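(* For every $\alpha\in[1/2,1)$ and every $\beta>1$, the function $$\frac{x^{\frac{1-\beta}{\alpha}}\,e^{x^{1/\alpha}}\,\gamma(\beta-1,x^{1/\alpha})}{\alpha\,\Gamma(\beta-1)}-E_{\alpha,\beta}(x)=\frac{1}{\Gamma(\beta)}\left(\frac{1}{\alpha}-1\right)\mathbb{E}\left[e^{-x\,(\mathbf{W}_\alpha\times\mathbf{B}_{1,\beta-1})}\right],\qquad x>0,$$ is completely monotonic on $(0,+\infty)$.
   Context: A smooth function $f$ on $(0,+\infty)$ is completely monotonic (CM) if $(-1)^n f^{(n)}(x)\ge 0$ for all $n\ge 0$ and $x>0$. The generalized Mittag-Leffler function is $E_{\alpha,\beta}(z)=\sum_{n\ge 0}\frac{z^n}{\Gamma(\beta+\alpha n)}$, and the incomplete Gamma function is $\gamma(u,x)=\int_0^x t^{u-1}e^{-t}\,dt$ for $u,x>0$. For $a\in(0,1)$, $\mathbf{Z}_a$ denotes the standard positive $a$-stable random variable, characterized by $\mathbb{E}[e^{-\lambda\mathbf{Z}_a}]=e^{-\lambda^a}$ for $\lambda\ge 0$; for $a=1$, $\mathbf{Z}_1=1$. Set $\mathbf{W}_\alpha=\left(\mathbf{Z}_{\frac{1-\alpha}{\alpha}}/\mathbf{Z}_{1-\alpha}\right)^{1-\alpha}$, where numerator and denominator are independent. $\mathbf{B}_{1,\beta-1}$ is a Beta random variable with parameters $1$ and $\beta-1$, i.e. with density $(\beta-1)(1-t)^{\beta-2}$ on $(0,1)$. The product $\mathbf{W}_\alpha\times\mathbf{B}_{1,\beta-1}$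 is a product of independent random variables.
   Formalization: The printed expectation identity is false (at α=1/2, β=2 the linear coefficient in x needs 2/3 where E[B]=1/2); the theorem proved has B_{1,β-1}^α in place of B_{1,β-1}, and the complete monotonicity claim is unchanged. *)

(* Defs.v *)
From HB Require Import structures.
From mathcomp Require Import all_boot all_order all_algebra.
From mathcomp Require Import all_classical all_reals all_analysis.

Set Implicit Arguments.
Unset Strict Implicit.
Unset Printing Implicit Defensive.

Import Order.TTheory GRing.Theory Num.Theory.
Import numFieldNormedType.Exports.

Local Open Scope classical_set_scope.
Local Open Scope ring_scope.

(* Only the restriction of f to (0, +oo) matters: derivatives are local. *)
Definition completely_monotonic (R : realType) (f : R -> R) : Prop :=
  forall (n : nat) (x : R), 0 < x ->
    derivable (derive1n n f) x 1 /\ 0 <= (-1) ^+ n * derive1n n f x.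

Section special_functions.
Variable R : realType.
Local Notation mu := (@lebesgue_measure R).

(* Euler's Gamma function; meaningful for 0 < u. *)
Definition Gamma (u : R) : R :=
  \int[mu]_(t in `]0, +oo[) (t `^ (u - 1) * expR (- t)).

(* The lower incomplete Gamma function; meaningful for 0 < u. *)
Definition incomplete_gamma (u x : R) : R :=
  \int[mu]_(t in `]0, x]) (t `^ (u - 1) * expR (- t)).

Definition mittag_leffler (a b z : R) : R :=
  limn (series (fun n : nat => z ^+ n / Gamma (b + a * n%:R))).

End special_functions.

Section random_variables.
Context d (T : measurableType d) (R : realType) (P : probability T R).

Definition independent_rv (X Y : T -> R) : Prop :=
  forall A B : set R, measurable A -> measurable B ->
    P (X @^-1` A `&` Y @^-1` B) = (P (X @^-1` A) * P (Y @^-1` B))%E.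

Definition std_positive_stable (a : R) (Z : T -> R) : Prop :=
  if a == 1 then {ae P, forall w, Z w = 1}
  else {ae P, forall w, 0 < Z w} /\
       forall l : R, 0 <= l ->
         'E_P[(fun w => expR (- (l * Z w)))]%E = (expR (- (l `^ a)))%:E.

(* Beta(1, c) law, with density c (1 - t)^(c - 1) on (0, 1). The library's
   beta_prob only has integer parameters. *)
Definition beta1_law (c : R) (B : T -> R) : Prop :=
  forall A : set R, measurable A ->
    P (B @^-1` A) =
    (\int[@lebesgue_measure R]_(t in A `&` `]0%R, 1%R[)
        (c * (1 - t) `^ (c - 1))%:E)%E.

(* W_alpha, built from Z1 of index (1 - alpha) / alpha and Z2 of index
   1 - alpha. It satisfies
     expR (y `^ alpha^-1) / alpha - mittag_leffler alpha 1 y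
       = (alpha^-1 - 1) * 'E_P[expR (- (y * W_alpha))].
   Taking y = x * t `^ alpha and averaging over t of law Beta(1, beta - 1)
   turns the left-hand side into Gamma beta * ML_remainder alpha beta x
   (see below), so the Beta variable B enters the representation of
   ML_remainder as B `^ alpha; with B itself the identity fails. *)
Definition W_var (alpha : R) (Z1 Z2 : T -> R) : T -> R :=
  fun w => (Z1 w / Z2 w) `^ (1 - alpha).

End random_variables.

Definition ML_remainder (R : realType) (alpha beta x : R) : R :=
  x `^ ((1 - beta) / alpha) * expR (x `^ alpha^-1)
    * incomplete_gamma (beta - 1) (x `^ alpha^-1)
    / (alpha * Gamma (beta - 1))
  - mittag_leffler alpha beta x.

(* Main.v *)
Require Import Defs.
From HB Require Import structures.
From mathcomp Require Import all_boot all_order all_algebra.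
From mathcomp Require Import all_classical all_reals all_analysis.
From mathcomp Require Import measurable_realfun gauss_integral lebesgue_integral_under.
From mathcomp Require Import ring lra.

(** Put [F y = e^(y^(1/a)) / a - E_(a,1) y]. Averaging [F (x t^a)] over [t] of law
    Beta(1, b - 1) gives [Gamma b] times the function of the theorem, term by term in the
    series, so everything reduces to [F].

    Rotating a ray of integration in the upper half-plane gives Stieltjes representations of
    [z^r / (z^r + 1)] for [0 < r < 1] and of [(z - 1) / (z^a - 1) - 1] for [1/2 <= a < 1].
    These are Laplace transforms, and uniqueness for the latter turns them into
      [E_(r,1) (- y) = c_r int_0^oo e^(- (u y)^(1/r)) / (u^2 + 2 u cos (pi r) + 1) du],
      [F y = c_a int_0^oo e^(- (u y)^(1/a)) / (u^2 - 2 u cos (pi a) + 1) du],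
    with [c_r = sin (pi r) / (pi r)]. For [r = 1 - a] the left-hand side of the first one is
    the Laplace transform of [Z_r^(- r)], as its moments show; integrating out [Z_(r/a)] there
    yields the right-hand side of the second one, up to the factor [r / a].

    Complete monotonicity of [F] does not need the random variables: with [p = 1/a] in ]1, 2],
    [F y = int_0^oo e^(- ((y + v)^p - y^p)) S (y + v) dv], where the exponent is minus a
    Bernstein function of [y] and [S] is a mixture of rescaled copies of
    [(y^p + 1) / (y^2 - 2 y cos (pi / p) + 1)], which is a Stieltjes function: the numerator
    vanishes at the poles. *)

Set Implicit Arguments.
Unset Strict Implicit.
Unset Printing Implicit Defensive.

Import Order.TTheory GRing.Theory Num.Theory.
Import numFieldNormedType.Exports.

Local Open Scope classical_set_scope.
Local Open Scope ring_scope.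

(** * Measurability, pointwise derivatives and substitutions *)

(** The complex analysis is done with pairs of real functions of the modulus and the angle. Cauchy's
    theorem becomes the constancy in the angle of an integral along a ray, and the residue at s
    becomes the concentration of a Poisson kernel at s. The delicate point is z = 1 on the positive
    axis, where z^a - 1 vanishes: holomorphy is therefore asked only on sectors strictly inside the
    upper half-plane, boundary values are taken off r = 1, and one growth bound, uniform in the
    angle, holds everything together.

    The bound a >= 1/2 enters through two facts: 1 - a <= a controls the growth of (z - 1) / (z^a -
    1) - 1, and p <= 2 makes x^(p - 2) completely monotone.

    For p > 1 the exponentials e^(- (u y)^p) are not completely monotone in y, so the integral for F
    does not show the claim by itself. The remedy is to work with e^(- (1 + u^p) y^p). The summand 1
    completes a numerator 1 to y^p + 1, which vanishes at e^(i pi / p) and e^(- i pi / p), the only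
    poles off the negative axis; the extra factor e^(- y^p) is absorbed by the difference (y + v)^p
    - y^p. *)

Lemma measurable_invr (R : realType) : measurable_fun [set: R] (@GRing.inv R).
Proof.
have -> : (@GRing.inv R) = fun x => if x == 0 then 0 else x^-1.
  by apply/funext => x; case: eqVneq => // ->; rewrite invr0.
apply: measurable_fun_if => //.
- apply: (measurable_fun_bool true).
  rewrite (_ : _ @^-1` _ = [set 0]) ?setTI//.
  by apply/seteqP; split => [_ /eqP ->//|_ -> /=]; rewrite eqxx.
- rewrite setTI; apply: open_continuous_measurable_fun.
    rewrite (_ : _ @^-1` _ = [set~ 0]).
      by apply: closed_openC; apply: accessible_closed_set1; apply: hausdorff_accessible; exact: Rhausdorff.
    by apply/seteqP; split => x /= => [/negbT/eqP|/eqP/negbTE].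
  move=> x; rewrite inE/= => /negbT/eqP x0; apply: inv_continuous; exact/eqP.
Qed.

Lemma measurable_funV d (T : measurableType d) (R : realType) (D : set T) (f : T -> R) :
  measurable_fun D f -> measurable_fun D (fun x => (f x)^-1).
Proof. by move=> mf; apply: (measurableT_comp (@measurable_invr R)). Qed.

Section measurable_functions.
Context d (T : measurableType d) (R : realType) (D : set T).
Implicit Types f : T -> R.

Lemma measurable_fexpR f : measurable_fun D f -> measurable_fun D (fun x => expR (f x)).
Proof. by move=> mf; apply: (measurableT_comp (@measurable_expR R)). Qed.

Lemma measurable_fpowR f p : measurable_fun D f -> measurable_fun D (fun x => f x `^ p).
Proof. by move=> mf; apply: (measurableT_comp (@measurable_powR R p)). Qed.

Lemma measurable_fnorm f : measurable_fun D f -> measurable_fun D (fun x => `|f x|).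
Proof. by move=> mf; exact: measurableT_comp. Qed.

End measurable_functions.

Ltac mfun := repeat first
  [ exact: measurable_cst | exact: measurable_id | exact: measurable_fst
  | exact: measurable_snd | assumption
  | apply: measurable_fexpR | apply: measurable_fpowR | apply: measurable_fnorm
  | apply: measurable_funM | apply: measurable_funD | apply: measurable_funB
  | apply: measurable_funN | apply: measurable_funX | apply: measurable_funV ].

Lemma is_derive_continuous (R : realType) (f : R -> R) (x df : R) :
  is_derive x 1 f df -> {for x, continuous f}.
Proof. by move=> [df1 _]; exact/differentiable_continuous/derivable1_diffP. Qed.

Lemma continuous_powR (R : realType) (p x : R) : 0 < x ->
  {for x, continuous (fun y : R => y `^ p)}.
Proof. by move=> x0; exact/is_derive_continuous/is_derive1_powR. Qed.

Section pointwise_derivatives.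
Variable R : realType.
Implicit Types f g : R -> R.

Lemma is_derive_fC (c x : R) : is_derive x 1 (fun=> c) 0.
Proof. exact: is_derive_cst. Qed.

Lemma is_derive_fid (x : R) : is_derive x 1 (fun t => t) 1.
Proof. exact: is_derive_id. Qed.

Lemma is_derive_fpowR (p x : R) : 0 < x ->
  is_derive x 1 (fun t => t `^ p) (p * x `^ (p - 1)).
Proof. exact: is_derive1_powR. Qed.

Lemma is_derive_fD f g (x df dg : R) : is_derive x 1 f df -> is_derive x 1 g dg ->
  is_derive x 1 (fun t => f t + g t) (df + dg).
Proof. by move=> hf hg; exact: (is_deriveD hf hg). Qed.

Lemma is_derive_fN f (x df : R) : is_derive x 1 f df ->
  is_derive x 1 (fun t => - f t) (- df).
Proof. by move=> hf; exact: (is_deriveN hf). Qed.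

Lemma is_derive_fB f g (x df dg : R) : is_derive x 1 f df -> is_derive x 1 g dg ->
  is_derive x 1 (fun t => f t - g t) (df - dg).
Proof. by move=> hf hg; exact: (is_deriveB hf hg). Qed.

Lemma is_derive_fM f g (x df dg : R) : is_derive x 1 f df -> is_derive x 1 g dg ->
  is_derive x 1 (fun t => f t * g t) (df * g x + f x * dg).
Proof.
move=> hf hg; apply: (is_derive_eq (is_deriveM hf hg)).
by rewrite /GRing.scale/= addrC (mulrC df).
Qed.

Lemma is_derive_fZ k f (x df : R) : is_derive x 1 f df ->
  is_derive x 1 (fun t => k * f t) (k * df).
Proof. by move=> hf; exact: (is_deriveZ k hf). Qed.

Lemma is_derive_fV f (x df : R) : is_derive x 1 f df -> f x != 0 ->
  is_derive x 1 (fun t => (f t)^-1) (- df / f x ^+ 2).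
Proof.
move=> [hf1 hf2] fx; split; first exact: derivableV.
by rewrite deriveV// hf2 /GRing.scale/=; field.
Qed.

Lemma is_derive_fcomp f g (x df dg : R) : is_derive (g x) 1 f df -> is_derive x 1 g dg ->
  is_derive x 1 (fun t => f (g t)) (df * dg).
Proof. by move=> hf hg; exact: (is_derive1_comp hf hg). Qed.

End pointwise_derivatives.

(** Two indicators move the restriction to the rectangle into the integrand, so the sign condition
    is asked only on [D1] times [D2], and Tonelli on the full product applies. *)
Lemma tonelli_on d1 d2 (T1 : measurableType d1) (T2 : measurableType d2)
    (R : realType) (m1 : {sigma_finite_measure set T1 -> \bar R})
    (m2 : {sigma_finite_measure set T2 -> \bar R})
    (D1 : set T1) (D2 : set T2) (f : T1 -> T2 -> R) :
  measurable D1 -> measurable D2 ->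
  measurable_fun setT (fun z : T1 * T2 => f z.1 z.2) ->
  (forall x y, D1 x -> D2 y -> 0 <= f x y) ->
  (\int[m1]_(x in D1) \int[m2]_(y in D2) (f x y)%:E =
   \int[m2]_(y in D2) \int[m1]_(x in D1) (f x y)%:E)%E.
Proof.
move=> mD1 mD2 mf f0.
pose g (z : T1 * T2) := (\1_D1 z.1 * (\1_D2 z.2 * f z.1 z.2)).
have mg : measurable_fun setT (EFin \o g).
  apply/measurable_EFinP; apply: measurable_funM.
    by apply: (measurableT_comp (measurable_indic mD1)).
  apply: measurable_funM => //.
  by apply: (measurableT_comp (measurable_indic mD2)).
have g0 z : (0 <= (EFin \o g) z)%E.
  rewrite /g/= lee_fin; case: z => x y /=; rewrite !indicE.
  case: (boolP (x \in D1)) => xD; last by rewrite mul0r.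
  case: (boolP (y \in D2)) => yD; last by rewrite mul0r mulr0.
  by rewrite !mul1r; apply: f0; apply/set_mem.
have := fubini_tonelli (m1 := m1) (m2 := m2) (EFin \o g) mg g0.
rewrite /fubini_F /fubini_G.
have -> : (\int[m1]_x \int[m2]_y (EFin \o g) (x, y))%E =
  (\int[m1]_(x in D1) \int[m2]_(y in D2) (f x y)%:E)%E.
  rewrite [RHS]integral_mkcond; apply: eq_integral => x _.
  rewrite patchE; case: ifPn => xD; last first.
    by rewrite integral0_eq// => y _; rewrite /g/= indicE (negbTE xD) mul0r.
  rewrite [RHS]integral_mkcond; apply: eq_integral => y _.
  rewrite /g/= patchE !indicE xD mul1r.
  by case: ifPn => yD; rewrite ?mul1r ?mul0r.
have -> : (\int[m2]_y \int[m1]_x (EFin \o g) (x, y))%E =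
  (\int[m2]_(y in D2) \int[m1]_(x in D1) (f x y)%:E)%E.
  rewrite [RHS]integral_mkcond; apply: eq_integral => y _.
  rewrite patchE; case: ifPn => yD; last first.
    by rewrite integral0_eq// => x _; rewrite /g/= !indicE (negbTE yD) mul0r mulr0.
  rewrite [RHS]integral_mkcond; apply: eq_integral => x _.
  rewrite /g/= patchE !indicE yD mul1r.
  by case: ifPn => xD; rewrite ?mul1r ?mul0r.
by [].
Qed.

(** * Changes of variables for nonnegative integrands on open intervals *)

Section substitution.
Variable R : realType.
Local Notation mu := (@lebesgue_measure R).

Lemma cvg_integral_exhaust (D : set R) (a b : nat -> R) (f : R -> R) :
  (forall n m, (n <= m)%N -> a m <= a n) ->
  (forall n m, (n <= m)%N -> b n <= b m) ->
  \bigcup_n `[a n, b n]%classic = D ->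
  measurable_fun D f -> (forall x, D x -> 0 <= f x) ->
  (\int[mu]_(x in `[a n, b n]) (f x)%:E)%E @[n --> \oo] -->
  (\int[mu]_(x in D) (f x)%:E)%E.
Proof.
move=> ha hb <- mf f0.
apply: (@ge0_nondecreasing_set_cvg_integral _ (measurableTypeR R) R (fun n => `[a n, b n]%classic) (EFin \o f) mu).
- move=> n m nm; apply/subsetPset => x /=; rewrite !in_itv/= => /andP[h1 h2].
  by rewrite (le_trans (ha _ _ nm) h1) (le_trans h2 (hb _ _ nm)).
- by [].
- move=> n; apply/measurable_EFinP; apply: measurable_funS mf => //.
    by apply: bigcup_measurable.
  by move=> x; exists n.
- by move=> n x xn; rewrite lee_fin; apply: f0; exists n.
Qed.

(** Substitution on the compact intervals [[a n, b n]] passes to the limit by monotone convergence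
    on both sides, so that neither integral has to be finite. *)
Lemma ge0_subst_exhaust (D D' : set R) (a b : nat -> R) (F F' G : R -> R) :
  (forall n m, (n <= m)%N -> a m <= a n) ->
  (forall n m, (n <= m)%N -> b n <= b m) ->
  (forall n, a n <= b n) ->
  \bigcup_n `[a n, b n]%classic = D -> \bigcup_n `[F (a n), F (b n)]%classic = D' ->
  {in D &, {homo F : x y / x < y}} ->
  (forall x, D x -> is_derive x 1 F (F' x)) ->
  open D -> {in D, continuous F'} -> (forall x, D x -> 0 <= F' x) ->
  open D' -> {in D', continuous G} ->
  (forall x, D' x -> 0 <= G x) ->
  (\int[mu]_(x in D') (G x)%:E = \int[mu]_(x in D) (G (F x) * F' x)%:E)%E.
Proof.
move=> ha hb hab UD UD' incF dF oD cF' F'0 oD' cG G0.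
have Dn n x : a n <= x <= b n -> D x.
  by move=> h; rewrite -UD; exists n => //=; rewrite in_itv.
have Da n : D (a n) by apply: (Dn n); rewrite lexx hab.
have Db n : D (b n) by apply: (Dn n); rewrite lexx hab.
have nincF x y : D x -> D y -> x <= y -> F x <= F y.
  move=> Dx Dy; rewrite le_eqVlt => /predU1P[->//|xy].
  by apply/ltW/incF => //; rewrite inE.
have cF x : D x -> {for x, continuous F}.
  by move=> Dx; apply: differentiable_continuous; apply/derivable1_diffP;
     have := dF x Dx => -[].
have DF x : D x -> D' (F x).
  rewrite -{1}UD => -[n _ /=]; rewrite in_itv/= => /andP[h1 h2].
  rewrite -UD'; exists n => //=; rewrite in_itv/=.
  have Dx : D x by apply: (Dn n); rewrite h1 h2.
  by rewrite !nincF.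
have F'E x : D x -> (derive1 F) x = F' x.
  by move=> Dx; rewrite derive1E; have [_ ->] := dF x Dx.
have c1 : (\int[mu]_(x in `[F (a n), F (b n)]) (G x)%:E)%E @[n --> \oo] -->
  (\int[mu]_(x in D') (G x)%:E)%E.
  apply: (@cvg_integral_exhaust D' (F \o a) (F \o b)) => //.
  - by move=> n m nm /=; apply: nincF => //; exact: ha.
  - by move=> n m nm /=; apply: nincF => //; exact: hb.
  - by apply: open_continuous_measurable_fun.
have cGF : {in D, continuous (fun x => G (F x) * F' x)}.
  move=> x xD; apply: cvgM; last exact: cF'.
  apply: continuous_comp; first by apply: cF; rewrite inE in xD.
  by apply: cG; rewrite inE; apply: DF; rewrite inE in xD.
have c2 : (\int[mu]_(x in `[a n, b n]) (G (F x) * F' x)%:E)%E @[n --> \oo] -->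
  (\int[mu]_(x in D) (G (F x) * F' x)%:E)%E.
  apply: (@cvg_integral_exhaust D a b) => //.
  - by apply: open_continuous_measurable_fun.
  - by move=> x Dx; apply: mulr_ge0; [apply/G0/DF | exact: F'0].
apply: cvg_unique c1 _ => //.
rewrite (_ : (fun n => _) = (fun n => \int[mu]_(x in `[a n, b n]) (G (F x) * F' x)%:E)%E) //.
apply/funext => n.
(* Degenerate intervals do occur: the exhaustion of the half-line used below starts with [1, 1]. *)
have := hab n; rewrite le_eqVlt => /predU1P[e|lab].
  by rewrite e !set_itv1 !integral_set1.
have near_F'E x : D x -> \forall y \near x, (derive1 F) y = F' y.
  move=> Dx; near=> y; apply: F'E; near: y; exact: open_nbhs_nbhs.
have cdF x : D x -> {for x, continuous (derive1 F)}.
  move=> Dx; rewrite /prop_for /continuous_at F'E//.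
  apply: cvg_trans (cF' x _); last by rewrite inE.
  by apply: near_eq_cvg; near=> y; apply/esym; near: y; exact: near_F'E.
rewrite integration_by_substitution_increasing //.
- apply: eq_integral => x; rewrite inE/= in_itv/= => xab.
  by congr (_%:E); rewrite -[LHS]/(G (F x) * derive1 F x) F'E//; exact: (Dn n).
- by move=> x y; rewrite !in_itv/= => hx hy; apply: incF; rewrite inE; exact: (Dn n).
- move=> x; rewrite in_itv/= => /andP[/ltW h1 /ltW h2]; apply: cdF.
  by apply: (Dn n); rewrite h1 h2.
- by apply/cvg_ex; exists ((derive1 F) (a n)); apply: cvg_at_right_filter; exact: cdF.
- by apply/cvg_ex; exists ((derive1 F) (b n)); apply: cvg_at_left_filter; exact: cdF.
- split.
  + move=> x; rewrite in_itv/= => /andP[/ltW h1 /ltW h2].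
    by have [] := dF x _ => //; apply: (Dn n); rewrite h1 h2.
  + by apply: cvg_at_right_filter; exact: cF.
  + by apply: cvg_at_left_filter; exact: cF.
- apply: continuous_in_subspaceT => x; rewrite inE/= in_itv/= => h.
  apply: cG; rewrite inE -UD'; exists n => //=; by rewrite in_itv.
Unshelve. all: by end_near. Qed.

Lemma bigcup_itv_oy : \bigcup_n `[(n.+1%:R)^-1 : R, n.+1%:R]%classic = `]0, +oo[%classic.
Proof.
apply/seteqP; split => x /=.
  move=> [n _ /=]; rewrite !in_itv/= andbT => /andP[h _].
  by apply: lt_le_trans h; rewrite invr_gt0.
rewrite in_itv/= andbT => x0.
pose N := Num.truncn (x + x^-1).
exists N => //=; rewrite in_itv/=.
have hN : x + x^-1 < N.+1%:R by apply: truncnS_gt.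
apply/andP; split.
  rewrite -(invrK x) lef_pV2 ?posrE ?invr_gt0//.
  by apply/ltW/(le_lt_trans _ hN); rewrite lerDr ltW.
by apply/ltW/(le_lt_trans _ hN); rewrite lerDl invr_ge0 ltW.
Qed.

Lemma invn_anti (n m : nat) : (n <= m)%N -> (m.+1%:R)^-1 <= (n.+1%:R)^-1 :> R.
Proof. by move=> nm; rewrite lef_pV2 ?posrE// ler_nat. Qed.

Lemma natS_mono (n m : nat) : (n <= m)%N -> n.+1%:R <= m.+1%:R :> R.
Proof. by move=> nm; rewrite ler_nat. Qed.

Lemma invn_le_n (n : nat) : (n.+1%:R)^-1 <= n.+1%:R :> R.
Proof. by apply: (@le_trans _ _ 1); [rewrite invf_le1// ler1n|rewrite ler1n]. Qed.

Lemma open_oy : open (`]0, +oo[%classic : set R).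
Proof. exact: interval_open. Qed.

Lemma ge0_subst_scale (c : R) (G : R -> R) : 0 < c ->
  {in `]0, +oo[%classic, continuous G} ->
  (forall x, 0 < x -> 0 <= G x) ->
  (\int[mu]_(x in `]0%R, +oo[) (G x)%:E =
   \int[mu]_(x in `]0%R, +oo[) (G (c * x) * c)%:E)%E.
Proof.
move=> c0 cG G0.
apply: (@ge0_subst_exhaust _ _ (fun n => (n.+1%:R)^-1) (fun n => n.+1%:R) (fun x => c * x) (fun=> c)) => //.
- exact: invn_anti.
- exact: natS_mono.
- exact: invn_le_n.
- exact: bigcup_itv_oy.
- rewrite -bigcup_itv_oy; apply/seteqP; split => x /= [n _ /=]; rewrite !in_itv/= => /andP[h1 h2].
    have x0 : 0 < x by apply: lt_le_trans h1; rewrite mulr_gt0.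
    have := @in_setT _ x; have : (`]0%R, +oo[%classic : set R) x by rewrite /= in_itv/= x0.
    by rewrite -bigcup_itv_oy => -[m _ /=]; exists m.
  have x0 : 0 < x by apply: lt_le_trans h1; rewrite invr_gt0.
  have : (`]0%R, +oo[%classic : set R) (x / c) by rewrite /= in_itv/= divr_gt0.
  rewrite -bigcup_itv_oy => -[m _ /=]; rewrite in_itv/= => /andP[k1 k2]; exists m => //=.
  by rewrite in_itv/= mulrC -ler_pdivlMr// k1 mulrC -ler_pdivrMr.
- by move=> x y _ _ xy; rewrite ltr_pM2l.
- by move=> x _; apply: (is_derive_eq (is_deriveZ c (is_derive_id x 1))); rewrite scaler1.
- by move=> x _; exact: cst_continuous.
- by move=> x _; exact: ltW.
- by move=> x /=; rewrite in_itv/= andbT => /G0.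
Qed.

Lemma ge0_subst_powR (p : R) (G : R -> R) : 0 < p ->
  {in `]0, +oo[%classic, continuous G} ->
  (forall x, 0 < x -> 0 <= G x) ->
  (\int[mu]_(x in `]0%R, +oo[) (G x)%:E =
   \int[mu]_(x in `]0%R, +oo[) (G (x `^ p) * (p * x `^ (p - 1)))%:E)%E.
Proof.
move=> p0 cG G0.
apply: (@ge0_subst_exhaust _ _ (fun n => (n.+1%:R)^-1) (fun n => n.+1%:R) (fun x => x `^ p) (fun x => p * x `^ (p - 1))) => //.
- exact: invn_anti.
- exact: natS_mono.
- exact: invn_le_n.
- exact: bigcup_itv_oy.
- apply/seteqP; split => x /=.
    move=> [n _ /=]; rewrite !in_itv/= andbT => /andP[h1 h2].
    by apply: lt_le_trans h1; rewrite powR_gt0// invr_gt0.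
  rewrite in_itv/= andbT => x0.
  have : (`]0%R, +oo[%classic : set R) (x `^ p^-1) by rewrite /= in_itv/= powR_gt0.
  rewrite -bigcup_itv_oy => -[m _ /=]; rewrite in_itv/= => /andP[k1 k2]; exists m => //=.
  have -> : x = (x `^ p^-1) `^ p by rewrite -powRrM mulVf ?powRr1 ?gt_eqF// ltW.
  by rewrite in_itv/=; apply/andP; split; apply: ge0_ler_powR => //; rewrite ?nnegrE ?powR_ge0 ?invr_ge0// ltW.
- by move=> x y; rewrite !inE/= !in_itv/= !andbT => x0 y0 xy; apply: gt0_ltr_powR; rewrite ?nnegrE ?ltW.
- by move=> x /=; rewrite in_itv/= andbT => x0; exact: is_derive1_powR.
- move=> x; rewrite inE/= in_itv/= andbT => x0.
  apply: cvgM; first exact: cvg_cst.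
  exact: continuous_powR.
- by move=> x _; rewrite mulr_ge0 ?powR_ge0// ltW.
- by move=> x /=; rewrite in_itv/= andbT => /G0.
Qed.

End substitution.

(** * Integrals of real functions and uniqueness for the Laplace transform *)

Section integral_tools.
Context d (T : measurableType d) (R : realType) (m : {measure set T -> \bar R}).
Variable D : set T.
Hypothesis mD : measurable D.
Implicit Types f g : T -> R.

Lemma EFin_Rintegral f : m.-integrable D (EFin \o f) ->
  (\int[m]_(x in D) (f x)%:E = (\int[m]_(x in D) f x)%:E)%E.
Proof. by move=> fi; rewrite /Rintegral fineK//; exact: integrable_fin_num. Qed.

Lemma integrable_dom f g : measurable_fun D f ->
  (forall x, D x -> `|f x| <= g x) -> m.-integrable D (EFin \o g) ->
  m.-integrable D (EFin \o f).
Proof.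
move=> mf fg; apply: le_integrable => //; first exact/measurable_EFinP.
by move=> x Dx /=; rewrite lee_fin (le_trans (fg _ Dx))// ler_norm.
Qed.

Lemma integrable_mfun f : m.-integrable D (EFin \o f) -> measurable_fun D f.
Proof. by move=> /measurable_int/measurable_EFinP. Qed.

Lemma integrable_ge0_lty f : measurable_fun D f -> (forall x, D x -> 0 <= f x) ->
  (\int[m]_(x in D) (f x)%:E < +oo)%E -> m.-integrable D (EFin \o f).
Proof.
move=> mf f0 foo; apply/integrableP; split; first exact/measurable_EFinP.
by under eq_integral => x /set_mem xD do rewrite /= ger0_norm ?f0//.
Qed.

Lemma ge0_integral_eq_integrable f r : measurable_fun D f ->
  (forall x, D x -> 0 <= f x) ->
  (\int[m]_(x in D) (f x)%:E = r%:E)%E -> m.-integrable D (EFin \o f).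
Proof. by move=> mf f0 fr; apply: integrable_ge0_lty => //; rewrite fr ltry. Qed.

Lemma integrableZ f k : m.-integrable D (EFin \o f) ->
  m.-integrable D (EFin \o (fun x => k * f x)).
Proof. by move=> fi; apply: (@integrableZl _ _ _ m D mD k (EFin \o f)). Qed.

Lemma integrableDr f g : m.-integrable D (EFin \o f) ->
  m.-integrable D (EFin \o g) -> m.-integrable D (EFin \o (fun x => f x + g x)).
Proof. by move=> fi gi; apply: (@integrableD _ _ _ m D mD (EFin \o f) (EFin \o g)). Qed.

Lemma integrableBr f g : m.-integrable D (EFin \o f) ->
  m.-integrable D (EFin \o g) -> m.-integrable D (EFin \o (fun x => f x - g x)).
Proof. by move=> fi gi; apply: (@integrableB _ _ _ m D mD (EFin \o f) (EFin \o g)). Qed.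

Lemma ge0_integralZl_fin f k : measurable_fun D f ->
  (forall x, D x -> 0 <= f x) -> 0 <= k ->
  (\int[m]_(x in D) (k * f x)%:E = k%:E * \int[m]_(x in D) (f x)%:E)%E.
Proof.
move=> mf f0 k0; rewrite -ge0_integralZl//; exact/measurable_EFinP.
Qed.

Lemma dominated_Rcvg (f_ : nat -> T -> R) f g :
  (forall n, measurable_fun D (f_ n)) -> measurable_fun D f ->
  {ae m, forall x, D x -> f_ ^~ x @ \oo --> f x} ->
  m.-integrable D (EFin \o g) ->
  (forall n x, D x -> `|f_ n x| <= g x) ->
  m.-integrable D (EFin \o f) /\
  \int[m]_(x in D) f_ n x @[n --> \oo] --> \int[m]_(x in D) f x.
Proof.
move=> mf_ mf cf ig fg.
have := @dominated_convergence _ T R m D mD (fun n => EFin \o f_ n) (EFin \o f) (EFin \o g).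
case.
- by move=> n; exact/measurable_EFinP.
- exact/measurable_EFinP.
- apply: filterS cf => x h Dx; apply: cvg_EFin; [exact: nearW|exact: h].
- by [].
- by apply: aeW => x n Dx /=; rewrite lee_fin; exact: fg.
move=> fi _ c; split => //.
apply: fine_cvg; rewrite (_ : (fine _)%:E = \int[m]_(x in D) (EFin \o f) x)%E //.
by rewrite EFin_Rintegral.
Qed.

(** The extended-valued sum of the absolute values dominates every partial sum, and Tonelli for
    series makes it integrable. This is the tool for the termwise integrations of the Mittag-Leffler
    and exponential series below. *)
Lemma cvg_Rintegral_series (f : nat -> T -> R) (F : T -> R) :
  (forall n, measurable_fun D (f n)) ->
  (forall x, D x -> series (f ^~ x) @ \oo --> F x) ->
  (\sum_(0 <= n <oo) \int[m]_(x in D) `|f n x|%:E < +oo)%E ->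
  m.-integrable D (EFin \o F) /\
  series (fun n => \int[m]_(x in D) f n x) @ \oo --> \int[m]_(x in D) F x.
Proof.
move=> mf cF foo.
pose g x := (\sum_(0 <= n <oo) `|f n x|%:E)%E.
have mfe n : measurable_fun D (fun x => `|f n x|%:E).
  by apply/measurable_EFinP; exact: measurableT_comp.
have g0 x : (0 <= g x)%E by apply: nneseries_ge0.
have gi : m.-integrable D g.
  apply/integrableP; split.
    by apply: ge0_emeasurable_sum.
  under eq_integral do rewrite gee0_abs//.
  by rewrite integral_nneseries.
have fi n : m.-integrable D (EFin \o f n).
  apply/integrableP; split; first exact/measurable_EFinP.
  apply: le_lt_trans foo.
  apply: le_trans (nneseries_lim_ge n.+1 _).
    by rewrite big_nat_recr//= leeDr//; apply: sume_ge0 => k _; apply: integral_ge0.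
  by move=> k _ _; apply: integral_ge0.
pose s n x := series (f ^~ x) n.
have ms n : measurable_fun D (s n).
  rewrite /s; under eq_fun do rewrite /series/=.
  exact: measurable_sum.
have mF : measurable_fun D F by apply: (measurable_fun_cvg ms).
have := @dominated_convergence _ T R m D mD (fun n => EFin \o s n) (EFin \o F) g.
case => //.
- by move=> n; exact/measurable_EFinP.
- exact/measurable_EFinP.
- by apply: aeW => x Dx; apply: cvg_EFin; [exact: nearW|exact: cF].
- apply: aeW => x n Dx /=.
  apply: (@le_trans _ _ (\sum_(0 <= k < n) `|f k x|%:E)%E).
    by rewrite sumEFin lee_fin; exact: ler_norm_sum.
  by apply: (nneseries_lim_ge n).
move=> Fi _ c; split => //.
have e n : series (fun n => \int[m]_(x in D) f n x) n = \int[m]_(x in D) s n x.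
  rewrite /series/= /s /series/= /Rintegral.
  under [in RHS]eq_integral do rewrite -sumEFin.
  rewrite integral_sum//.
  by under [in RHS]eq_bigr => k _ do rewrite (EFin_Rintegral (fi k)); rewrite sumEFin.
rewrite (funext e).
apply: fine_cvg; rewrite (_ : (fine _)%:E = \int[m]_(x in D) (EFin \o F) x)%E //.
by rewrite EFin_Rintegral.
Qed.

End integral_tools.

Section laplace_uniqueness.
Variable R : realType.
Local Notation mu := (@lebesgue_measure R).
Local Notation oy := (`]0%R, +oo[%classic : set R).

(** In the variable x = e^(-t) the hypothesis says that [h] is orthogonal to all polynomials. If
    [h t0] is positive, the powers of a polynomial that exceeds 1 only close to x0 = e^(-t0) blow up
    where [h] is positive and cost at most the integral of |h| elsewhere, so their integral against
    [h] cannot stay 0. *)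
Let laplace_uniq_pos (h : R -> R) (t0 : R) :
  mu.-integrable oy (EFin \o h) ->
  {in oy, continuous h} ->
  (forall n : nat, \int[mu]_(t in oy) (expR (- t) ^+ n * h t) = 0) ->
  0 < t0 -> ~ 0 < h t0.
Proof.
move=> hi ch h0 t00 ht0.
have moy : measurable (oy : set (measurableTypeR R)) by exact: measurable_itv.
have mh := integrable_mfun hi.
have en1 (t : R) : 0 < t -> 0 < expR (- t) < 1.
  by move=> t1; rewrite expR_gt0 expR_lt1 oppr_lt0.
pose x0 := expR (- t0).
have ix (p : R -> R) (n : nat) : measurable_fun setT p -> (forall t : R, 0 < t -> `|p t| <= n%:R) ->
  mu.-integrable oy (EFin \o (fun t => p t * h t)).
  move=> mp pn; apply: (integrable_dom moy (g := fun t => n%:R * `|h t|)).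
  - by apply: measurable_funM => //; exact: measurable_funTS.
  - move=> t; rewrite /= in_itv/= andbT => t1.
    by rewrite normrM ler_wpM2r// pn.
  - exact: (integrableZ moy _ (integrable_norm hi)).
(* As a polynomial in x = e^(-t) it is at least 1 exactly when |x - x0| <= [eta], and it lies
   between 0 and 2 on ]0, 1[ for [eta] below 1. *)
pose p (eta t : R) := 1 - (expR (- t) - x0) ^+ 2 + eta ^+ 2.
have mE : measurable_fun [set: R] (fun t : R => expR (- t)).
  by apply: measurableT_comp.
have mp (eta : R) : measurable_fun setT (p eta).
  by apply: measurable_funD => //; apply: measurable_funB => //;
    apply: measurable_funX; apply: measurable_funB.
have p01 (eta t : R) : 0 < eta < 1 -> 0 < t -> 0 <= p eta t <= 2.
  move=> /andP[eta0 eta1] t1; have /andP[a1 a2] := en1 t t1.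
  have /andP[b1 b2] := en1 t0 t00; rewrite -/x0 in b1 b2; rewrite /p.
  have h1 : (expR (- t) - x0) ^+ 2 <= 1 by nra.
  have h2 : eta ^+ 2 <= 1 by nra.
  have h3 := sqr_ge0 eta; have h4 := sqr_ge0 (expR (- t) - x0).
  by apply/andP; split; lra.
(* The extra power [k] makes the induction on [n] go through: one factor [p eta t] is a combination
   of the shifts of [k] by 0, 1 and 2. *)
have pz (eta : R) : 0 < eta < 1 -> forall n k,
    \int[mu]_(t in oy) (p eta t ^+ n * expR (- t) ^+ k * h t) = 0.
  move=> eta01; elim=> [|n ih] k.
    by under eq_Rintegral do rewrite expr0 mul1r; exact: h0.
  have J j : mu.-integrable oy (EFin \o (fun t => p eta t ^+ n * expR (- t) ^+ j * h t)).
    apply: (ix (fun t => p eta t ^+ n * expR (- t) ^+ j) (2 ^ n)%N).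
      by apply: measurable_funM; exact: measurable_funX.
    move=> t t1; have /andP[e0 e1] := en1 t t1.
    have /andP[q0 q2] := p01 eta t eta01 t1.
    rewrite ger0_norm ?mulr_ge0 ?exprn_ge0// ?(ltW e0)//.
    rewrite natrX -[leRHS]mulr1 ler_pM ?exprn_ge0 ?(ltW e0)//.
      by rewrite lerXn2r// nnegrE.
    by rewrite exprn_ile1// ltW.
  have I j c := integrableZ moy c (J j).
  transitivity (\int[mu]_(t in oy)
     ((1 - x0 ^+ 2 + eta ^+ 2) * (p eta t ^+ n * expR (- t) ^+ k * h t)
      + ((2 * x0) * (p eta t ^+ n * expR (- t) ^+ k.+1 * h t)
      + (- 1) * (p eta t ^+ n * expR (- t) ^+ k.+2 * h t)))).
    by apply: eq_Rintegral => t _; rewrite {1}exprS {1}/p !exprS; ring.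
  rewrite RintegralD//; last by apply: integrableDr.
  rewrite RintegralD// !RintegralZl// ?ih ?mulr0 ?addr0//.
pose d := t0 / 2.
have : \forall t \near t0, h t0 / 2 < h t.
  have c0 : h t @[t --> t0] --> h t0 by apply: ch; rewrite inE/= in_itv/= t00.
  by have := @cvgr_gt _ _ _ _ _ _ c0 (h t0 / 2); apply; rewrite ltr_pdivrMr// ltr_pMr// ltr1n.
move=> /nbhs_ballP[e /= e0 he].
pose dl := Num.min (e / 2) (t0 / 2).
have dl0 : 0 < dl by rewrite lt_min !divr_gt0.
have dle : dl < e by rewrite gt_min ltr_pdivrMr// ltr_pMr// ltr1n.
have dlt : dl < t0 by rewrite gt_min; apply/orP; right; rewrite ltr_pdivrMr// ltr_pMr// ltr1n.
(* Half-width in x: |x - x0| < [eta] confines t to the interval of radius [dl] around [t0], where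
   [h] exceeds [h t0 / 2]. *)
pose eta := Num.min (x0 - expR (- (t0 + dl))) (expR (- (t0 - dl)) - x0).
have eta0 : 0 < eta.
  by rewrite lt_min !subr_gt0 !ltr_expR !ltrN2 ltrDl dl0 gtrBl dl0.
have /andP[x00 x01] := en1 t0 t00; rewrite -/x0 in x00 x01.
have etax : eta < x0 by rewrite gt_min ltrBlDr ltrDl expR_gt0.
have eta1 : eta < 1 by exact: lt_trans x01.
have hpos (t : R) : `|expR (- t) - x0| < eta -> h t0 / 2 < h t.
  have k1 : eta <= x0 - expR (- (t0 + dl)) by rewrite ge_min lexx.
  have k2 : eta <= expR (- (t0 - dl)) - x0 by rewrite ge_min lexx orbT.
  rewrite ltr_norml => /andP[l1 l2].
  have g1 : expR (- (t0 + dl)) < expR (- t) by lra.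
  have g2 : expR (- t) < expR (- (t0 - dl)) by lra.
  rewrite !ltr_expR in g1 g2.
  apply: he; rewrite /ball/= ltr_norml; apply/andP; split; lra.
pose t2 := - ln (x0 - eta / 2).
have et2 : expR (- t2) = x0 - eta / 2 by rewrite opprK lnK// posrE; lra.
have t02 : t0 < t2 by rewrite -ltrN2 -ltr_expR et2 -/x0; lra.
(* Minimum of the polynomial over |x - x0| <= eta / 2, that is 1 + eta^2 - (eta / 2)^2. In t, this
   region contains [[t0, t2]]. *)
pose q := 1 + 3 / 4 * eta ^+ 2.
have q1 : 1 < q by rewrite /q ltrDl mulr_gt0// exprn_gt0.
have eta01 : 0 < eta < 1 by rewrite eta0 eta1.
pose J := `[t0, t2]%classic : set R.
(* On [[t0, t2]] the power is at least q^n; elsewhere within distance [eta] of x0 the integrand is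
   nonnegative; further away the power is at most 1, which costs |h|. *)
have ineq n (t : R) : 0 < t ->
    q ^+ n * (h t0 / 2) * \1_J t - `|h t| <= p eta t ^+ n * expR (- t) ^+ 0 * h t.
  move=> t1; have /andP[p0 p2] := p01 eta t eta01 t1.
  rewrite expr0 mulr1 indicE.
  case: (boolP (t \in J)) => /= [+|tJ].
    rewrite mulr1 => /set_mem; rewrite /J/= in_itv/= => /andP[j1 j2].
    have u1 : expR (- t) <= x0 by rewrite ler_expR lerN2.
    have u2 : x0 - eta / 2 <= expR (- t) by rewrite -et2 ler_expR lerN2.
    have hh : h t0 / 2 < h t by apply: hpos; rewrite ltr_norml; apply/andP; split; lra.
    have pq : q <= p eta t.
      rewrite /p /q; have : (expR (- t) - x0) ^+ 2 <= (eta / 2) ^+ 2.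
        by rewrite -sqrrN lerXn2r// ?nnegrE; lra.
      rewrite exprMn; lra.
    rewrite lerBlDr (@le_trans _ _ (p eta t ^+ n * h t)) ?lerDl//.
    apply: ler_pM => //; last exact: ltW.
    - by rewrite exprn_ge0// (le_trans _ (ltW q1)).
    - by rewrite divr_ge0// ltW.
    - by rewrite lerXn2r// ?nnegrE// (le_trans _ (ltW q1)).
  rewrite mulr0 sub0r.
  have [/hpos hh|far] := ltP `|expR (- t) - x0| eta.
    apply: (@le_trans _ _ 0); first by rewrite oppr_le0.
    by rewrite mulr_ge0 ?exprn_ge0// ltW// (le_lt_trans _ hh)// divr_ge0// ltW.
  have pl1 : p eta t <= 1.
    rewrite /p.
    have : eta ^+ 2 <= (expR (- t) - x0) ^+ 2.
      by rewrite -[leRHS]real_normK ?num_real// lerXn2r// nnegrE ltW.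
    lra.
  rewrite lerNl; apply: (@le_trans _ _ `|p eta t ^+ n * h t|).
    by rewrite -normrN ler_norm.
  by rewrite normrM ler_piMl// ger0_norm ?exprn_ge0// exprn_ile1.
have mJ : measurable (J : set (measurableTypeR R)) by exact: measurable_itv.
have muJ : mu (J `&` oy) = (t2 - t0)%:E.
  rewrite setIidl; last first.
    by move=> x; rewrite /J/= !in_itv/= andbT => /andP[+ _]; exact: lt_le_trans.
  by rewrite /J lebesgue_measure_itv/= lte_fin t02 -EFinB.
have iJE : (\int[mu]_(x in oy) (\1_J x)%:E = (t2 - t0)%:E)%E.
  by rewrite integral_indic//; exact: muJ.
have iJ : mu.-integrable oy (EFin \o (\1_J : R -> R)).
  apply: integrable_ge0_lty.
  - by apply: measurable_funTS; apply: measurable_indic; exact: measurable_itv.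
  - by move=> x _; rewrite indicE.
  by rewrite iJE ltry.
have bnd n : q ^+ n * (h t0 / 2) * (t2 - t0) <= \int[mu]_(t in oy) `|h t|.
  have := pz eta eta01 n 0.
  have := @le_Rintegral _ _ _ mu oy (fun t => q ^+ n * (h t0 / 2) * \1_J t - `|h t|) (fun t => p eta t ^+ n * expR (- t) ^+ 0 * h t) moy.
  move=> + z; rewrite z RintegralB//; last 2 first.
  - exact: integrableZ.
  - exact: (integrable_norm hi).
  rewrite RintegralZl//.
  have -> : \int[mu]_(t in oy) (\1_J t : R) = t2 - t0.
    by rewrite /Rintegral iJE.
  rewrite subr_le0; apply.
  - apply: integrableBr => //; first exact: integrableZ.
    exact: (integrable_norm hi).
  - apply: (ix (fun t => p eta t ^+ n * expR (- t) ^+ 0) (2 ^ n)%N).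
      by apply: measurable_funM; exact: measurable_funX.
    move=> t t1; have /andP[w0 w2] := p01 eta t eta01 t1.
    by rewrite expr0 mulr1 ger0_norm ?exprn_ge0// natrX lerXn2r// nnegrE.
  - by move=> t; rewrite /= in_itv/= andbT; exact: ineq.
(* Bernoulli's inequality, by which q^n exceeds [C / kap] for [n] large. *)
have bern n : 1 + n%:R * (q - 1) <= q ^+ n.
  elim: n => [|n ihn]; first by rewrite mul0r addr0 expr0.
  rewrite exprSr -natr1.
  have q0 : 0 <= q by exact: le_trans (ltW q1).
  have := ler_wpM2r q0 ihn; apply: le_trans.
  have := mulr_ge0 (ler0n R n) (sqr_ge0 (q - 1)); nra.
set C := \int[mu]_(t in oy) `|h t| in bnd.
pose kap := h t0 / 2 * (t2 - t0).
have kap0 : 0 < kap by rewrite mulr_gt0 ?divr_gt0// subr_gt0.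
pose N := (Num.truncn (C / kap / (q - 1))).+1.
have hN : C / kap / (q - 1) < N%:R by exact: truncnS_gt.
have := bnd N; apply/negP; rewrite -ltNge -mulrA -ltr_pdivrMr//.
apply: lt_le_trans (bern N).
rewrite ltr_pdivrMr ?subr_gt0// in hN.
by rewrite (lt_le_trans hN)// lerDr.
Qed.

Lemma laplace_uniqueness (h : R -> R) :
  mu.-integrable oy (EFin \o h) ->
  {in oy, continuous h} ->
  (forall n : nat, \int[mu]_(t in oy) (expR (- t) ^+ n * h t) = 0) ->
  forall t, 0 < t -> h t = 0.
Proof.
move=> hi ch h0 t t0; apply/eqP; rewrite eq_le !leNgt; apply/andP; split; apply/negP.
  exact: laplace_uniq_pos.
move=> ht; apply: (@laplace_uniq_pos (fun t => - 1 * h t) t) => //.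
- exact: integrableZ.
- by move=> x xo; apply: cvgM; [exact: cvg_cst|exact: ch].
- move=> n; transitivity (\int[mu]_(t in oy) (- 1 * (expR (- t) ^+ n * h t))).
    by apply: eq_Rintegral => x _; ring.
  rewrite RintegralZl ?h0 ?mulr0//.
  apply: (integrable_dom (m := mu) _ (g := fun t => `|h t|)) => //.
  - apply: measurable_funM; last exact: integrable_mfun hi.
    by apply: measurable_funX; apply: measurableT_comp => //; exact: measurableT_comp.
  - move=> x; rewrite /= in_itv/= andbT => x0.
    rewrite normrM ler_piMl// ger0_norm ?exprn_ge0 ?expR_ge0// exprn_ile1 ?expR_ge0//.
    by rewrite expR_le1 oppr_le0 ltW.
  - exact: (integrable_norm hi).
- by rewrite mulN1r oppr_gt0.
Qed.

End laplace_uniqueness.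

(** * Gamma and Beta integrals *)

Section power_integrability.
Variable R : realType.
Local Notation mu := (@lebesgue_measure R).
Local Notation oy := (`]0%R, +oo[%classic : set R).

Lemma measurable_oy : measurable (oy : set (measurableTypeR R)).
Proof. exact: measurable_itv. Qed.

(* The primitive [- (1 + t^p)^(- q/p) / q] of the weight below makes its integral finite. *)
Let weight (p q t : R) := t `^ (p - 1) * (1 + t `^ p) `^ (- (1 + q / p)).

Let weight_derive (p q t : R) : 0 < p -> 0 < q -> 0 < t ->
  is_derive t 1 (fun t => - q^-1 * (1 + t `^ p) `^ (- (q / p))) (weight p q t).
Proof.
move=> p0 q0 t0.
have h : 0 < 1 + t `^ p by rewrite addr_gt0// powR_gt0.
have d1 : is_derive t 1 (fun t => 1 + t `^ p) (p * t `^ (p - 1)).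
  by apply: (is_derive_eq (is_derive_fD (is_derive_fC 1 t) (is_derive_fpowR p t0))); rewrite add0r.
have d2 := is_derive_fcomp (f := fun y => y `^ (- (q / p))) (g := fun t => 1 + t `^ p) (is_derive_fpowR (- (q / p)) h) d1.
apply: (is_derive_eq (is_derive_fZ (- q^-1) d2)).
rewrite /weight opprD addrC.
have -> : - (q / p) - 1 = - 1 - q / p by ring.
by field; rewrite !gt_eqF.
Qed.

Let weight_ge0 p q t : 0 <= weight p q t.
Proof. by rewrite mulr_ge0// powR_ge0. Qed.

Let weight_cont p q t : 0 < t -> {for t, continuous (weight p q)}.
Proof.
move=> t0; apply: cvgM; first exact: continuous_powR.
apply: (@continuous_comp _ _ _ (fun t : R => 1 + t `^ p) (fun y : R => y `^ (- (1 + q / p)))).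
  by apply: cvgD; [exact: cvg_cst|exact: continuous_powR].
by apply: continuous_powR; rewrite addr_gt0// powR_gt0.
Qed.

Let weight_itv (p q a b : R) : 0 < p -> 0 < q -> 0 < a -> a <= b ->
  (\int[mu]_(t in `[a, b]) (weight p q t)%:E <= (q^-1)%:E)%E.
Proof.
move=> p0 q0 a0; rewrite le_eqVlt => /predU1P[->|ab].
  by rewrite set_itv1 integral_set1 lee_fin invr_ge0 ltW.
pose F (t : R) : R := - q^-1 * (1 + t `^ p) `^ (- (q / p)).
have dw (t : R) (t0 : 0 < t) : is_derive t 1 F (weight p q t) by exact: weight_derive.
have pos (x : R) : a <= x -> 0 < x by apply: lt_le_trans.
rewrite (@continuous_FTC2 _ _ F)//.
- have Fb : F b <= 0 by rewrite /F mulNr oppr_le0 mulr_ge0 ?powR_ge0// invr_ge0 ltW.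
  suff Fa : - F a <= q^-1.
    rewrite -EFinB.
    rewrite lee_fin.
    clearbody F. clear dw.
     lra.
  rewrite /F mulNr opprK ler_piMr ?invr_ge0 ?(ltW q0)// powRN invf_le1; last first.
    by rewrite powR_gt0// addr_gt0// powR_gt0.
  rewrite -[X in X <= _](powRr0 (1 + a `^ p)).
  apply: ler_powR; last by rewrite divr_ge0// ltW.
  by rewrite lerDl powR_ge0.
- apply: continuous_in_subspaceT => x; rewrite inE/= in_itv/= => /andP[+ _].
  by move/pos; exact: weight_cont.
- split.
  + by move=> x; rewrite in_itv/= => /andP[/ltW/pos x0 _]; have [] := dw x x0.
  + by apply: cvg_at_right_filter; apply: (is_derive_continuous (dw _ _)).
  + by apply: cvg_at_left_filter; apply: (is_derive_continuous (dw _ _)); apply/pos/ltW.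
- by move=> x; rewrite in_itv/= => /andP[/ltW/pos x0 _]; rewrite derive1E; have [_ ->] := dw x x0.
Qed.

Let weight_integrable (p q : R) : 0 < p -> 0 < q ->
  mu.-integrable oy (EFin \o weight p q).
Proof.
move=> p0 q0.
have mw : measurable_fun oy (weight p q).
  apply: open_continuous_measurable_fun => // t; rewrite inE/= in_itv/= andbT; exact: weight_cont.
apply: integrable_ge0_lty => //.
apply: (@le_lt_trans _ _ (q^-1)%:E); last exact: ltry.
have c := @cvg_integral_exhaust R oy (fun n => (n.+1%:R)^-1) (fun n => n.+1%:R) (weight p q)
  (@invn_anti R) (@natS_mono R) (@bigcup_itv_oy R) mw (fun x _ => weight_ge0 p q x).
rewrite -(cvg_lim _ c)//.
apply: lime_le; first by apply/cvg_ex; eexists; exact: c.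
by apply: nearW => n; apply: weight_itv; rewrite ?invr_gt0//; exact: invn_le_n.
Qed.

(** The weight above behaves like t^(p - 1) near 0 and like t^(- q - 1) at infinity, so a multiple
    of it dominates both bounds at once. *)
Lemma integrable_powR_bound (g : R -> R) (C p q : R) : 0 < p -> 0 < q ->
  measurable_fun oy g ->
  (forall t, 0 < t -> t <= 1 -> `|g t| <= C * t `^ (p - 1)) ->
  (forall t, 1 <= t -> `|g t| <= C * t `^ (- q - 1)) ->
  mu.-integrable oy (EFin \o g).
Proof.
move=> p0 q0 mg g1 g2.
have C0 : 0 <= C.
  by have := g2 1 (lexx _); rewrite powR1 mulr1; apply: le_trans.
(* 1 + t^p is at most 2 for t <= 1 and at most 2 t^p for t >= 1; raised to the power 1 + q / p, this
   2 is what the comparison loses. *)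
pose K := 2 `^ (1 + q / p).
have K0 : 0 < K by rewrite powR_gt0.
have qp : 0 < 1 + q / p by rewrite addr_gt0// divr_gt0.
apply: (integrable_dom (m := mu) measurable_oy (g := fun t => C * K * weight p q t)) => //; last first.
  by apply: integrableZ; [exact: measurable_oy|exact: weight_integrable].
move=> t; rewrite /= in_itv/= andbT => t0.
have tp0 : 0 < t `^ p by rewrite powR_gt0.
rewrite -mulrA; have [t1|t1] := leP t 1.
  apply: (le_trans (g1 t t0 t1)); rewrite ler_wpM2l// /weight mulrCA ler_peMr ?powR_ge0//.
  rewrite /K powRN ler_pdivlMr ?powR_gt0 ?addr_gt0// mul1r.
  apply: ge0_ler_powR; rewrite ?nnegrE ?(ltW qp) ?addr_ge0 ?powR_ge0//.
  have : t `^ p <= 1 `^ p by apply: ge0_ler_powR => //; rewrite ?nnegrE ?ltW.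
  rewrite powR1; lra.
apply: (le_trans (g2 t (ltW t1))); rewrite ler_wpM2l// /weight mulrCA.
have -> : t `^ (- q - 1) = t `^ (p - 1) * (t `^ p) `^ (- (1 + q / p)).
  rewrite -powRrM -powRD; last by rewrite (gt_eqF (lt_trans ltr01 t1)) implybT.
  by congr (_ `^ _); field; rewrite gt_eqF.
rewrite ler_wpM2l ?powR_ge0// !powRN ler_pdivlMr ?powR_gt0 ?addr_gt0//.
rewrite mulrC ler_pdivrMr ?powR_gt0// /K -powRM ?powR_ge0//.
apply: ge0_ler_powR; rewrite ?nnegrE ?(ltW qp) ?addr_ge0 ?mulr_ge0 ?powR_ge0//.
have : 1 `^ p <= t `^ p by apply: ge0_ler_powR => //; rewrite ?nnegrE ?ltW.
rewrite powR1; lra.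
Qed.

End power_integrability.

Section gamma_function.
Variable R : realType.
Local Notation mu := (@lebesgue_measure R).
Local Notation oy := (`]0%R, +oo[%classic : set R).
Local Notation moy := (@measurable_oy R).

(** A single term of the exponential series, of integer order above [u], suffices. *)
Lemma powR_le_fact_expR (u t : R) : 0 <= u -> 1 <= t ->
  t `^ u <= (Num.truncn u).+1`!%:R * expR t.
Proof.
move=> u0 t1; set n := (Num.truncn u).+1.
have un : u <= n%:R by apply/ltW/truncnS_gt.
have t0 : 0 <= t by exact: le_trans t1.
apply: (@le_trans _ _ (t ^+ n)); first by rewrite -powR_mulrn// ler_powR.
have := expR_ge1Dxn (Num.truncn u) t0; rewrite -/n => h.
rewrite mulrC -ler_pdivrMr ?ltr0n ?fact_gt0//.
by apply: le_trans h; rewrite lerDr.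
Qed.

Lemma measurable_gamma_integrand (u s : R) :
  measurable_fun [set: R] (fun t : R => t `^ u * expR (- (s * t))).
Proof.
by mfun. Qed.

Lemma integrable_gamma (u : R) : 0 < u ->
  mu.-integrable oy (EFin \o (fun t : R => t `^ (u - 1) * expR (- t))).
Proof.
move=> u0.
apply: (@integrable_powR_bound _ _ (Num.truncn (u + 1)).+1`!%:R u 1) => //.
- apply: measurable_funTS; have := measurable_gamma_integrand (u - 1) 1.
  by under eq_fun do rewrite mul1r.
- move=> t t0 t1; rewrite ger0_norm ?mulr_ge0 ?powR_ge0 ?expR_ge0// mulrC.
  rewrite ler_wpM2r ?powR_ge0//; apply: (@le_trans _ _ 1).
    by rewrite expR_le1 oppr_le0 ltW.
  by rewrite ler1n fact_gt0.
- move=> t t1; rewrite ger0_norm ?mulr_ge0 ?powR_ge0 ?expR_ge0//.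
  have t0 : 0 < t by exact: lt_le_trans t1.
  have -> : u - 1 = (u + 1) + (- 1 - 1) by ring.
  rewrite powRD; last by rewrite (gt_eqF t0) implybT.
  rewrite mulrAC ler_wpM2r ?powR_ge0// expRN ler_pdivrMr ?expR_gt0//.
  by apply: powR_le_fact_expR => //; rewrite addr_ge0// ltW.
Qed.

Lemma integral_gamma (u : R) : 0 < u ->
  (\int[mu]_(t in oy) (t `^ (u - 1) * expR (- t))%:E = (Gamma u)%:E)%E.
Proof. by move=> u0; rewrite EFin_Rintegral//; exact: integrable_gamma. Qed.

Lemma continuous_expRN (s t : R) : {for t, continuous (fun t : R => expR (- (s * t)))}.
Proof.
apply: (@continuous_comp _ _ _ (fun t : R => - (s * t)) (@expR R)); last exact: continuous_expR.
by apply: cvgN; apply: cvgM; [exact: cvg_cst|exact: cvg_id].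
Qed.

Lemma continuous_gamma_integrand (u s t : R) : 0 < t ->
  {for t, continuous (fun t : R => t `^ u * expR (- (s * t)))}.
Proof.
by move=> t0; apply: cvgM; [exact: continuous_powR|exact: continuous_expRN].
Qed.

Lemma integral_gamma_scale (u s : R) : 0 < u -> 0 < s ->
  (\int[mu]_(t in oy) (t `^ (u - 1) * expR (- (s * t)))%:E = (Gamma u * s `^ (- u))%:E)%E.
Proof.
move=> u0 s0.
set X := (\int[mu]_(t in oy) _)%E.
have H : (Gamma u)%:E = ((s `^ u)%:E * X)%E.
  rewrite -integral_gamma//.
  transitivity (\int[mu]_(t in oy) (t `^ (u - 1) * expR (- (1 * t)))%:E)%E.
    by apply: eq_integral => t _; rewrite mul1r.
  rewrite (@ge0_subst_scale R s)//; last 2 first.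
  - by move=> t; rewrite inE/= in_itv/= andbT => t0; exact: continuous_gamma_integrand.
  - by move=> t t0; rewrite mulr_ge0 ?powR_ge0 ?expR_ge0.
  rewrite -(ge0_integralZl_fin mu moy); last 3 first.
  - by apply: measurable_funTS; exact: measurable_gamma_integrand.
  - by move=> t _; rewrite mulr_ge0 ?powR_ge0 ?expR_ge0.
  - by rewrite powR_ge0.
  apply: eq_integral => t; rewrite inE/= in_itv/= andbT => t0.
  rewrite mul1r powRM ?(ltW s0) ?(ltW t0)//; congr (_%:E).
  by rewrite -(mulr_powRB1 (ltW s0) u0); ring.
rewrite mulrC EFinM H muleA -EFinM -powRD; last by rewrite (gt_eqF s0) implybT.
by rewrite addNr powRr0 mul1e.
Qed.

Lemma integral_gamma_powR (u p : R) : 0 < u -> 0 < p ->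
  (\int[mu]_(t in oy) (t `^ (u - 1) * expR (- (t `^ p)))%:E = (Gamma (u / p) / p)%:E)%E.
Proof.
move=> u0 p0.
set X := (\int[mu]_(t in oy) _)%E.
have H : (Gamma (u / p))%:E = (p%:E * X)%E.
  rewrite -integral_gamma ?divr_gt0//.
  transitivity (\int[mu]_(t in oy) (t `^ (u / p - 1) * expR (- (1 * t)))%:E)%E.
    by apply: eq_integral => t _; rewrite mul1r.
  rewrite (@ge0_subst_powR R p)//; last 2 first.
  - by move=> t; rewrite inE/= in_itv/= andbT => t0; exact: continuous_gamma_integrand.
  - by move=> t t0; rewrite mulr_ge0 ?powR_ge0 ?expR_ge0.
  rewrite -(ge0_integralZl_fin mu moy); last 3 first.
  - by mfun.
  - by move=> t _; rewrite mulr_ge0 ?powR_ge0 ?expR_ge0.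
  - by rewrite ltW.
  apply: eq_integral => t; rewrite inE/= in_itv/= andbT => t0.
  rewrite mul1r -powRrM; congr (_%:E).
  have -> : u - 1 = p * (u / p - 1) + (p - 1) by field; rewrite gt_eqF.
  rewrite [t `^ (_ * _ + _)]powRD; last by rewrite (gt_eqF t0) implybT.
  by ring.
by rewrite mulrC EFinM H muleA -EFinM mulVf ?gt_eqF// mul1e.
Qed.

Lemma Gamma_ge0 (u : R) : 0 <= Gamma u.
Proof. by apply: Rintegral_ge0 => x _; rewrite mulr_ge0 ?powR_ge0 ?expR_ge0. Qed.

(** Both sides are the double integral of s^(a + b - 1) x^(b - 1) e^(- s (1 + x)), computed in the
    two orders with [integral_gamma_scale]. *)
Lemma Gamma_mul (a b : R) : 0 < a -> 0 < b ->
  ((Gamma a * Gamma b)%:E =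
   (Gamma (a + b))%:E * \int[mu]_(x in oy) (x `^ (b - 1) * (1 + x) `^ (- (a + b)))%:E)%E.
Proof.
move=> a0 b0.
transitivity (\int[mu]_(s in oy) \int[mu]_(x in oy)
   (s `^ (a + b - 1) * x `^ (b - 1) * expR (- (s * (1 + x))))%:E)%E.
  rewrite mulrC EFinM -(integral_gamma a0) -(ge0_integralZl_fin mu moy); last 3 first.
  - apply: measurable_funTS.
    have := measurable_gamma_integrand (a - 1) 1.
    by under eq_fun do rewrite mul1r.
  - by move=> t _; rewrite mulr_ge0 ?powR_ge0 ?expR_ge0.
  - by rewrite Gamma_ge0.
  apply: eq_integral => s; rewrite inE/= in_itv/= andbT => s0.
  transitivity ((s `^ (a - 1) * expR (- s) * s `^ b)%:E * (Gamma b * s `^ (- b))%:E)%E.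
    have e : s `^ b * s `^ (- b) = 1.
      by rewrite -powRD ?subrr ?powRr0// (gt_eqF s0) implybT.
    rewrite -EFinM; congr (_%:E).
    transitivity (Gamma b * (s `^ (a - 1) * expR (- s)) * (s `^ b * s `^ (- b))).
      by rewrite e mulr1.
    by ring.
  rewrite -(integral_gamma_scale b0 s0).
  rewrite -(ge0_integralZl_fin mu moy); last 3 first.
  - by apply: measurable_funTS; exact: measurable_gamma_integrand.
  - by move=> t _; rewrite mulr_ge0 ?powR_ge0 ?expR_ge0.
  - by rewrite !mulr_ge0 ?powR_ge0 ?expR_ge0.
  apply: eq_integral => x _; congr (_%:E).
  have -> : a + b - 1 = (a - 1) + b by ring.
  rewrite [s `^ (a - 1 + b)]powRD; last by rewrite (gt_eqF s0) implybT.
  by rewrite mulrDr mulr1 opprD expRD; ring.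
rewrite (@tonelli_on _ _ _ _ R mu mu oy oy (fun s x => s `^ (a + b - 1) * x `^ (b - 1) * expR (- (s * (1 + x))))); last 4 first.
- exact: moy.
- exact: moy.
- by mfun.
- by move=> s x _ _; rewrite !mulr_ge0 ?powR_ge0 ?expR_ge0.
rewrite -(ge0_integralZl_fin mu moy); last 3 first.
- by mfun.
- by move=> t _; rewrite mulr_ge0 ?powR_ge0 ?expR_ge0.
- by rewrite Gamma_ge0.
apply: eq_integral => x; rewrite inE/= in_itv/= andbT => x0.
have x10 : 0 < 1 + x by rewrite addr_gt0.
have ab0 : 0 < a + b by rewrite addr_gt0.
transitivity ((x `^ (b - 1))%:E * \int[mu]_(s in oy) (s `^ (a + b - 1) * expR (- ((1 + x) * s)))%:E)%E.
  rewrite -(ge0_integralZl_fin mu moy); last 3 first.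
  - by apply: measurable_funTS; exact: measurable_gamma_integrand.
  - by move=> t _; rewrite mulr_ge0 ?powR_ge0 ?expR_ge0.
  - by rewrite powR_ge0.
  by apply: eq_integral => s _; rewrite (mulrC s (1 + x)); congr (_%:E); ring.
by rewrite integral_gamma_scale// -!EFinM; congr (_%:E); ring.
Qed.

Lemma cvgy_powRN (q : R) : 0 < q -> (1 + x) `^ (- q) @[x --> +oo] --> (0 : R).
Proof.
move=> q0; apply/cvgrPdist_lt => e e0; near=> x.
rewrite sub0r normrN ger0_norm ?powR_ge0// powRN.
have x0 : 0 < 1 + x by rewrite addr_gt0//; near: x; exact: nbhs_pinfty_gt.
rewrite -[e]invrK ltf_pV2 ?posrE ?invr_gt0 ?powR_gt0//.
have -> : e^-1 = (e^-1 `^ q^-1) `^ q.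
  by rewrite -powRrM mulVf ?gt_eqF// powRr1// invr_ge0 ltW.
apply: gt0_ltr_powR => //; rewrite ?nnegrE ?powR_ge0 ?(ltW x0)//.
have : e^-1 `^ q^-1 < x by near: x; apply: nbhs_pinfty_gt; exact: num_real.
by move=> h; rewrite (lt_trans h)// ltrDr.
Unshelve. all: by end_near. Qed.

Lemma integral_oneD_powR (u : R) : 0 < u ->
  (\int[mu]_(x in oy) ((1 + x) `^ (- (u + 1)))%:E = (u^-1)%:E)%E.
Proof.
move=> u0.
rewrite integral_itv_obnd_cbnd; last by apply/measurable_EFinP; mfun.
pose F (x : R) : R := - u^-1 * (1 + x) `^ (- u).
have dF (x : R) : 0 <= x -> is_derive x 1 F ((1 + x) `^ (- (u + 1))).
  move=> x0; have h : 0 < 1 + x by rewrite ltr_pwDl.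
  have d1 := is_derive_fD (is_derive_fC 1 x) (is_derive_fid x).
  have d2 := is_derive_fcomp (f := fun y => y `^ (- u)) (g := fun t => 1 + t) (is_derive_fpowR (- u) h) d1.
  apply: (is_derive_eq (is_derive_fZ (- u^-1) d2)).
  by rewrite add0r mulr1 mulrA mulrNN mulVf ?gt_eqF// mul1r opprD.
rewrite (@ge0_continuous_FTC2y _ _ F 0 0).
- by rewrite /F addr0 powR1 mulr1 -EFinB sub0r opprK.
- by move=> x _; exact: powR_ge0.
- apply: continuous_in_subspaceT => x; rewrite inE/= in_itv/= andbT => x0.
  apply: (@continuous_comp _ _ _ (fun t : R => 1 + t) (fun y : R => y `^ (- (u + 1)))).
    by apply: cvgD; [exact: cvg_cst|exact: cvg_id].
  by apply: continuous_powR; rewrite ltr_pwDl.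
- rewrite -[X in _ --> X](mulr0 (- u^-1)); apply: cvgM; first exact: cvg_cst.
  exact: cvgy_powRN.
- by move=> x /ltW/dF[].
- by apply: cvg_at_right_filter; apply: (is_derive_continuous (dF 0 _)).
- by move=> x; rewrite in_itv/= andbT => /ltW x0; rewrite derive1E; have [_ ->] := dF x x0.
Qed.

Lemma Gamma1 : Gamma 1 = 1 :> R.
Proof.
apply: EFin_inj; rewrite -(integral_gamma ltr01).
rewrite integral_itv_obnd_cbnd; last by apply/measurable_EFinP; mfun.
transitivity (\int[mu]_(t in `[0%R, +oo[) (expR (- t))%:E)%E.
  by apply: eq_integral => t _; rewrite subrr powRr0 mul1r.
pose F (x : R) : R := - expR (- x).
have dF (x : R) : is_derive x 1 F (expR (- x)).
  have d2 := is_derive_fcomp (f := expR) (g := fun t => - t) (is_derive_expR (- x)) (is_derive_fN (is_derive_fid x)).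
  by apply: (is_derive_eq (is_derive_fN d2)); rewrite mulrN1 opprK.
rewrite (@ge0_continuous_FTC2y _ _ F 0 0).
- by rewrite /F oppr0 expR0 -EFinB sub0r opprK.
- by move=> x _; exact: expR_ge0.
- apply: continuous_subspaceT => x.
  apply: (@continuous_comp _ _ _ (fun t : R => - t) expR); last exact: continuous_expR.
  by apply: cvgN; exact: cvg_id.
- by rewrite -[X in _ --> X]oppr0; apply: cvgN; exact: cvgr_expR.
- by move=> x _; have [] := dF x.
- by apply: cvg_at_right_filter; apply: (is_derive_continuous (dF 0)).
- by move=> x _; rewrite derive1E; have [_ ->] := dF x.
Qed.

(** The case b = 1 of [Gamma_mul], where the Beta integral is 1 / u; it stands in for an integration
    by parts. *)
Lemma GammaD1 (u : R) : 0 < u -> Gamma (u + 1) = u * Gamma u.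
Proof.
move=> u0; have := Gamma_mul u0 ltr01.
rewrite Gamma1 mulr1 (_ : (\int[mu]_(x in oy) _)%E = (u^-1)%:E); last first.
  rewrite -integral_oneD_powR//; apply: eq_integral => x _.
  by rewrite subrr powRr0 mul1r.
rewrite -EFinM => -[->].
by rewrite mulrCA mulfV ?gt_eqF// mulr1.
Qed.

(** Only [X, X + 1] is kept of the half-line; there the power is at least its value at the left end
    and the exponential at least its value at the right end. [X] stays free: for [X] large, 1 /
    Gamma is seen to decay faster than any given geometric sequence. *)
Lemma Gamma_lower (u X : R) : 1 <= u -> 0 < X ->
  X `^ (u - 1) * expR (- (X + 1)) <= Gamma u.
Proof.
move=> u1 X0; have u0 : 0 < u by exact: lt_le_trans u1.
rewrite -lee_fin -(integral_gamma u0).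
have mX : measurable (`[X, X + 1]%classic : set (measurableTypeR R)) by exact: measurable_itv.
have X1 : X < X + 1 by rewrite ltrDl.
apply: (@le_trans _ _ (\int[mu]_(t in `[X, (X + 1)%R]) (X `^ (u - 1) * expR (- (X + 1)))%:E)%E).
  rewrite integral_cst// [X in (_ * X)%E](_ : _ = 1%E) ?mule1//.
  have -> : 1%E = (X + 1 - X)%:E by rewrite addrAC subrr add0r.
  by rewrite EFinB; have := @lebesgue_measure_itv R `[X, X + 1]; rewrite /= lte_fin X1.
apply: (@le_trans _ _ (\int[mu]_(t in `[X, (X + 1)%R]) (t `^ (u - 1) * expR (- t))%:E)%E).
  apply: ge0_le_integral => //.
  - by move=> t _; rewrite lee_fin mulr_ge0 ?powR_ge0 ?expR_ge0.
  - by apply/measurable_EFinP; mfun.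
  - move=> t; rewrite /= in_itv/= => /andP[h1 h2]; rewrite lee_fin.
    apply: ler_pM; rewrite ?powR_ge0 ?expR_ge0//.
      by apply: ge0_ler_powR; rewrite ?nnegrE ?subr_ge0 ?(ltW X0)// (le_trans (ltW X0)).
    by rewrite ler_expR lerN2.
apply: ge0_subset_integral => //.
- by apply/measurable_EFinP; mfun.
- by move=> t _; rewrite lee_fin mulr_ge0 ?powR_ge0 ?expR_ge0.
- by move=> t; rewrite /= !in_itv/= andbT => /andP[+ _]; exact: lt_le_trans.
Qed.

(** The functional equation moves the argument beyond 1, where [Gamma_lower] applies. *)
Lemma Gamma_gt0 (u : R) : 0 < u -> 0 < Gamma u.
Proof.
move=> u0; rewrite -(pmulr_rgt0 _ u0) -GammaD1//.
have u1 : 1 <= u + 1 by rewrite lerDr ltW.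
apply: lt_le_trans (Gamma_lower u1 ltr01).
by rewrite mulr_gt0 ?powR_gt0 ?expR_gt0.
Qed.

Lemma Gamma_natS (n : nat) : Gamma n.+1%:R = n`!%:R :> R.
Proof.
elim: n => [|n ih]; first by rewrite Gamma1 fact0.
by rewrite -natr1 GammaD1// ih factS natrM.
Qed.

(** The increasing map x / (1 + x) carries the half-line onto ]0, 1[, so integrals over bounded
    intervals inherit the exhaustion of the half-line. *)
Lemma ge0_subst_frac (c : R) (G : R -> R) : 0 < c ->
  {in `]0, c[%classic, continuous G} -> (forall t, 0 < t < c -> 0 <= G t) ->
  (\int[mu]_(t in `]0%R, c[) (G t)%:E =
   \int[mu]_(x in oy) (G (c * (x / (1 + x))) * (c * (1 + x) ^- 2))%:E)%E.
Proof.
move=> c0 cG G0.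
pose F (x : R) := c * (x / (1 + x)).
have h (x : R) : 0 < x -> 0 < 1 + x by move=> x0; rewrite addr_gt0.
apply: (@ge0_subst_exhaust R oy `]0%R, c[%classic (fun n => (n.+1%:R)^-1) (fun n => n.+1%:R)
   F (fun x => c * (1 + x) ^- 2) G).
- exact: invn_anti.
- exact: natS_mono.
- exact: invn_le_n.
- exact: bigcup_itv_oy.
- apply/seteqP; split => x /=.
    move=> [n _ /=]; rewrite !in_itv/= => /andP[h1 h2].
    have n0 : 0 < n.+1%:R :> R by [].
    apply/andP; split.
      by apply: lt_le_trans h1; rewrite mulr_gt0 ?divr_gt0 ?invr_gt0// h ?invr_gt0.
    by apply: (le_lt_trans h2); rewrite /F gtr_pMr// ltr_pdivrMr ?h// mul1r ltrDr.
  rewrite in_itv/= => /andP[x0 x1].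
  have y0 : 0 < x / c by rewrite divr_gt0.
  have y1 : x / c < 1 by rewrite ltr_pdivrMr// mul1r.
  have -> : x = c * (x / c) by rewrite mulrC divfK// gt_eqF.
  move: (x / c) y0 y1 => {x0 x1} y y0 y1.
  have : (`]0%R, +oo[%classic : set R) (y / (1 - y)).
    by rewrite /= in_itv/= divr_gt0// subr_gt0.
  rewrite -bigcup_itv_oy => -[m _ /=]; rewrite in_itv/= => /andP[k1 k2]; exists m => //=.
  have n0 : 0 < m.+1%:R :> R by [].
  have y1' : 0 < 1 - y by rewrite subr_gt0.
  move: k1 k2; rewrite !ler_pdivlMr ?ler_pdivrMr// in_itv/= /F !ler_pM2l// => k1 k2.
  have i0 : 0 < m.+1%:R^-1 :> R by rewrite invr_gt0.
  rewrite ler_pdivrMr ?ler_pdivlMr ?h//; apply/andP; split.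
    by move: k1; rewrite mulrBr mulr1 lerBlDr mulrDr mulr1 (mulrC y).
  by move: k2; rewrite mulrBr mulr1 lerBrDr mulrDr mulr1 (mulrC y).
- move=> x y; rewrite !inE/= !in_itv/= !andbT => x0 y0 xy.
  by rewrite /F ltr_pM2l// ltr_pdivrMr ?h// mulrAC ltr_pdivlMr ?h//; nra.
- move=> x /=; rewrite in_itv/= andbT => x0.
  have d1 := is_derive_fD (is_derive_fC 1 x) (is_derive_fid x).
  have d2 := is_derive_fV d1 (lt0r_neq0 (h x x0)).
  apply: (is_derive_eq (is_derive_fZ c (is_derive_fM (is_derive_fid x) d2))).
  by field; rewrite gt_eqF ?h.
- exact: open_oy.
- move=> x; rewrite inE/= in_itv/= andbT => x0.
  apply: cvgM; first exact: cvg_cst.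
  apply: cvgV; first by rewrite expf_neq0// gt_eqF// h.
  apply: (@continuous_comp _ _ _ (fun t : R => 1 + t) (fun y : R => y ^+ 2)).
    by apply: cvgD; [exact: cvg_cst|exact: cvg_id].
  exact: exprn_continuous.
- by move=> x _; rewrite mulr_ge0 ?(ltW c0)// invr_ge0 sqr_ge0.
- exact: interval_open.
- exact: cG.
- by move=> x; rewrite /= in_itv/=; exact: G0.
Qed.

Lemma integral_beta (a b : R) : 0 < a -> 0 < b ->
  (\int[mu]_(t in `]0%R, 1%R[) ((1 - t) `^ (b - 1) * t `^ (a - 1))%:E =
   (Gamma a * Gamma b / Gamma (a + b))%:E)%E.
Proof.
move=> a0 b0.
have ab : 0 < Gamma (a + b) by rewrite Gamma_gt0// addr_gt0.
have -> : (Gamma a * Gamma b / Gamma (a + b))%:E =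
  (\int[mu]_(x in oy) (x `^ (a - 1) * (1 + x) `^ (- (a + b)))%:E)%E.
  rewrite mulrC (mulrC (Gamma a)) EFinM Gamma_mul// (addrC b a) muleA -EFinM mulVf ?gt_eqF//.
  by rewrite mul1e.
rewrite (ge0_subst_frac ltr01); first last.
- by move=> x _; rewrite mulr_ge0 ?powR_ge0.
- move=> x; rewrite inE/= in_itv/= => /andP[x0 x1]; apply: cvgM; last exact: continuous_powR.
  apply: (@continuous_comp _ _ _ (fun t : R => 1 - t) (fun y : R => y `^ (b - 1))).
    by apply: cvgB; [exact: cvg_cst|exact: cvg_id].
  by apply: continuous_powR; rewrite subr_gt0.
apply: eq_integral => x; rewrite inE/= in_itv/= andbT => x0.
have x1 : 0 < 1 + x by rewrite addr_gt0.
have FE : 1 - x / (1 + x) = (1 + x)^-1 by field; rewrite gt_eqF.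
congr (_%:E); rewrite !mul1r FE powRM ?(ltW x0) ?invr_ge0 ?(ltW x1)//.
rewrite -(powR_inv1 (ltW x1)) -!powRrM -(powR_mulrn 2 (ltW x1)) -powRN.
rewrite [LHS](_ : _ = x `^ (a - 1) * ((1 + x) `^ (-1 * (b - 1)) * (1 + x) `^ (-1 * (a - 1)) * (1 + x) `^ (- 2%:R))); last by ring.
congr (_ * _); rewrite -!powRD ?(gt_eqF x1) ?implybT//.
by congr (_ `^ _); ring.
Qed.

End gamma_function.

(** * Stieltjes representations by rotating the ray of integration *)

Section rotation.
Variable R : realType.
Local Notation mu := (@lebesgue_measure R).
Local Notation oy := (`]0%R, +oo[%classic : set R).
Local Notation moy := (@measurable_oy R).

Lemma cvg_Rintegral_exhaust (f : R -> R) : mu.-integrable oy (EFin \o f) ->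
  \int[mu]_(x in `[(n.+1%:R)^-1, n.+1%:R]) f x @[n --> \oo] --> \int[mu]_(x in oy) f x.
Proof.
move=> fi; have mf := integrable_mfun fi.
pose J n : set R := `[(n.+1%:R)^-1, n.+1%:R]%classic.
have mJ n : measurable (J n : set (measurableTypeR R)) by exact: measurable_itv.
have JO n : J n `<=` oy.
  move=> x; rewrite /J/= !in_itv/= andbT => /andP[+ _].
  by apply: lt_le_trans; rewrite invr_gt0.
have e n : \int[mu]_(x in J n) f x = \int[mu]_(x in oy) (\1_(J n) x * f x).
  rewrite Rintegral_mkcond [RHS]Rintegral_mkcond; apply: eq_Rintegral => x _.
  rewrite !patchE indicE; case: ifPn => xJ; last by rewrite mul0r; case: ifP.
  by rewrite (mem_set (JO _ _ (set_mem xJ))) mul1r.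
under eq_fun do rewrite e.
have cv (x : R) : oy x -> \1_(J n) x * f x @[n --> \oo] --> f x.
  move=> x0.
  have : (\bigcup_n J n) x by rewrite /J bigcup_itv_oy.
  move=> [N _ JN]; apply: cvg_near_cst.
  near=> n; rewrite indicE mem_set ?mul1r//.
  have Nn : (N <= n)%N by near: n; exact: nbhs_infty_ge.
  move: JN; rewrite /J/= !in_itv/= => /andP[h1 h2].
  by rewrite (le_trans (invn_anti R Nn))// (le_trans h2)// natS_mono.
have [] := @dominated_Rcvg _ _ R mu oy moy (fun n x => \1_(J n) x * f x) f (fun x => `|f x|) => //.
- by move=> n; apply: measurable_funM => //; apply: measurable_funTS.
- exact: (@aeW _ (measurableTypeR R) R mu _ cv).
- exact: (integrable_norm fi).
- move=> n x _; rewrite normrM ler_piMl// indicE; case: (_ \in _) => /=.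
    by rewrite normr1.
  by rewrite normr0.
Unshelve. all: by end_near. Qed.

(* For [f = A + i B] in polar coordinates, [C] is the real part of [z f'(z)]. *)
Lemma rotation_invariance (A B C : R -> R -> R) (lo hi phi1 phi2 K p q : R) :
  0 < p -> 0 < q ->
  (forall r phi : R, 0 < r -> lo < phi < hi -> is_derive r 1 (A ^~ phi) (C r phi / r)) ->
  (forall r phi : R, 0 < r -> lo < phi < hi -> is_derive phi 1 (B r) (C r phi)) ->
  (forall r phi : R, 0 < r -> lo < phi < hi -> {for r, continuous (B ^~ phi)}) ->
  (forall r phi : R, 0 < r -> lo < phi < hi -> {for r, continuous (C ^~ phi)}) ->
  (forall r1 r2 : R, 0 < r1 -> exists M : R, forall r phi : R,
     r1 <= r <= r2 -> lo < phi < hi -> `|C r phi| <= M) ->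
  (forall r phi : R, 0 < r -> r <= 1 -> lo < phi < hi ->
     `|A r phi| <= K * r `^ p /\ `|B r phi| <= K * r `^ p) ->
  (forall r phi : R, 1 <= r -> lo < phi < hi ->
     `|A r phi| <= K * r `^ (- q) /\ `|B r phi| <= K * r `^ (- q)) ->
  lo < phi1 < hi -> lo < phi2 < hi ->
  \int[mu]_(r in oy) (B r phi1 / r) = \int[mu]_(r in oy) (B r phi2 / r).
Proof.
move=> p0 q0 dA dB cB cC bC b0 b1 h1 h2.
have cBr (r phi : R) : 0 < r -> lo < phi < hi -> {for r, continuous (fun r => B r phi / r)}.
  move=> r0 hp; apply: cvgM; first exact: cB.
  by apply: inv_continuous; rewrite gt_eqF.
have cCr (r phi : R) : 0 < r -> lo < phi < hi -> {for r, continuous (fun r => C r phi / r)}.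
  move=> r0 hp; apply: cvgM; first exact: cC.
  by apply: inv_continuous; rewrite gt_eqF.
have iB (phi : R) : lo < phi < hi -> mu.-integrable oy (EFin \o (fun r => B r phi / r)).
  move=> hp; apply: (integrable_powR_bound (C := K) (p := p) (q := q)) => //.
  - apply: open_continuous_measurable_fun => // r; rewrite inE/= in_itv/= andbT => r0.
    exact: cBr.
  - move=> r r0 r1; have [_ hb] := b0 r phi r0 r1 hp.
    rewrite normrM normfV (gtr0_norm r0) ler_pdivrMr// -mulrA (mulrC _ r).
    by rewrite mulr_powRB1// ltW.
  - move=> r r1; have r0 : 0 < r by exact: lt_le_trans r1.
    have [_ hb] := b1 r phi r1 hp.
    rewrite normrM normfV (gtr0_norm r0) ler_pdivrMr// -mulrA.
    have -> : r `^ (- q - 1) * r = r `^ (- q).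
      rewrite -[X in _ * X = _](powRr1 (ltW r0)) -powRD ?subrK//.
      by rewrite (gt_eqF r0) implybT.
    by [].
have K0 : 0 <= K.
  by have [+ _] := b1 1 phi1 (lexx _) h1; rewrite powR1 mulr1; apply: le_trans.
wlog lt12 : phi1 phi2 h1 h2 / phi1 < phi2.
  move=> H; have [|] := ltP phi1 phi2; first exact: H.
  by rewrite le_eqVlt => /predU1P[->//|h21]; apply/esym; exact: H.
pose a (n : nat) : R := n.+1%:R^-1.
pose b (n : nat) : R := n.+1%:R.
(* Truncation away from 0 and infinity, where the angle can be differentiated under the integral. *)
pose Y n (phi : R) := \int[mu]_(r in `[a n, b n]) (B r phi / r).
have a0 n : 0 < a n by rewrite invr_gt0.
(* Cauchy-Riemann: the angular derivative of B / r is C / r, which is also the radial derivative of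
   [A]. Only boundary values of [A] remain, and these vanish as the truncation is removed. *)
have dY n (phi : R) : lo < phi < hi -> is_derive phi 1 (Y n) (A (b n) phi - A (a n) phi).
  move=> hp.
  have [M HM] := bC (a n) (b n) (a0 n).
  have M0 : 0 <= M.
    by apply: le_trans (HM (a n) phi _ hp); rewrite ?lexx ?invn_le_n.
  have mJ : measurable (`[a n, b n]%classic : set (measurableTypeR R)) by exact: measurable_itv.
  have Ip : (`]lo, hi[%classic : set R) phi by rewrite /= in_itv/=.
  have intf (x : R) : (`]lo, hi[%classic : set R) x ->
      mu.-integrable `[a n, b n] (EFin \o (fun r => B r x / r)).
    rewrite /= in_itv/= => hx; apply: continuous_compact_integrable; first exact: segment_compact.
    apply: continuous_in_subspaceT => r; rewrite inE/= in_itv/= => /andP[ra _].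
    by apply: cBr => //; exact: lt_le_trans ra.
  have d1 (x r : R) : lo < x < hi -> 0 < r -> is_derive x 1 (fun phi => B r phi / r) (C r x / r).
    move=> hx r0; apply: (is_derive_eq (is_derive_fM (dB r x r0 hx) (is_derive_fC r^-1 x))).
    by rewrite mulr0 addr0.
  have derf1 (x r : R) : (`]lo, hi[%classic : set R) x -> `[a n, b n]%classic r ->
      derivable (fun phi => B r phi / r) x 1.
    rewrite /= !in_itv/= => hx /andP[ra _].
    by have [] := d1 x r hx (lt_le_trans (a0 n) ra).
  have G0 (r : R) : 0 <= M * b n by rewrite mulr_ge0.
  have intG : mu.-integrable `[a n, b n] (EFin \o (fun=> M * b n)).
    apply: continuous_compact_integrable; first exact: segment_compact.
    by apply: continuous_subspaceT => ?; exact: cst_continuous.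
  have hub (x r : R) : (`]lo, hi[%classic : set R) x -> `[a n, b n]%classic r ->
      `|partial1of2 (fun x r => B r x / r) x r| <= M * b n.
    rewrite /= !in_itv/= => hx hr.
    have r0 : 0 < r by case/andP: hr => ra _; apply: lt_le_trans ra.
    rewrite partial1of2E; have [_ ->] := d1 x r hx r0.
    rewrite normrM; apply: ler_pM => //; first exact: HM.
    rewrite normfV gtr0_norm// -[leRHS]invrK lef_pV2 ?posrE ?invr_gt0 ?ltr0n//.
    by case/andP: hr.
  have H1 := derivable_under_integral mJ Ip intf derf1 G0 intG hub.
  have H2 := differentiation_under_integral mJ Ip intf derf1 G0 intG hub.
  split; first exact: H1.
  rewrite -derive1E; rewrite {}H2.
  transitivity (\int[mu]_(r in `[a n, b n]) (C r phi / r)).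
    apply: eq_Rintegral => r; rewrite inE/= in_itv/= => /andP[ra _].
    by rewrite partial1of2E; have [_ ->] := d1 phi r hp (lt_le_trans (a0 n) ra).
  rewrite /Rintegral.
  have := invn_le_n R n; rewrite -/(a n) -/(b n) le_eqVlt => /predU1P[->|ab].
    by rewrite set_itv1 integral_set1 subrr.
  have dA' (r : R) : a n <= r -> is_derive r 1 (A ^~ phi) (C r phi / r).
    by move=> ra; apply: dA => //; exact: lt_le_trans ra.
  rewrite (@continuous_FTC2 _ _ (A ^~ phi)).
  - by [].
  - exact: ab.
  - apply: continuous_in_subspaceT => r; rewrite inE/= in_itv/= => /andP[ra _].
    by apply: cCr => //; exact: lt_le_trans ra.
  - split.
    + by move=> r; rewrite in_itv/= => /andP[/ltW/dA'[]].
    + by apply: cvg_at_right_filter; apply: (is_derive_continuous (dA' _ _)).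
    + by apply: cvg_at_left_filter; apply: (is_derive_continuous (dA' _ (ltW ab))).
  - by move=> r; rewrite in_itv/= => /andP[/ltW/dA'[_ +] _]; rewrite derive1E.
(* The mean value theorem in the angle turns the decay of the boundary terms into a bound for the
   change of the truncated integral from one ray to the other. *)
have YB n : `|Y n phi2 - Y n phi1| <= K * (b n `^ (- q) + a n `^ p) * (phi2 - phi1).
  have mid (c : R) : phi1 <= c <= phi2 -> lo < c < hi.
    move=> /andP[c1 c2]; case/andP: h1 => l1 _; case/andP: h2 => _ l2.
    by rewrite (lt_le_trans l1 c1) (le_lt_trans c2 l2).
  have [|//|c] := MVT (f := Y n) (df := fun phi => A (b n) phi - A (a n) phi) lt12.
  - move=> c; rewrite in_itv/= => /andP[/ltW c1 /ltW c2]; apply: dY.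
    by apply: mid; rewrite c1 c2.
  - apply: continuous_in_subspaceT => c; rewrite inE/= in_itv/= => hc.
    exact: (is_derive_continuous (dY n c (mid c hc))).
  rewrite in_itv/= => /andP[/ltW c1 /ltW c2] ->.
  have hc : lo < c < hi by apply: mid; rewrite c1 c2.
  rewrite normrM [`|phi2 - phi1|]ger0_norm ?subr_ge0 ?(ltW lt12)//.
  apply: ler_wpM2r; first by rewrite subr_ge0 ltW.
  rewrite mulrDr (le_trans (ler_normB _ _))// lerD//.
    by have [] := b1 (b n) c (_ : 1 <= b n) hc; rewrite // ler1n.
  by have [] := b0 (a n) c (a0 n) (_ : a n <= 1) hc; rewrite // invf_le1// ler1n.
have c1 : Y n phi1 @[n --> \oo] --> \int[mu]_(r in oy) (B r phi1 / r).
  exact: (cvg_Rintegral_exhaust (iB _ h1)).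
have c2 : Y n phi2 @[n --> \oo] --> \int[mu]_(r in oy) (B r phi2 / r).
  exact: (cvg_Rintegral_exhaust (iB _ h2)).
have powinf (u : R) : 0 < u -> (b n) `^ (- u) @[n --> \oo] --> (0 : R).
  move=> u0; rewrite (_ : (fun n => _) = (fun n : nat => (1 + n%:R) `^ (- u))); last first.
    by apply/funext => n; rewrite /b -natr1 addrC.
  apply: (cvg_comp (fun n : nat => n%:R) (fun x : R => (1 + x) `^ (- u))); last exact: cvgy_powRN.
  apply/cvgryPge => M; near=> n; near: n; exact: nbhs_infty_ger.
have c3 : Y n phi2 - Y n phi1 @[n --> \oo] --> (0 : R).
  apply: norm_cvg0.
  have c0 : K * (b n `^ (- q) + a n `^ p) * (phi2 - phi1) @[n --> \oo] --> (0 : R).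
    rewrite -[X in _ --> X](mul0r (phi2 - phi1)); apply: cvgM; last exact: cvg_cst.
    rewrite -[X in _ --> X](mulr0 K); apply: cvgM; first exact: cvg_cst.
    rewrite -[X in _ --> X](addr0 0); apply: cvgD; first exact: powinf.
    rewrite (_ : (fun n => a n `^ p) = (fun n => b n `^ (- p))); first exact: powinf.
    by apply/funext => n; rewrite /a -powR_inv1// -powRrM mulN1r.
  apply: squeeze_cvgr (cvg_cst 0) c0; apply: nearW => n.
  by rewrite normr_ge0 YB.
have c4 : Y n phi2 - Y n phi1 @[n --> \oo] -->
  \int[mu]_(r in oy) (B r phi2 / r) - \int[mu]_(r in oy) (B r phi1 / r) by exact: cvgB c2 c1.
apply/eqP; rewrite eq_sym -subr_eq0; apply/eqP.
have hl := cvg_lim (@Rhausdorff R) c4; have := cvg_lim (@Rhausdorff R) c3.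
by rewrite -hl => <-.
Unshelve. all: by end_near. Qed.

End rotation.

(** * Holomorphic functions in polar coordinates *)

Section polar_holomorphy.
Variable R : realType.
Implicit Types (A B C D : R -> R -> R) (lo hi : R).

(** Uniform in the angle over the whole sector, because the bound serves as a constant majorant when
    the angle is differentiated under the integral. *)
Definition locally_bounded lo hi A := forall r1 r2 : R, 0 < r1 ->
  exists M : R, forall r phi : R, r1 <= r <= r2 -> lo < phi < hi -> `|A r phi| <= M.

(* [f = A + i B] is holomorphic in [z = r e^(i phi)], with [z f'(z) = C + i D]. *)
Record polar_holomorphic lo hi A B C D : Prop := PolarHolomorphic {
  polar_dAr : forall r phi : R, 0 < r -> lo < phi < hi -> is_derive r 1 (A ^~ phi) (C r phi / r);
  polar_dBr : forall r phi : R, 0 < r -> lo < phi < hi -> is_derive r 1 (B ^~ phi) (D r phi / r);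
  polar_dAphi : forall r phi : R, 0 < r -> lo < phi < hi -> is_derive phi 1 (A r) (- D r phi);
  polar_dBphi : forall r phi : R, 0 < r -> lo < phi < hi -> is_derive phi 1 (B r) (C r phi);
  polar_contC : forall r phi : R, 0 < r -> lo < phi < hi -> {for r, continuous (C ^~ phi)};
  polar_contD : forall r phi : R, 0 < r -> lo < phi < hi -> {for r, continuous (D ^~ phi)};
  polar_bndA : locally_bounded lo hi A;
  polar_bndB : locally_bounded lo hi B;
  polar_bndC : locally_bounded lo hi C;
  polar_bndD : locally_bounded lo hi D }.

Lemma locally_boundedM lo hi A B : locally_bounded lo hi A -> locally_bounded lo hi B ->
  locally_bounded lo hi (fun r phi => A r phi * B r phi).
Proof.
move=> hA hB r1 r2 r0; have [M hM] := hA r1 r2 r0; have [N hN] := hB r1 r2 r0.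
by exists (M * N) => r phi hr hp; rewrite normrM ler_pM// ?hM ?hN.
Qed.

Lemma locally_boundedD lo hi A B : locally_bounded lo hi A -> locally_bounded lo hi B ->
  locally_bounded lo hi (fun r phi => A r phi + B r phi).
Proof.
move=> hA hB r1 r2 r0; have [M hM] := hA r1 r2 r0; have [N hN] := hB r1 r2 r0.
by exists (M + N) => r phi hr hp; rewrite (le_trans (ler_normD _ _))// lerD ?hM ?hN.
Qed.

Lemma locally_boundedN lo hi A : locally_bounded lo hi A ->
  locally_bounded lo hi (fun r phi => - A r phi).
Proof.
move=> hA r1 r2 r0; have [M hM] := hA r1 r2 r0.
by exists M => r phi hr hp; rewrite normrN hM.
Qed.

Lemma locally_bounded_cst lo hi (c : R) : locally_bounded lo hi (fun _ _ => c).
Proof. by move=> r1 r2 r0; exists `|c|. Qed.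

Lemma polar_cst lo hi (c : R) :
  polar_holomorphic lo hi (fun _ _ => c) (fun _ _ => 0) (fun _ _ => 0) (fun _ _ => 0).
Proof.
split; try exact: locally_bounded_cst; move=> r phi r0 hp.
- by rewrite mul0r; exact: is_derive_fC.
- by rewrite mul0r; exact: is_derive_fC.
- by rewrite oppr0; exact: is_derive_fC.
- exact: is_derive_fC.
- exact: cst_continuous.
- exact: cst_continuous.
Qed.

(** The function is e^(i tau) z^s, for which z f'(z) = s f(z). A nonzero [tau] is used for the
    rotated variable z e^(- i th) of the kernel below. *)
Lemma polar_powR lo hi (s tau : R) :
  polar_holomorphic lo hi
    (fun r phi => r `^ s * cos (s * phi + tau)) (fun r phi => r `^ s * sin (s * phi + tau))
    (fun r phi => s * (r `^ s * cos (s * phi + tau))) (fun r phi => s * (r `^ s * sin (s * phi + tau))).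
Proof.
have bp : locally_bounded lo hi (fun r _ => r `^ s).
  move=> r1 r2 r10; exists (r1 `^ s + r2 `^ s) => r phi /andP[h1 h2] _.
  have r0 : 0 < r by exact: lt_le_trans h1.
  rewrite ger0_norm ?powR_ge0//; have [s0|/ltW s0] := leP 0 s.
    by rewrite (@le_trans _ _ (r2 `^ s))// ?lerDr ?powR_ge0// ge0_ler_powR ?nnegrE ?(ltW r0)// (le_trans (ltW r0)).
  rewrite (@le_trans _ _ (r1 `^ s))// ?lerDl ?powR_ge0//.
  rewrite -[s]opprK !(powRN _ (- s)) lef_pV2 ?posrE ?powR_gt0//.
  by rewrite ge0_ler_powR ?nnegrE ?oppr_ge0 ?(ltW r0) ?(ltW r10).
have bc : locally_bounded lo hi (fun _ phi => cos (s * phi + tau)).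
  by move=> r1 r2 r10; exists 1 => r phi _ _; rewrite ler_norml cos_geN1 cos_le1.
have bs : locally_bounded lo hi (fun _ phi => sin (s * phi + tau)).
  by move=> r1 r2 r10; exists 1 => r phi _ _; rewrite ler_norml sin_geN1 sin_le1.
have dlin (phi : R) : is_derive phi 1 (fun phi : R => s * phi + tau) s.
  apply: (is_derive_eq (is_derive_fD (is_derive_fZ s (is_derive_fid phi)) (is_derive_fC tau phi))).
  by rewrite mulr1 addr0.
have dr (r k : R) : 0 < r -> is_derive r 1 (fun r => r `^ s * k) (s * (r `^ s * k) / r).
  move=> r0; apply: (is_derive_eq (is_derive_fM (is_derive_fpowR s r0) (is_derive_fC k r))).
  have -> : r `^ s = r * r `^ (s - 1).
    by rewrite -[in X in X * _](powRr1 (ltW r0)) -powRD ?(gt_eqF r0) ?implybT // addrC subrK.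
  by rewrite mulr0 addr0; field; exact: lt0r_neq0.
split.
- by move=> r phi r0 _; exact: dr.
- by move=> r phi r0 _; exact: dr.
- move=> r phi r0 _.
  have d := is_derive_fcomp (f := cos) (g := fun phi => s * phi + tau) (is_derive_cos (s * phi + tau)) (dlin phi).
  by apply: (is_derive_eq (is_derive_fZ (r `^ s) d)); ring.
- move=> r phi r0 _.
  have d := is_derive_fcomp (f := sin) (g := fun phi => s * phi + tau) (is_derive_sin (s * phi + tau)) (dlin phi).
  by apply: (is_derive_eq (is_derive_fZ (r `^ s) d)); ring.
- move=> r phi r0 _; apply: cvgM; first exact: cvg_cst.
  by apply: cvgM; [exact: continuous_powR|exact: cvg_cst].
- move=> r phi r0 _; apply: cvgM; first exact: cvg_cst.
  by apply: cvgM; [exact: continuous_powR|exact: cvg_cst].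
- exact: locally_boundedM.
- exact: locally_boundedM.
- by apply: locally_boundedM; [exact: locally_bounded_cst|exact: locally_boundedM].
- by apply: locally_boundedM; [exact: locally_bounded_cst|exact: locally_boundedM].
Qed.

Lemma polarD lo hi A1 B1 C1 D1 A2 B2 C2 D2 :
  polar_holomorphic lo hi A1 B1 C1 D1 -> polar_holomorphic lo hi A2 B2 C2 D2 ->
  polar_holomorphic lo hi (fun r phi => A1 r phi + A2 r phi) (fun r phi => B1 r phi + B2 r phi)
    (fun r phi => C1 r phi + C2 r phi) (fun r phi => D1 r phi + D2 r phi).
Proof.
move=> h1 h2; split; try (move=> r phi r0 hp).
- by rewrite mulrDl; apply: is_derive_fD; [exact: (polar_dAr h1)|exact: (polar_dAr h2)].
- by rewrite mulrDl; apply: is_derive_fD; [exact: (polar_dBr h1)|exact: (polar_dBr h2)].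
- by rewrite opprD; apply: is_derive_fD; [exact: (polar_dAphi h1)|exact: (polar_dAphi h2)].
- by apply: is_derive_fD; [exact: (polar_dBphi h1)|exact: (polar_dBphi h2)].
- by apply: cvgD; [exact: (polar_contC h1)|exact: (polar_contC h2)].
- by apply: cvgD; [exact: (polar_contD h1)|exact: (polar_contD h2)].
- by apply: locally_boundedD; [exact: (polar_bndA h1)|exact: (polar_bndA h2)].
- by apply: locally_boundedD; [exact: (polar_bndB h1)|exact: (polar_bndB h2)].
- by apply: locally_boundedD; [exact: (polar_bndC h1)|exact: (polar_bndC h2)].
- by apply: locally_boundedD; [exact: (polar_bndD h1)|exact: (polar_bndD h2)].
Qed.

Lemma polarM lo hi A1 B1 C1 D1 A2 B2 C2 D2 :
  polar_holomorphic lo hi A1 B1 C1 D1 -> polar_holomorphic lo hi A2 B2 C2 D2 ->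
  polar_holomorphic lo hi
    (fun r phi => A1 r phi * A2 r phi - B1 r phi * B2 r phi)
    (fun r phi => A1 r phi * B2 r phi + B1 r phi * A2 r phi)
    (fun r phi => C1 r phi * A2 r phi - D1 r phi * B2 r phi + (A1 r phi * C2 r phi - B1 r phi * D2 r phi))
    (fun r phi => C1 r phi * B2 r phi + D1 r phi * A2 r phi + (A1 r phi * D2 r phi + B1 r phi * C2 r phi)).
Proof.
case=> dA1 dB1 eA1 eB1 cC1 cD1 bA1 bB1 bC1 bD1; case=> dA2 dB2 eA2 eB2 cC2 cD2 bA2 bB2 bC2 bD2.
split; try (move=> r phi r0 hp).
- apply: (is_derive_eq (is_derive_fB (is_derive_fM (dA1 _ _ r0 hp) (dA2 _ _ r0 hp)) (is_derive_fM (dB1 _ _ r0 hp) (dB2 _ _ r0 hp)))).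
  by rewrite /=; ring.
- apply: (is_derive_eq (is_derive_fD (is_derive_fM (dA1 _ _ r0 hp) (dB2 _ _ r0 hp)) (is_derive_fM (dB1 _ _ r0 hp) (dA2 _ _ r0 hp)))).
  by rewrite /=; ring.
- apply: (is_derive_eq (is_derive_fB (is_derive_fM (eA1 _ _ r0 hp) (eA2 _ _ r0 hp)) (is_derive_fM (eB1 _ _ r0 hp) (eB2 _ _ r0 hp)))).
  by rewrite /=; ring.
- apply: (is_derive_eq (is_derive_fD (is_derive_fM (eA1 _ _ r0 hp) (eB2 _ _ r0 hp)) (is_derive_fM (eB1 _ _ r0 hp) (eA2 _ _ r0 hp)))).
  by rewrite /=; ring.
- have a1 := is_derive_continuous (dA1 _ _ r0 hp); have a2 := is_derive_continuous (dA2 _ _ r0 hp).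
  have b1 := is_derive_continuous (dB1 _ _ r0 hp); have b2 := is_derive_continuous (dB2 _ _ r0 hp).
  have c1 := cC1 _ _ r0 hp; have c2 := cC2 _ _ r0 hp; have d1 := cD1 _ _ r0 hp; have d2 := cD2 _ _ r0 hp.
  by apply: cvgD; apply: cvgB; exact: cvgM.
- have a1 := is_derive_continuous (dA1 _ _ r0 hp); have a2 := is_derive_continuous (dA2 _ _ r0 hp).
  have b1 := is_derive_continuous (dB1 _ _ r0 hp); have b2 := is_derive_continuous (dB2 _ _ r0 hp).
  have c1 := cC1 _ _ r0 hp; have c2 := cC2 _ _ r0 hp; have d1 := cD1 _ _ r0 hp; have d2 := cD2 _ _ r0 hp.
  by apply: cvgD; apply: cvgD; exact: cvgM.
- by apply: locally_boundedD; [|apply: locally_boundedN]; exact: locally_boundedM.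
- by apply: locally_boundedD; exact: locally_boundedM.
- by apply: locally_boundedD; (apply: locally_boundedD; [|apply: locally_boundedN]); exact: locally_boundedM.
- by do !apply: locally_boundedD; exact: locally_boundedM.
Qed.

(** 1 / f is the conjugate of f over |f|^2, and z (1 / f)' is - z f' times the squared conjugate of
    f over |f|^4; the last two functions are its real and imaginary parts. They are spelled with
    products, in the shape of [locally_boundedM]. *)
Lemma polarV lo hi A B C D : polar_holomorphic lo hi A B C D ->
  (forall r phi : R, 0 < r -> lo < phi < hi -> 0 < A r phi ^+ 2 + B r phi ^+ 2) ->
  locally_bounded lo hi (fun r phi => (A r phi ^+ 2 + B r phi ^+ 2)^-1) ->
  polar_holomorphic lo hi
    (fun r phi => A r phi * (A r phi ^+ 2 + B r phi ^+ 2)^-1)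
    (fun r phi => - (B r phi * (A r phi ^+ 2 + B r phi ^+ 2)^-1))
    (fun r phi => - ((C r phi * (A r phi * A r phi - B r phi * B r phi) + 2 * (D r phi * (A r phi * B r phi))) *
       ((A r phi ^+ 2 + B r phi ^+ 2)^-1 * (A r phi ^+ 2 + B r phi ^+ 2)^-1)))
    (fun r phi => - ((D r phi * (A r phi * A r phi - B r phi * B r phi) - 2 * (C r phi * (A r phi * B r phi))) *
       ((A r phi ^+ 2 + B r phi ^+ 2)^-1 * (A r phi ^+ 2 + B r phi ^+ 2)^-1))).
Proof.
case=> dA dB eA eB cC cD bA bB bC bD pos bV.
have dn (r phi : R) : 0 < r -> lo < phi < hi ->
    is_derive r 1 (fun r => (A r phi ^+ 2 + B r phi ^+ 2)^-1)
     (- (2 * (A r phi * C r phi + B r phi * D r phi) / r) / (A r phi ^+ 2 + B r phi ^+ 2) ^+ 2).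
  move=> r0 hp; have n0 := lt0r_neq0 (pos r phi r0 hp).
  have d := is_derive_fD (is_derive_fM (dA _ _ r0 hp) (dA _ _ r0 hp)) (is_derive_fM (dB _ _ r0 hp) (dB _ _ r0 hp)).
  apply: (is_derive_eq (is_derive_fV d _)); first by rewrite /= -!expr2.
  by rewrite /= -!expr2; congr (- _ / _); ring.
have en (r phi : R) : 0 < r -> lo < phi < hi ->
    is_derive phi 1 (fun phi => (A r phi ^+ 2 + B r phi ^+ 2)^-1)
     (- (2 * (B r phi * C r phi - A r phi * D r phi)) / (A r phi ^+ 2 + B r phi ^+ 2) ^+ 2).
  move=> r0 hp; have n0 := lt0r_neq0 (pos r phi r0 hp).
  have d := is_derive_fD (is_derive_fM (eA _ _ r0 hp) (eA _ _ r0 hp)) (is_derive_fM (eB _ _ r0 hp) (eB _ _ r0 hp)).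
  apply: (is_derive_eq (is_derive_fV d _)); first by rewrite /= -!expr2.
  by rewrite /= -!expr2; congr (- _ / _); ring.
have cont (r phi : R) : 0 < r -> lo < phi < hi ->
   [/\ {for r, continuous (A ^~ phi)}, {for r, continuous (B ^~ phi)},
       {for r, continuous (C ^~ phi)}, {for r, continuous (D ^~ phi)} &
       {for r, continuous (fun r => (A r phi ^+ 2 + B r phi ^+ 2)^-1)}].
  move=> r0 hp; split; [exact: is_derive_continuous (dA _ _ r0 hp)|exact: is_derive_continuous (dB _ _ r0 hp)|exact: cC|exact: cD|exact: is_derive_continuous (dn _ _ r0 hp)].
split; try (move=> r phi r0 hp); try have n0 := lt0r_neq0 (pos r phi r0 hp); try have r1 := lt0r_neq0 r0.
- apply: (is_derive_eq (is_derive_fM (dA _ _ r0 hp) (dn _ _ r0 hp))).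
  by rewrite /=; field; rewrite r1 n0.
- apply: (is_derive_eq (is_derive_fN (is_derive_fM (dB _ _ r0 hp) (dn _ _ r0 hp)))).
  by rewrite /=; field; rewrite r1 n0.
- apply: (is_derive_eq (is_derive_fM (eA _ _ r0 hp) (en _ _ r0 hp))).
  by rewrite /=; field; rewrite n0.
- apply: (is_derive_eq (is_derive_fN (is_derive_fM (eB _ _ r0 hp) (en _ _ r0 hp)))).
  by rewrite /=; field; rewrite n0.
- have [a b c d n] := cont _ _ r0 hp.
  apply: cvgN; apply: cvgM; last exact: cvgM.
  apply: cvgD; last by apply: cvgM; [exact: cvg_cst|apply: cvgM => //; exact: cvgM].
  by apply: cvgM => //; apply: cvgB; exact: cvgM.
- have [a b c d n] := cont _ _ r0 hp.
  apply: cvgN; apply: cvgM; last exact: cvgM.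
  apply: cvgB; last by apply: cvgM; [exact: cvg_cst|apply: cvgM => //; exact: cvgM].
  by apply: cvgM => //; apply: cvgB; exact: cvgM.
- exact: locally_boundedM.
- by apply: locally_boundedN; exact: locally_boundedM.
- apply: locally_boundedN; apply: locally_boundedM; last exact: locally_boundedM.
  apply: locally_boundedD.
    apply: locally_boundedM => //; apply: locally_boundedD; first exact: locally_boundedM.
    by apply: locally_boundedN; exact: locally_boundedM.
  apply: locally_boundedM; first exact: locally_bounded_cst.
  by apply: locally_boundedM => //; exact: locally_boundedM.
- apply: locally_boundedN; apply: locally_boundedM; last exact: locally_boundedM.
  apply: locally_boundedD.
    apply: locally_boundedM => //; apply: locally_boundedD; first exact: locally_boundedM.
    by apply: locally_boundedN; exact: locally_boundedM.
  apply: locally_boundedN; apply: locally_boundedM; first exact: locally_bounded_cst.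
  by apply: locally_boundedM => //; exact: locally_boundedM.
Qed.

End polar_holomorphy.

(** * The Poisson kernel as an approximate identity *)

Section poisson_kernel.
Variable R : realType.
Local Notation mu := (@lebesgue_measure R).
Local Notation oy := (`]0%R, +oo[%classic : set R).
Local Notation moy := (@measurable_oy R).
Implicit Types (s r d : R).

Let tail (p q r : R) : R := if r <= 1 then r `^ (p - 1) else r `^ (- q - 1).

(** Growth allowed against the Stieltjes kernel 1 / (r (r + s)): like r^p at 0 and, since the kernel
    decays like r^(-2), like r^(1 - q) at infinity. *)
Definition power_bound (K p q r : R) : R := if r <= 1 then K * r `^ p else K * r `^ (1 - q).

Let measurable_tail p q : measurable_fun [set: R] (tail p q).
Proof.
apply: measurable_fun_ifT; last 2 first.
- exact: measurable_powR.
- exact: measurable_powR.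
by apply: measurable_fun_ler; [exact: measurable_id|exact: measurable_cst].
Qed.

Lemma integrable_tail (K p q : R) : 0 < p -> 0 < q ->
  mu.-integrable oy (EFin \o (fun r : R => K * (if r <= 1 then r `^ (p - 1) else r `^ (- q - 1)))).
Proof.
move=> p0 q0; apply: integrableZ; first exact: moy.
apply: (integrable_powR_bound (C := 1) (p := p) (q := q)) => //.
- by apply: measurable_funTS; exact: measurable_tail.
- by move=> r r0 ->; rewrite mul1r ger0_norm ?powR_ge0.
- move=> r; rewrite le_eqVlt => /predU1P[<-|r1].
    by rewrite lexx !powR1 mulr1 normr1.
  by rewrite [r <= 1]leNgt r1/= mul1r ger0_norm ?powR_ge0.
Qed.

(** The denominator is |r - s e^(i d)|^2: up to normalization this is the Poisson kernel of the
    half-plane at s e^(i d), which concentrates at r = s as [d] tends to 0. *)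
Definition poisson s d r : R := sin d / (r ^+ 2 - 2 * r * s * cos d + s ^+ 2).

Lemma poisson_den s d r : r ^+ 2 - 2 * r * s * cos d + s ^+ 2 = (r - s * cos d) ^+ 2 + (s * sin d) ^+ 2.
Proof. by have := cos2Dsin2 d => h; rewrite exprMn (sin2cos2 d); ring. Qed.

Lemma poisson_den_gt0 s d r : 0 < s -> 0 < d < pi ->
  0 < r ^+ 2 - 2 * r * s * cos d + s ^+ 2.
Proof.
move=> s0 d0; rewrite poisson_den ltr_wpDl ?sqr_ge0// exprn_gt0// mulr_gt0//.
exact: sin_gt0_pi.
Qed.

Lemma poisson_ge0 s d r : 0 < s -> 0 < d < pi -> 0 <= poisson s d r.
Proof.
move=> s0 d0; rewrite divr_ge0 ?ltW ?poisson_den_gt0//; exact: sin_gt0_pi.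
Qed.

Lemma measurable_poisson s d : measurable_fun [set: R] (poisson s d).
Proof. by rewrite /poisson; mfun. Qed.

(** The primitive is an arctangent; its limit at infinity is pi / (2 s) and its value at 0 is - (pi
    / 2 - d) / s, because cos d / sin d = tan (pi / 2 - d). The mass therefore tends to pi / s as
    [d] tends to 0, which is the constant of the inversion. *)
Lemma poisson_mass s d : 0 < s -> 0 < d < pi ->
  (\int[mu]_(r in oy) (poisson s d r)%:E = ((pi - d) / s)%:E)%E.
Proof.
move=> s0 d0; have sd := sin_gt0_pi d0.
have ss : 0 < s * sin d by rewrite mulr_gt0.
rewrite integral_itv_obnd_cbnd; last first.
  by apply/measurable_EFinP; apply: measurable_funTS; exact: measurable_poisson.
pose F r : R := s^-1 * atan ((r - s * cos d) / (s * sin d)).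
have dF r : is_derive r 1 F (poisson s d r).
  have d1 := is_derive_fM (is_derive_fB (is_derive_fid r) (is_derive_fC (s * cos d) r)) (is_derive_fC (s * sin d)^-1 r).
  have d2 := is_derive_fcomp (f := atan) (g := fun r => (r - s * cos d) / (s * sin d)) (is_derive1_atan _) d1.
  apply: (is_derive_eq (is_derive_fZ s^-1 d2)).
  have := poisson_den_gt0 r s0 d0; rewrite /poisson poisson_den => /lt0r_neq0 h.
  by field; rewrite h !gt_eqF.
rewrite (@ge0_continuous_FTC2y _ _ F 0 (s^-1 * (pi / 2))).
- have -> : F 0 = s^-1 * - (pi / 2 - d).
    rewrite /F sub0r; congr (_ * _).
    have -> : - (s * cos d) / (s * sin d) = - tan (pi / 2 - d).
      rewrite /tan -opprB sinN cosN sinBpihalf cosBpihalf opprK.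
      by field; rewrite !gt_eqF.
    rewrite atanN tanK// in_itv/=; case/andP: d0 => d1 d2; apply/andP; split; lra.
  by rewrite -EFinB; congr (_%:E); field; rewrite gt_eqF.
- by move=> x _; exact: poisson_ge0.
- apply: continuous_subspaceT => r; rewrite /poisson.
  apply: cvgM; first exact: cvg_cst.
  apply: cvgV; first by rewrite gt_eqF// poisson_den_gt0.
  apply: cvgD; last exact: cvg_cst.
  apply: cvgB; first exact: exprn_continuous.
  apply: cvgM; last exact: cvg_cst.
  apply: cvgM; last exact: cvg_cst.
  by apply: cvgM; [exact: cvg_cst|exact: cvg_id].
- apply: cvgM; first exact: cvg_cst.
  apply: (cvg_comp (fun r => (r - s * cos d) / (s * sin d)) atan); last exact: cvgy_atan.
  apply/cvgryPge => M; near=> r.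
  rewrite ler_pdivlMr// lerBrDr; near: r; apply: nbhs_pinfty_ge; exact: num_real.
- by move=> r _; have [] := dF r.
- by apply: cvg_at_right_filter; apply: (is_derive_continuous (dF 0)).
- by move=> r _; rewrite derive1E; have [_ ->] := dF r.
Unshelve. all: by end_near. Qed.

Lemma integrable_poisson s d : 0 < s -> 0 < d < pi ->
  mu.-integrable oy (EFin \o poisson s d).
Proof.
move=> s0 d0; apply: (ge0_integral_eq_integrable (r := (pi - d) / s)).
- by apply: measurable_funTS; exact: measurable_poisson.
- by move=> r _; exact: poisson_ge0.
- exact: poisson_mass.
Qed.

(** A concrete sequence inside ]0, pi[ tending to 0, because limits of integrals are taken along
    sequences. *)
Definition angle (k : nat) : R := k.+1%:R^-1.

Lemma angle_bounds k : 0 < angle k < pi.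
Proof.
rewrite invr_gt0 ltr0Sn/= (@le_lt_trans _ _ 1)//; first by rewrite invf_le1// ler1n.
by rewrite (@lt_le_trans _ _ 2) ?pi_ge2// ltr1n.
Qed.

Lemma cvg_angle : angle k @[k --> \oo] --> (0 : R).
Proof. exact: cvg_harmonic. Qed.

(** Near [s], the oscillation of [f] is integrated against a kernel of bounded mass; away from [s],
    the factor sin d tends to 0 while the rest has an integrable majorant independent of d. *)
Lemma cvg_poisson s (f : R -> R) (K p q : R) : 0 < s -> 0 < p -> 0 < q ->
  measurable_fun oy f ->
  (forall r, 0 < r -> `|f r| <= power_bound K p q r) ->
  {for s, continuous f} ->
  \int[mu]_(r in oy) (f r * poisson s (angle k) r) @[k --> \oo] --> pi * f s / s.
Proof.
move=> s0 p0 q0 mf bf cf.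
have K0 : 0 <= K.
  by have := bf 1 ltr01; rewrite /power_bound lexx powR1 mulr1; apply: le_trans.
(* Majorant away from [s], where |r - s e^(i d)| is at least a constant times 1 + r. *)
pose w r := (`|f r| + `|f s|) * (1 + r) ^- 2.
have wi : mu.-integrable oy (EFin \o w).
  have e r : w r = `|f r| * (1 + r) ^- 2 + `|f s| * (1 + r) ^- 2 by rewrite /w mulrDl.
  rewrite (_ : w = fun r => `|f r| * (1 + r) ^- 2 + `|f s| * (1 + r) ^- 2); last exact/funext.
  have inv1 r : 0 < r -> 0 <= (1 + r) ^- 2 <= 1.
    move=> r0; rewrite invr_ge0 sqr_ge0/= invf_le1 ?exprn_gt0 ?addr_gt0//.
    by rewrite -[leLHS](expr1n _ 2) lerXn2r ?nnegrE ?addr_ge0 ?ltW// ltrDl.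
  have inv2 r : 0 < r -> 0 <= (1 + r) ^- 2 <= r `^ (-2%:R).
    move=> r0; rewrite invr_ge0 sqr_ge0/= powRN powR_mulrn ?(ltW r0)//.
    by rewrite lef_pV2 ?posrE ?exprn_gt0 ?addr_gt0// lerXn2r ?nnegrE ?addr_ge0 ?(ltW r0)// lerDr.
  apply: integrableDr; first exact: moy.
    apply: (integrable_powR_bound (C := K) (p := p + 1) (q := q)) => //.
    - by rewrite addr_gt0.
    - by mfun.
    - move=> r r0 r1; have := bf r r0; rewrite /power_bound r1 addrK => h.
      have /andP[i0 i1] := inv1 r r0.
      rewrite normrM normr_id (ger0_norm i0) -[leRHS]mulr1 ler_pM//.
    - move=> r r1; have r0 : 0 < r by exact: lt_le_trans r1.
      have /andP[i0 i2] := inv2 r r0.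
      have h : `|f r| <= K * r `^ (1 - q).
        have := bf r r0; rewrite /power_bound; case: ifP => // r1'.
        have -> : r = 1 by apply/eqP; rewrite eq_le r1 r1'.
        by rewrite !powR1.
      rewrite normrM normr_id (ger0_norm i0).
      have -> : K * r `^ (- q - 1) = K * r `^ (1 - q) * r `^ (- 2%:R).
        rewrite -mulrA -powRD; last by rewrite (gt_eqF r0) implybT.
        by congr (_ * _ `^ _); ring.
      exact: ler_pM.
  apply: (integrable_powR_bound (C := `|f s|) (p := 1) (q := 1)) => //.
  - by mfun.
  - move=> r r0 r1; have /andP[i0 i1] := inv1 r r0.
    by rewrite subrr powRr0 mulr1 normrM normr_id (ger0_norm i0) ler_piMr.
  - move=> r r1; have r0 : 0 < r by exact: lt_le_trans r1.
    have /andP[i0 i2] := inv2 r r0.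
    rewrite normrM normr_id (ger0_norm i0) ler_wpM2l//.
    by have -> : -1 - 1 = - 2%:R :> R by ring.
have main eps : 0 < eps -> exists L, forall d, 0 < d < pi ->
    `|\int[mu]_(r in oy) (f r * poisson s d r) - f s * ((pi - d) / s)|
      <= eps * ((pi - d) / s) + sin d * (L * \int[mu]_(r in oy) w r).
  move=> eps0.
  have : \forall r \near s, `|f s - f r| <= eps by move/cvgrPdist_le: (cf) => /(_ eps eps0).
  move=> /nbhs_ballP[eta /= eta0 heta].
  (* 1 + r <= (1 + s) + |r - s|, and 1 + s <= ((1 + s) / eta) |r - s| as soon as |r - s| >= eta. *)
  pose L := ((1 + s) / eta + 1) ^+ 2; exists L => d d0.
  have sd : 0 <= sin d by exact/ltW/sin_gt0_pi.
  have L0 : 0 <= L by exact: sqr_ge0.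
  have ip := integrable_poisson s0 d0.
  have pt r : oy r -> `|f r * poisson s d r - f s * poisson s d r| <=
      eps * poisson s d r + sin d * L * w r.
    rewrite /= in_itv/= andbT => r0.
    have P0 := poisson_ge0 r s0 d0.
    have w0 : 0 <= w r by rewrite mulr_ge0 ?addr_ge0 ?invr_ge0 ?sqr_ge0.
    rewrite -mulrBl normrM (ger0_norm P0).
    have [near_s|far] := ltP `|s - r| eta.
      rewrite (@le_trans _ _ (eps * poisson s d r))//; last first.
        by rewrite lerDl mulr_ge0// mulr_ge0.
      by rewrite ler_wpM2r// distrC; apply: heta.
    rewrite (@le_trans _ _ (sin d * L * w r))//; last first.
      by rewrite lerDr mulr_ge0// ltW.
    rewrite /poisson mulrCA -(mulrA (sin d)); apply: ler_wpM2l => //.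
    rewrite /w mulrCA; apply: ler_pM => //.
    - by rewrite invr_ge0 ltW// poisson_den_gt0.
    - exact: ler_normB.
    - have den : (s - r) ^+ 2 <= r ^+ 2 - 2 * r * s * cos d + s ^+ 2.
        have rs : 0 <= r * s by apply: mulr_ge0; exact: ltW.
        have := ler_wpM2l rs (cos_le1 d); rewrite mulr1 => h; nra.
      have sr0 : 0 < (s - r) ^+ 2.
        rewrite -real_normK ?num_real// exprn_gt0//.
        exact: lt_le_trans far.
      have h1 : (1 + r) ^+ 2 <= L * (s - r) ^+ 2.
        rewrite -[(s - r) ^+ 2]real_normK ?num_real// -exprMn lerXn2r ?nnegrE//.
        - by rewrite addr_ge0 ?ltW.
        - by rewrite mulr_ge0// addr_ge0// divr_ge0 ?addr_ge0 ?ltW.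
        rewrite mulrDl mul1r (@le_trans _ _ ((1 + s) + `|s - r|))//.
          have := ler_norm (r - s); rewrite distrC; lra.
        rewrite lerD2r mulrAC ler_pdivlMr//; apply: ler_wpM2l => //.
        by rewrite addr_ge0// ltW.
      rewrite ler_pdivlMr ?exprn_gt0 ?addr_gt0//.
      rewrite mulrC ler_pdivrMr; last exact: (lt_le_trans sr0 den).
      by rewrite (le_trans h1)// ler_wpM2l.
  have ip1 : mu.-integrable oy (EFin \o (fun r => f s * poisson s d r)).
    by apply: integrableZ => //; exact: moy.
  have ib : mu.-integrable oy (EFin \o (fun r => eps * poisson s d r + sin d * L * w r)).
    by apply: integrableDr; [exact: moy|apply: integrableZ => //; exact: moy|apply: integrableZ => //; exact: moy].
  have idf : mu.-integrable oy (EFin \o (fun r => f r * poisson s d r - f s * poisson s d r)).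
    apply: (integrable_dom (m := mu) moy _ pt ib).
    have mp := measurable_funTS (D := oy) (measurable_poisson s d).
    by mfun.
  have if1 : mu.-integrable oy (EFin \o (fun r => f r * poisson s d r)).
    have := integrableDr moy idf ip1.
    by under [X in _.-integrable _ (EFin \o X)]eq_fun do rewrite subrK.
  have mass : \int[mu]_(r in oy) poisson s d r = (pi - d) / s.
    by rewrite /Rintegral poisson_mass.
  rewrite -mass -(RintegralZl _ moy ip) -(RintegralB moy if1 ip1).
  apply: (le_trans (le_normr_Rintegral moy idf)).
  apply: (le_trans (le_Rintegral moy (integrable_norm idf) ib pt)).
  by rewrite (RintegralD moy (integrableZ moy _ ip) (integrableZ moy _ wi)) (RintegralZl _ moy ip) (RintegralZl _ moy wi) -(mulrA (sin d)).
apply/cvgrPdist_le => e e0.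
(* The mass of the kernel is below pi / s, so with this tolerance the part near [s] contributes at
   most e / 2. *)
have eps0 : 0 < e * s / (2 * pi) by rewrite divr_gt0 ?mulr_gt0// pi_gt0.
have [L HL] := main _ eps0.
pose W := \int[mu]_(r in oy) w r.
have c0 : `|f s| / s * angle k + L * W * sin (angle k) @[k --> \oo] --> (0 : R).
  rewrite -[X in _ --> X]addr0; apply: cvgD.
    rewrite -[X in _ --> X](mulr0 (`|f s| / s)); apply: cvgM; [exact: cvg_cst|exact: cvg_angle].
  rewrite -[X in _ --> X](mulr0 (L * W)); apply: cvgM; first exact: cvg_cst.
  rewrite -[X in _ --> X](@sin0 R).
  by apply: (cvg_comp angle sin); [exact: cvg_angle|exact: continuous_sin].
have e20 : 0 < e / 2 by rewrite divr_gt0.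
near=> k.
have /andP[k0 kpi] := angle_bounds k.
have hk := HL (angle k) (angle_bounds k).
have small : `|f s| / s * angle k + L * W * sin (angle k) <= e / 2.
  by near: k; exact: (cvgr_le _ c0).
have := ler_distD (f s * ((pi - angle k) / s)) (pi * f s / s) (\int[mu]_(r in oy) (f r * poisson s (angle k) r)).
move=> /le_trans; apply.
have -> : pi * f s / s - f s * ((pi - angle k) / s) = f s / s * angle k.
  by field; rewrite gt_eqF.
rewrite [X in _ + X]distrC normrM (gtr0_norm k0) normrM normfV (gtr0_norm s0).
rewrite (le_trans (lerD (lexx _) hk))//.
have h2 : e * s / (2 * pi) * ((pi - angle k) / s) <= e / 2.
  have E (P a : R) : 0 < P -> e * s / (2 * P) * ((P - a) / s) = e / 2 * ((P - a) / P).
    by move=> P0; field; rewrite !gt_eqF.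
  rewrite E ?pi_gt0//.
  by rewrite ler_piMr ?(ltW e20)// ler_pdivrMr ?pi_gt0// mul1r gerBl ltW.
rewrite -/W.
have -> : sin (angle k) * (L * W) = L * W * sin (angle k) by rewrite mulrC.
lra.
Unshelve. all: by end_near. Qed.

End poisson_kernel.

(** * Stieltjes inversion by rotation of the ray *)

Section stieltjes.
Variable R : realType.
Local Notation mu := (@lebesgue_measure R).
Local Notation oy := (`]0%R, +oo[%classic : set R).
Local Notation moy := (@measurable_oy R).

Lemma norm_div_sq (x n m : R) : 0 < m -> x ^+ 2 <= n -> m ^+ 2 <= n -> `|x / n| <= m^-1.
Proof.
move=> m0 xn mn; have n0 : 0 < n by apply: lt_le_trans mn; rewrite exprn_gt0.
rewrite normrM normfV (gtr0_norm n0) ler_pdivrMr// mulrC ler_pdivlMr//.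
rewrite -(@ler_pXn2r _ 2) ?nnegrE ?mulr_ge0 ?(ltW m0) ?(ltW n0)//.
rewrite exprMn real_normK ?num_real// expr2 ler_pM// ?sqr_ge0//.
Qed.

Section kernel.
Variables (s th : R).
Hypotheses (s0 : 0 < s) (th0 : 0 < th < pi).

(** [N1] and [N2] are the real and imaginary parts of z e^(- i th) + s. Its zeros have argument th -
    pi modulo 2 pi, outside the upper half-plane, so its inverse is regular along the whole
    rotation. *)
Let N1 (r phi : R) := r `^ 1 * cos (1 * phi + - th) + s.
Let N2 (r phi : R) := r `^ 1 * sin (1 * phi + - th) + 0.
Let n (r phi : R) := N1 r phi ^+ 2 + N2 r phi ^+ 2.

Let sth : 0 < sin th. Proof. exact: sin_gt0_pi. Qed.

Let nE r phi : 0 < r -> n r phi = r ^+ 2 + 2 * r * s * cos (phi - th) + s ^+ 2.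
Proof.
move=> r0; rewrite /n /N1 /N2 powRr1 ?(ltW r0)// mul1r addr0.
rewrite [(r * sin _) ^+ 2]exprMn (sin2cos2 (phi - th)); ring.
Qed.

Let ler_cos (x y : R) : 0 <= y -> y <= x -> x <= pi -> cos x <= cos y.
Proof.
move=> y0 yx xpi; rewrite leNgt; apply/negP.
rewrite ltr_cos ?in_itv/= ?y0 ?(le_trans yx xpi) ?(le_trans y0 yx)// ltNge yx.
by [].
Qed.

(** The distance |phi - th| is at most pi - th or at most th, and both these angles have cosine at
    least - |cos th|. *)
Let cos_lower phi : 0 < phi < pi -> - `|cos th| <= cos (phi - th).
Proof.
move=> /andP[p0 ppi]; case/andP: th0 => t0 tpi.
have [h|h] := leP th phi.
  rewrite (@le_trans _ _ (cos (pi - th)))//.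
    by rewrite cosB cospi sinpi mul0r addr0 mulN1r lerN2 ler_norm.
  by apply: ler_cos; lra.
rewrite -[cos (phi - th)]cosN opprB (@le_trans _ _ (cos th))//.
  by rewrite lerNl -normrN ler_norm.
by apply: ler_cos; lra.
Qed.

(** With c = |cos th|, the form r^2 - 2 r s c + s^2 is at least s^2 (1 - c^2) for fixed s and at
    least r^2 (1 - c^2) for fixed r. The first bound serves for r near 0, the second at infinity. *)
Let n_lower r phi : 0 < r -> 0 < phi < pi ->
  (s * sin th) ^+ 2 <= n r phi /\ (sin th * r) ^+ 2 <= n r phi.
Proof.
move=> r0 hp; have := cos_lower hp; set c := `|cos th| => h.
have c2 : c ^+ 2 + sin th ^+ 2 = 1.
  by rewrite /c real_normK ?num_real// cos2Dsin2.
have nl : r ^+ 2 - 2 * r * s * c + s ^+ 2 <= n r phi.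
  rewrite nE//; have rs : 0 < r * s by exact: mulr_gt0.
  have := ler_wpM2l (ltW rs) h; nra.
have e : sin th ^+ 2 = 1 - c ^+ 2 by rewrite -c2 addrC addKr.
split; apply: le_trans nl.
  rewrite exprMn e; have := sqr_ge0 (r - s * c); nra.
rewrite exprMn e; have := sqr_ge0 (s - r * c); nra.
Qed.

Let n_gt0 r phi : 0 < r -> 0 < phi < pi -> 0 < n r phi.
Proof.
move=> r0 hp; have [h _] := n_lower r0 hp.
by apply: lt_le_trans h; rewrite exprn_gt0// mulr_gt0.
Qed.

Let N_bound r phi : 0 < r -> 0 < phi < pi ->
  [/\ `|N1 r phi / n r phi| <= (s * sin th)^-1, `|N2 r phi / n r phi| <= (s * sin th)^-1,
      `|N1 r phi / n r phi| <= (sin th * r)^-1 & `|N2 r phi / n r phi| <= (sin th * r)^-1].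
Proof.
move=> r0 hp; have [h1 h2] := n_lower r0 hp.
have a1 : N1 r phi ^+ 2 <= n r phi by rewrite lerDl sqr_ge0.
have a2 : N2 r phi ^+ 2 <= n r phi by rewrite lerDr sqr_ge0.
by split; apply: norm_div_sq => //; exact: mulr_gt0.
Qed.

Let polar_kernel lo hi : 0 <= lo -> hi <= pi -> exists C D,
  polar_holomorphic lo hi (fun r phi => N1 r phi * (n r phi)^-1)
    (fun r phi => - (N2 r phi * (n r phi)^-1)) C D.
Proof.
move=> lo0 hipi.
have sub phi : lo < phi < hi -> 0 < phi < pi.
  by move=> /andP[h1 h2]; rewrite (le_lt_trans lo0 h1) (lt_le_trans h2 hipi).
have hN := polarD (polar_powR lo hi 1 (- th)) (polar_cst lo hi s).
do 2 eexists; apply: (polarV hN).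
- by move=> r phi r0 /sub; exact: n_gt0.
- move=> r1 r2 r10; exists ((s * sin th) ^- 2) => r phi /andP[h1 _] /sub hp.
  have r0 : 0 < r by exact: lt_le_trans h1.
  have [h _] := n_lower r0 hp.
  have m0 : 0 < (s * sin th) ^+ 2 by rewrite exprn_gt0// mulr_gt0.
  rewrite ger0_norm ?invr_ge0 ?(ltW (n_gt0 r0 hp))//.
  by rewrite lef_pV2 ?posrE ?n_gt0.
Qed.

Variables (A B : R -> R -> R) (K p q : R).
Hypotheses (p0 : 0 < p) (q0 : 0 < q).
Hypothesis holAB : forall lo hi, 0 < lo -> hi < pi ->
  exists C D, polar_holomorphic lo hi A B C D.
Hypothesis bndAB : forall r phi, 0 < r -> 0 < phi < pi ->
  `|A r phi| <= power_bound K p q r /\ `|B r phi| <= power_bound K p q r.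

Let K0 : 0 <= K.
Proof.
have /(_ ltr01)[//|+ _] := @bndAB 1 th.
by rewrite /power_bound lexx powR1 mulr1; apply: le_trans.
Qed.

Let Af (r phi : R) := A r phi * (N1 r phi * (n r phi)^-1) - B r phi * - (N2 r phi * (n r phi)^-1).
Let Bf (r phi : R) := A r phi * - (N2 r phi * (n r phi)^-1) + B r phi * (N1 r phi * (n r phi)^-1).

Let K' := 2 * K * ((s * sin th)^-1 + (sin th)^-1).

Let K'0 : 0 <= K'.
Proof.
apply: mulr_ge0; first by apply: mulr_ge0 => //; exact: K0.
by apply: addr_ge0; rewrite invr_ge0 ltW// mulr_gt0.
Qed.

Let bnd_lin (x y a b X c : R) : 0 <= X -> `|x| <= X -> `|y| <= X -> `|a| <= c -> `|b| <= c ->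
  `|x * a + y * b| <= 2 * X * c.
Proof.
move=> X0 hx hy ha hb; rewrite (le_trans (ler_normD _ _))// !normrM.
by rewrite mulr_natl mulrnAl mulr2n lerD// ler_pM.
Qed.

Let bndf0 r phi : 0 < r -> r <= 1 -> 0 < phi < pi ->
  `|Af r phi| <= K' * r `^ p /\ `|Bf r phi| <= K' * r `^ p.
Proof.
move=> r0 r1 hp; have [a1 a2 _ _] := N_bound r0 hp; have [bA bB] := bndAB r0 hp.
rewrite /power_bound r1 in bA bB.
have X0 : 0 <= K * r `^ p by rewrite mulr_ge0 ?powR_ge0 ?K0.
have a3 : `|- (N2 r phi * (n r phi)^-1)| <= (s * sin th)^-1 by rewrite normrN.
have le : 2 * (K * r `^ p) * (s * sin th)^-1 <= K' * r `^ p.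
  rewrite (_ : 2 * (K * r `^ p) * (s * sin th)^-1 = 2 * K * (s * sin th)^-1 * r `^ p); last by ring.
  by rewrite ler_wpM2r ?powR_ge0// ler_wpM2l ?mulr_ge0 ?K0// lerDl invr_ge0 ltW.
split; apply: le_trans le.
  by rewrite /Af -mulrN; apply: bnd_lin; rewrite ?normrN.
exact: bnd_lin.
Qed.

Let bndf1 r phi : 1 <= r -> 0 < phi < pi ->
  `|Af r phi| <= K' * r `^ (- q) /\ `|Bf r phi| <= K' * r `^ (- q).
Proof.
move=> r1 hp; have r0 : 0 < r by exact: lt_le_trans r1.
have [_ _ a1 a2] := N_bound r0 hp; have [bA bB] := bndAB r0 hp.
have pb : power_bound K p q r = K * r `^ (1 - q).
  rewrite /power_bound; case: ifP => // r1'.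
  have -> : r = 1 by apply/eqP; rewrite eq_le r1 r1'.
  by rewrite !powR1.
rewrite pb in bA bB.
have X0 : 0 <= K * r `^ (1 - q) by rewrite mulr_ge0 ?powR_ge0 ?K0.
have a3 : `|- (N2 r phi * (n r phi)^-1)| <= (sin th * r)^-1 by rewrite normrN.
have le : 2 * (K * r `^ (1 - q)) * (sin th * r)^-1 <= K' * r `^ (- q).
  have -> : r `^ (1 - q) = r * r `^ (- q).
    by rewrite powRD ?powRr1 ?(ltW r0)// (gt_eqF r0) implybT.
  rewrite (_ : 2 * (K * (r * r `^ (- q))) * (sin th * r)^-1 = 2 * K * (sin th)^-1 * r `^ (- q)); last first.
    by field; rewrite !gt_eqF.
  rewrite ler_wpM2r ?powR_ge0// ler_wpM2l ?mulr_ge0 ?K0// lerDr invr_ge0 mulr_ge0//; exact: ltW.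
split; apply: le_trans le.
  by rewrite /Af -mulrN; apply: bnd_lin; rewrite ?normrN.
exact: bnd_lin.
Qed.

Let rotate phi : 0 < phi < pi ->
  \int[mu]_(r in oy) (Bf r phi / r) = \int[mu]_(r in oy) (Bf r th / r).
Proof.
move=> hp; case/andP: (hp) => p1 p2; case/andP: (th0) => t1 t2.
(* Holomorphy of A + i B is granted only strictly inside ]0, pi[, so a sector containing both angles
   has to keep a margin on each side. *)
pose lo := Num.min phi th / 2; pose hi := (Num.max phi th + pi) / 2.
have m0 : 0 < Num.min phi th by rewrite lt_min p1 t1.
have M0 : Num.max phi th < pi by rewrite gt_max p2 t2.
have lo0 : 0 < lo by rewrite divr_gt0.
have hipi : hi < pi by rewrite /hi; lra.
have lom : lo < Num.min phi th by rewrite /lo; lra.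
have him : Num.max phi th < hi by rewrite /hi; lra.
move: (lom) (him); rewrite lt_min gt_max => /andP[l1 l2] /andP[u1 u2].
have sub x : lo < x < hi -> 0 < x < pi.
  by move=> /andP[h1 h2]; rewrite (lt_trans lo0 h1) (lt_trans h2 hipi).
have [C1 [D1 h1]] := holAB lo0 hipi.
have [C2 [D2 h2]] := polar_kernel (ltW lo0) (ltW hipi).
have := polarM h1 h2.
set CC := fun r phi : R => _ - _ + (_ - _).
set DD := fun r phi : R => _ * _ + _ + (_ + _) => h.
apply: (@rotation_invariance R Af Bf CC lo hi phi th K' p q p0 q0).
- by move=> r x r0 hx; exact: (polar_dAr h).
- by move=> r x r0 hx; exact: (polar_dBphi h).
- by move=> r x r0 hx; exact: (is_derive_continuous (polar_dBr h r0 hx)).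
- by move=> r x r0 hx; exact: (polar_contC h).
- exact: (polar_bndC h).
- by move=> r x r0 r1 /sub; exact: bndf0.
- by move=> r x r1 /sub; exact: bndf1.
- by rewrite l1 u1.
- by rewrite l2 u2.
Qed.

(* Rotating the ray of integration of [f(z)/(z e^(-i th) + s) dz/z] from the angle [th] down to the positive axis, where [f] is real. *)
Lemma stieltjes_rotation (A0 : R -> R) :
  measurable_fun oy A0 ->
  (forall r, 0 < r -> r != 1 -> A r (angle R k) @[k --> \oo] --> A0 r) ->
  (forall r, 0 < r -> r != 1 -> B r (angle R k) @[k --> \oo] --> (0 : R)) ->
  \int[mu]_(r in oy) (B r th / (r * (r + s))) =
  \int[mu]_(r in oy) (A0 r * poisson s (pi - th) r).
Proof.
move=> mA0 cA cB.
have st := sth.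
transitivity (\int[mu]_(r in oy) (Bf r th / r)).
  apply: eq_Rintegral => r; rewrite inE/= in_itv/= andbT => r0.
  rewrite /Bf /n /N1 /N2 powRr1 ?(ltW r0)// mul1r subrr cos0 sin0 mulr1 mulr0 addr0 mul0r.
  have rs : r + s != 0 by rewrite gt_eqF// addr_gt0.
  by field; rewrite rs gt_eqF.
(* By rotation this sequence is constant. Its limit is computed a second time below, by dominated
   convergence as the ray approaches the positive axis. *)
have c1 : \int[mu]_(r in oy) (Bf r (angle R k) / r) @[k --> \oo] --> \int[mu]_(r in oy) (Bf r th / r).
  apply: cvg_near_cst; apply: nearW => k; exact: rotate (angle_bounds R k).
pose tl (r : R) := K' * (if r <= 1 then r `^ (p - 1) else r `^ (- q - 1)).
have bk k r : oy r -> `|Bf r (angle R k) / r| <= tl r.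
  rewrite /= in_itv/= andbT => r0; rewrite normrM normfV (gtr0_norm r0) /tl.
  have e (x : R) : r `^ (x - 1) = r `^ x / r.
    by rewrite powRB ?(gt_eqF r0) ?implybT// powRr1// ltW.
  case: ifP => r1; rewrite e mulrA ler_wpM2r ?invr_ge0 ?(ltW r0)//.
    by have [] := bndf0 r0 r1 (angle_bounds R k).
  have r1' : 1 <= r by rewrite ltW// ltNge r1.
  by have [] := bndf1 r1' (angle_bounds R k).
pose lim r := A0 r * - ((r * sin (- th)) * (r ^+ 2 + 2 * r * s * cos th + s ^+ 2)^-1) / r.
have cl r : 0 < r -> r != 1 -> Bf r (angle R k) / r @[k --> \oo] --> lim r.
  move=> r0 r1.
  have ca : (1 * angle R k + - th) @[k --> \oo] --> - th.
    rewrite -[X in _ --> X]add0r -[X in _ --> X + _](mulr0 1); apply: cvgD; last exact: cvg_cst.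
    by apply: cvgM; [exact: cvg_cst|exact: cvg_angle].
  have cN1 : N1 r (angle R k) @[k --> \oo] --> r * cos th + s.
    apply: cvgD; last exact: cvg_cst; apply: cvgM.
      by rewrite powRr1 ?(ltW r0)//; exact: cvg_cst.
    by rewrite -cosN; apply: (cvg_comp _ cos ca); exact: continuous_cos.
  have cN2 : N2 r (angle R k) @[k --> \oo] --> r * sin (- th).
    rewrite -[X in _ --> X]addr0; apply: cvgD; last exact: cvg_cst; apply: cvgM.
      by rewrite powRr1 ?(ltW r0)//; exact: cvg_cst.
    by apply: (cvg_comp _ sin ca); exact: continuous_sin.
  have den : (r * cos th + s) ^+ 2 + (r * sin (- th)) ^+ 2 = r ^+ 2 + 2 * r * s * cos th + s ^+ 2.
    by rewrite [(r * sin _) ^+ 2]exprMn sinN sqrrN (sin2cos2 th); ring.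
  have den0 : r ^+ 2 + 2 * r * s * cos th + s ^+ 2 != 0.
    rewrite gt_eqF// -den ltr_wpDl ?sqr_ge0// -[(_ * _) ^+ 2]real_normK ?num_real// exprn_gt0//.
    by rewrite normr_gt0 mulf_neq0 ?(gt_eqF r0)// sinN oppr_eq0 (gt_eqF st).
  have cn : (n r (angle R k))^-1 @[k --> \oo] --> (r ^+ 2 + 2 * r * s * cos th + s ^+ 2)^-1.
    apply: cvgV => //; rewrite -den !expr2.
    by apply: cvgD; exact: cvgM.
  apply: cvgM; last exact: cvg_cst.
  rewrite -[X in _ --> X]addr0 -[X in _ --> _ + X](mul0r ((r * cos th + s) * (r ^+ 2 + 2 * r * s * cos th + s ^+ 2)^-1)).
  apply: cvgD; first by apply: cvgM; [exact: cA|apply: cvgN; exact: cvgM].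
  by apply: cvgM; [exact: cB|exact: cvgM].
have mlim : measurable_fun oy lim by rewrite /lim; mfun.
have mBf k : measurable_fun oy (fun r => Bf r (angle R k) / r).
  have ak := angle_bounds R k; have /andP[a1 a2] := ak.
  have lo0 : 0 < angle R k / 2 by rewrite divr_gt0.
  have hipi : (angle R k + pi) / 2 < pi by lra.
  have [C1 [D1 h1]] := holAB lo0 hipi.
  have [C2 [D2 h2]] := polar_kernel (ltW lo0) (ltW hipi).
  have h := polarM h1 h2.
  have hk : angle R k / 2 < angle R k < (angle R k + pi) / 2 by apply/andP; split; lra.
  apply: open_continuous_measurable_fun; first exact: open_oy.
  move=> r; rewrite inE/= in_itv/= andbT => r0.
  apply: cvgM; first exact: (is_derive_continuous (polar_dBr h r0 hk)).
  by apply: inv_continuous; rewrite gt_eqF.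
(* Convergence on the positive axis is granted off r = 1, a null set; for (z - 1) / (z^a - 1),
   numerator and denominator both vanish there. *)
have ae : {ae mu, forall r, oy r -> Bf r (angle R k) / r @[k --> \oo] --> lim r}.
  exists [set 1]; split; [exact: measurable_set1|exact: lebesgue_measure_set1|].
  move=> r /= h; apply: contrapT => r1; apply: h; rewrite /= in_itv/= andbT => r0.
  by apply: cl => //; apply/eqP.
have [_ c2] := @dominated_Rcvg _ _ R mu oy moy (fun k r => Bf r (angle R k) / r) lim tl mBf mlim
  ae (integrable_tail K' p0 q0) bk.
transitivity (\int[mu]_(r in oy) lim r).
  by rewrite -(cvg_lim (@Rhausdorff R) c1) -(cvg_lim (@Rhausdorff R) c2).
apply: eq_Rintegral => r; rewrite inE/= in_itv/= andbT => r0.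
rewrite /lim /poisson sinB cosB sinpi cospi sinN.
have -> : r ^+ 2 - 2 * r * s * (-1 * cos th + 0 * sin th) + s ^+ 2 = r ^+ 2 + 2 * r * s * cos th + s ^+ 2 by ring.
have den0 : r ^+ 2 + 2 * r * s * cos th + s ^+ 2 != 0.
  have := @n_gt0 r th r0 th0; rewrite /n /N1 /N2.
  have h := @poisson_den_gt0 R s (pi - th) r s0.
  have : 0 < r ^+ 2 - 2 * r * s * cos (pi - th) + s ^+ 2.
    by apply: h; case/andP: th0 => t1 t2; apply/andP; split; lra.
  by rewrite cosB cospi sinpi => h' _; rewrite gt_eqF//; move: h'; congr (0 < _); ring.
by field; rewrite den0 gt_eqF.
Qed.

End kernel.

(** The angle of [stieltjes_rotation] is pushed to pi. On one side the ray tends to the negative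
    axis, where the boundary value of [B] appears; on the other the Poisson kernel has its angle
    tending to 0 and picks out [A0 s] with mass pi / s. *)
Lemma stieltjes_representation (A B : R -> R -> R) (A0 Bpi : R -> R) (K p q s : R) :
  0 < s -> 0 < p -> 0 < q ->
  (forall lo hi, 0 < lo -> hi < pi -> exists C D, polar_holomorphic lo hi A B C D) ->
  (forall r phi, 0 < r -> 0 < phi < pi ->
    `|A r phi| <= power_bound K p q r /\ `|B r phi| <= power_bound K p q r) ->
  measurable_fun oy A0 ->
  (forall r, 0 < r -> `|A0 r| <= power_bound K p q r) ->
  (forall r, 0 < r -> r != 1 -> A r (angle R k) @[k --> \oo] --> A0 r) ->
  (forall r, 0 < r -> r != 1 -> B r (angle R k) @[k --> \oo] --> (0 : R)) ->
  (forall r, 0 < r -> B r (pi - angle R k) @[k --> \oo] --> Bpi r) ->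
  measurable_fun oy Bpi ->
  {for s, continuous A0} ->
  mu.-integrable oy (EFin \o (fun r => Bpi r / (r * (r + s)))) /\
  \int[mu]_(r in oy) (Bpi r / (r * (r + s))) = pi * A0 s / s.
Proof.
move=> s0 p0 q0 hol bnd mA0 bA0 cA cB cpi mBpi cA0.
have K0 : 0 <= K.
  by have := bA0 1 ltr01; rewrite /power_bound lexx powR1 mulr1; apply: le_trans.
have ang k : 0 < pi - angle R k < pi.
  by have /andP[k0 k1] := angle_bounds R k; rewrite subr_gt0 k1 gtrBl.
have c1 : \int[mu]_(r in oy) (B r (pi - angle R k) / (r * (r + s))) @[k --> \oo] --> pi * A0 s / s.
  rewrite (_ : (fun k => _) = (fun k => \int[mu]_(r in oy) (A0 r * poisson s (angle R k) r))).
    exact: cvg_poisson mA0 bA0 cA0.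
  apply/funext => k; rewrite (stieltjes_rotation s0 (ang k) p0 q0 hol bnd mA0 cA cB).
  by apply: eq_Rintegral => r _; rewrite opprB addrC subrK.
(* s^(-1) + 1 bounds 1 / (r + s) when r <= 1 and r / (r + s) when r > 1. *)
pose tl (r : R) := K * (s^-1 + 1) * (if r <= 1 then r `^ (p - 1) else r `^ (- q - 1)).
have mB k : measurable_fun oy (fun r => B r (pi - angle R k) / (r * (r + s))).
  have ak := ang k; set t := pi - angle R k in ak *; have /andP[a1 a2] := ak.
  have lo0 : 0 < t / 2 by rewrite divr_gt0.
  have hipi : (t + pi) / 2 < pi by lra.
  have [C1 [D1 h]] := hol _ _ lo0 hipi.
  have hk : t / 2 < t < (t + pi) / 2 by apply/andP; split; lra.
  apply: measurable_funM; last by mfun.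
  apply: open_continuous_measurable_fun; first exact: open_oy.
  move=> r; rewrite inE/= in_itv/= andbT => r0.
  exact: (is_derive_continuous (polar_dBr h r0 hk)).
have bk k r : oy r -> `|B r (pi - angle R k) / (r * (r + s))| <= tl r.
  rewrite /= in_itv/= andbT => r0; have rs : 0 < r + s by rewrite addr_gt0.
  have [_ hb] := bnd r _ r0 (ang k).
  rewrite normrM normfV (gtr0_norm (mulr_gt0 r0 rs)).
  rewrite ler_pdivrMr ?mulr_gt0//; apply: (le_trans hb).
  have e (x : R) : r `^ (x - 1) = r `^ x / r.
    by rewrite powRB ?(gt_eqF r0) ?implybT// powRr1// ltW.
  rewrite /power_bound /tl; case: ifP => r1.
    rewrite e.
    rewrite (_ : _ * (r * (r + s)) = K * r `^ p * ((s^-1 + 1) * (r + s))); last by field; rewrite !gt_eqF.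
    rewrite ler_peMr ?mulr_ge0 ?powR_ge0//.
    have -> : (s^-1 + 1) * (r + s) = 1 + (r / s + r + s) by field; rewrite gt_eqF.
    by rewrite lerDl !addr_ge0 ?divr_ge0// ltW.
  rewrite !e.
  have -> : r `^ (1 - q) = r * r `^ (- q).
    by rewrite powRD ?powRr1 ?(ltW r0)// (gt_eqF r0) implybT.
  rewrite (_ : _ * (r * (r + s)) = K * (r * r `^ (- q)) * ((s^-1 + 1) * (r + s) / r)); last by field; rewrite !gt_eqF.
  rewrite ler_peMr ?mulr_ge0 ?powR_ge0 ?(ltW r0)//.
  have -> : (s^-1 + 1) * (r + s) / r = 1 + (s^-1 + r^-1 + s / r) by field; rewrite !gt_eqF.
  by rewrite lerDl !addr_ge0 ?divr_ge0 ?invr_ge0// ltW.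
have mlim : measurable_fun oy (fun r => Bpi r / (r * (r + s))).
  by apply: measurable_funM => //; mfun.
have ae : {ae mu, forall r, oy r -> B r (pi - angle R k) / (r * (r + s)) @[k --> \oo] --> Bpi r / (r * (r + s))}.
  apply: (@aeW _ (measurableTypeR R) R mu) => r; rewrite /= in_itv/= andbT => r0.
  by apply: cvgM; [exact: cpi|exact: cvg_cst].
have [c2i c2] := @dominated_Rcvg _ _ R mu oy moy (fun k r => B r (pi - angle R k) / (r * (r + s))) _ tl mB mlim
  ae (integrable_tail _ p0 q0) bk.
split => //.
by rewrite -(cvg_lim (@Rhausdorff R) c1) -(cvg_lim (@Rhausdorff R) c2).
Qed.

End stieltjes.

(** * The inversion for z^a, z^a / (z^a + 1) and (z - 1) / (z^a - 1) - 1 *)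

Section stieltjes_instances.
Variable R : realType.
Local Notation mu := (@lebesgue_measure R).
Local Notation oy := (`]0%R, +oo[%classic : set R).
Local Notation moy := (@measurable_oy R).

Let pow_A (a r phi : R) := r `^ a * cos (a * phi + 0).
Let pow_B (a r phi : R) := r `^ a * sin (a * phi + 0).

Let polar_pow (a lo hi : R) : exists C D, polar_holomorphic lo hi (pow_A a) (pow_B a) C D.
Proof. by do 2 eexists; exact: (polar_powR lo hi a 0). Qed.

Let cvg_angle0 (a : R) : a * angle R k + 0 @[k --> \oo] --> (0 : R).
Proof.
rewrite -[X in _ --> X]addr0; apply: cvgD; last exact: cvg_cst.
by rewrite -[X in _ --> X](mulr0 a); apply: cvgM; [exact: cvg_cst|exact: cvg_angle].
Qed.

Let cvg_anglepi (a : R) : a * (pi - angle R k) + 0 @[k --> \oo] --> a * pi.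
Proof.
rewrite -[X in _ --> X]addr0; apply: cvgD; last exact: cvg_cst.
apply: cvgM; first exact: cvg_cst.
by rewrite -[X in _ --> X]subr0; apply: cvgB; [exact: cvg_cst|exact: cvg_angle].
Qed.

Let cvg_pow_A0 (a r : R) : pow_A a r (angle R k) @[k --> \oo] --> r `^ a.
Proof.
rewrite -[X in _ --> X]mulr1 -cos0; apply: cvgM; first exact: cvg_cst.
by apply: (cvg_comp _ cos (cvg_angle0 a)); exact: continuous_cos.
Qed.

Let cvg_pow_B0 (a r : R) : pow_B a r (angle R k) @[k --> \oo] --> (0 : R).
Proof.
rewrite -[X in _ --> X](mulr0 (r `^ a)) -[X in _ * X]sin0; apply: cvgM; first exact: cvg_cst.
by apply: (cvg_comp _ sin (cvg_angle0 a)); exact: continuous_sin.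
Qed.

Let cvg_pow_Api (a r : R) : pow_A a r (pi - angle R k) @[k --> \oo] --> r `^ a * cos (a * pi).
Proof.
apply: cvgM; first exact: cvg_cst.
by apply: (cvg_comp _ cos (@cvg_anglepi a)); exact: continuous_cos.
Qed.

Let cvg_pow_Bpi (a r : R) : pow_B a r (pi - angle R k) @[k --> \oo] --> r `^ a * sin (a * pi).
Proof.
apply: cvgM; first exact: cvg_cst.
by apply: (cvg_comp _ sin (@cvg_anglepi a)); exact: continuous_sin.
Qed.

Section power.
Variable a : R.
Hypothesis a01 : 0 < a < 1.

Let bnd (r phi : R) : 0 < r -> 0 < phi < pi ->
  `|pow_A a r phi| <= power_bound 1 a (1 - a) r /\ `|pow_B a r phi| <= power_bound 1 a (1 - a) r.
Proof.
move=> r0 hp; rewrite /power_bound opprB addrC subrK if_same mul1r.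
by split; rewrite normrM ger0_norm ?powR_ge0// ler_piMr ?powR_ge0// ?cos_max ?sin_max.
Qed.

Let bnd0 (r : R) : 0 < r -> `|r `^ a| <= power_bound 1 a (1 - a) r.
Proof.
by move=> r0; rewrite /power_bound opprB addrC subrK if_same mul1r ger0_norm ?powR_ge0.
Qed.

Lemma sinpiM_gt0 : 0 < sin (a * pi).
Proof.
case/andP: a01 => a0 a1; apply: sin_gt0_pi; rewrite mulr_gt0 ?pi_gt0//=.
by rewrite -[ltRHS]mul1r ltr_pM2r// pi_gt0.
Qed.

(** The inversion for f(z) = z^a, whose imaginary part on the negative axis is r^a sin (a pi). *)
Lemma integral_powR_addV (s : R) : 0 < s ->
  mu.-integrable oy (EFin \o (fun r => r `^ (a - 1) / (r + s))) /\
  \int[mu]_(r in oy) (r `^ (a - 1) / (r + s)) = pi * s `^ (a - 1) / sin (a * pi).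
Proof.
move=> s0; case/andP: a01 => a0 a1; have sp := sinpiM_gt0.
have ma : measurable_fun oy (fun r : R => r `^ a) by mfun.
have [] := @stieltjes_representation R (pow_A a) (pow_B a) (fun r => r `^ a)
  (fun r => r `^ a * sin (a * pi)) 1 a (1 - a) s s0 a0 _ _ bnd ma bnd0 _ _ _ _ _.
- by rewrite subr_gt0.
- by move=> lo hi _ _; exact: polar_pow.
- by move=> r _ _; exact: cvg_pow_A0.
- by move=> r _ _; exact: cvg_pow_B0.
- by move=> r _; exact: cvg_pow_Bpi.
- by mfun.
- exact: continuous_powR.
have e r : oy r -> r `^ a * sin (a * pi) / (r * (r + s)) = sin (a * pi) * (r `^ (a - 1) / (r + s)).
  rewrite /= in_itv/= andbT => r0.
  rewrite powRB ?(gt_eqF r0) ?implybT// powRr1 ?(ltW r0)//.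
  by field; rewrite !gt_eqF// addr_gt0.
move=> i1 i2.
have i3 : mu.-integrable oy (EFin \o (fun r => r `^ (a - 1) / (r + s))).
  have := integrableZ moy (sin (a * pi))^-1 i1.
  apply: eq_integrable; first exact: moy.
  move=> r; rewrite inE => /e /= ->.
  by rewrite mulrA mulVf ?mul1r// gt_eqF.
split => //.
have i4 : sin (a * pi) * (\int[mu]_(r in oy) (r `^ (a - 1) / (r + s))) = pi * s `^ a / s.
  rewrite -(RintegralZl _ moy i3) -i2.
  by apply: eq_Rintegral => r; rewrite inE => /e ->.
apply: (mulfI (lt0r_neq0 sp)); rewrite i4.
rewrite powRB ?(gt_eqF s0) ?implybT// powRr1 ?(ltW s0)//.
have E (P x y z : R) : y != 0 -> z != 0 -> P * x / y = z * (P * (x / y) / z).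
  by move=> y0 z0; field; rewrite y0 z0.
by apply: E; rewrite gt_eqF.
Qed.

(** Here the rotation starts from the angle [th] itself, with s = 1 and f(z) = z^a: the ray at [th]
    gives sin (a th) times the integral just computed, the positive axis gives the trinomial. *)
Lemma integral_powR_trinomial (th : R) : 0 < th < pi ->
  \int[mu]_(r in oy) (r `^ a * (sin th / (r ^+ 2 + 2 * r * cos th + 1))) =
  pi * sin (a * th) / sin (a * pi).
Proof.
move=> th0; case/andP: a01 => a0 a1.
have ma : measurable_fun oy (fun r : R => r `^ a) by mfun.
have a10 : 0 < 1 - a by rewrite subr_gt0.
have h := @stieltjes_rotation R 1 th ltr01 th0 (pow_A a) (pow_B a) 1 a (1 - a) a0 a10
  (fun lo hi _ _ => polar_pow a lo hi) bnd (fun r => r `^ a) ma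
  (fun r _ _ => @cvg_pow_A0 a r) (fun r _ _ => @cvg_pow_B0 a r).
transitivity (\int[mu]_(r in oy) (r `^ a * poisson 1 (pi - th) r)).
  apply: eq_Rintegral => r _; rewrite /poisson sinB cosB sinpi cospi.
  by congr (_ * (_ / _)); ring.
rewrite -h.
have [i1 i2] := integral_powR_addV ltr01.
transitivity (\int[mu]_(r in oy) (sin (a * th) * (r `^ (a - 1) / (r + 1)))).
  apply: eq_Rintegral => r; rewrite inE/= in_itv/= andbT => r0; rewrite /pow_B addr0.
  rewrite powRB ?(gt_eqF r0) ?implybT// powRr1 ?(ltW r0)//.
  by field; rewrite !gt_eqF// addr_gt0.
rewrite (RintegralZl _ moy i1) i2 powR1 mulr1; ring.
Qed.

End power.

Lemma norm_le_sq (x y b : R) : 0 <= b -> x ^+ 2 + y ^+ 2 <= b ^+ 2 -> `|x| <= b /\ `|y| <= b.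
Proof.
move=> b0 h; split.
  rewrite -(@ler_pXn2r _ 2) ?nnegrE// real_normK ?num_real//.
  by apply: le_trans h; rewrite lerDl sqr_ge0.
rewrite -(@ler_pXn2r _ 2) ?nnegrE// real_normK ?num_real//.
by apply: le_trans h; rewrite lerDr sqr_ge0.
Qed.

Let ler_cos_pi (x y : R) : 0 <= y -> y <= x -> x <= pi -> cos x <= cos y.
Proof.
move=> y0 yx xpi; rewrite leNgt; apply/negP.
rewrite ltr_cos ?in_itv/= ?y0 ?(le_trans yx xpi) ?(le_trans y0 yx)// ltNge yx.
by [].
Qed.

Section ml_plus.
Variable a : R.
Hypothesis a01 : 0 < a < 1.
Let a0 : 0 < a. Proof. by case/andP: a01. Qed.
Let sp : 0 < sin (a * pi). Proof. exact: sinpiM_gt0. Qed.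

Let M1 (r phi : R) := pow_A a r phi + 1.
Let M2 (r phi : R) := pow_B a r phi + 0.
Let m r phi := M1 r phi ^+ 2 + M2 r phi ^+ 2.

Let mE r phi : m r phi = (r `^ a) ^+ 2 + 2 * r `^ a * cos (a * phi) + 1.
Proof.
rewrite /m /M1 /M2 /pow_A /pow_B !addr0.
by rewrite [(_ * sin _) ^+ 2]exprMn sin2cos2; ring.
Qed.

(** The argument of z^a stays below a pi < pi, which keeps z^a away from -1: the minimum of x^2 + 2
    x cos (a pi) + 1 over x is sin (a pi)^2. *)
Let m_lower r phi : 0 < phi < pi -> sin (a * pi) ^+ 2 <= m r phi.
Proof.
move=> /andP[p0 ppi]; rewrite mE sin2cos2.
have ra := powR_ge0 r a.
have : cos (a * pi) <= cos (a * phi).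
  apply: ler_cos_pi; first by rewrite mulr_ge0 ?ltW.
    by rewrite ler_wpM2l ?ltW.
  by rewrite -[leRHS]mul1r ler_wpM2r ?pi_ge0// ltW//; case/andP: a01.
move=> /(ler_wpM2l ra) h; have := sqr_ge0 (r `^ a + cos (a * pi)); nra.
Qed.

Let m_gt0 r phi : 0 < phi < pi -> 0 < m r phi.
Proof. by move=> hp; apply: lt_le_trans (m_lower r hp); rewrite exprn_gt0. Qed.

Let A (r phi : R) := pow_A a r phi * (M1 r phi * (m r phi)^-1) - pow_B a r phi * - (M2 r phi * (m r phi)^-1).
Let B (r phi : R) := pow_A a r phi * - (M2 r phi * (m r phi)^-1) + pow_B a r phi * (M1 r phi * (m r phi)^-1).

Let hol lo hi : 0 < lo -> hi < pi -> exists C D, polar_holomorphic lo hi A B C D.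
Proof.
move=> lo0 hipi.
have sub phi : lo < phi < hi -> 0 < phi < pi.
  by move=> /andP[h1 h2]; rewrite (lt_trans lo0 h1) (lt_trans h2 hipi).
have [C1 [D1 h1]] := polar_pow a lo hi.
have h2 := polarD h1 (polar_cst lo hi 1).
do 2 eexists; apply: (polarM h1); apply: (polarV h2).
- by move=> r phi r0 /sub; exact: m_gt0.
- move=> r1 r2 r10; exists (sin (a * pi) ^- 2) => r phi _ /sub hp.
  rewrite ger0_norm ?invr_ge0 ?(ltW (m_gt0 r hp))//.
  by rewrite lef_pV2 ?posrE ?m_gt0 ?exprn_gt0// m_lower.
Qed.

Let ABE r phi : 0 < phi < pi -> A r phi ^+ 2 + B r phi ^+ 2 = (r `^ a) ^+ 2 / m r phi.
Proof.
move=> hp; have m0 := lt0r_neq0 (m_gt0 r hp).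
have e : A r phi ^+ 2 + B r phi ^+ 2 = (pow_A a r phi ^+ 2 + pow_B a r phi ^+ 2) * (M1 r phi ^+ 2 + M2 r phi ^+ 2) * (m r phi)^-1 ^+ 2.
  by rewrite /A /B; ring.
rewrite e -/(m r phi) (_ : pow_A a r phi ^+ 2 + _ = (r `^ a) ^+ 2); last first.
  by rewrite /pow_A /pow_B [(_ * sin _) ^+ 2]exprMn sin2cos2; ring.
by field.
Qed.

Let bnd r phi : 0 < r -> 0 < phi < pi ->
  `|A r phi| <= power_bound (sin (a * pi))^-1 a (1 - a) r /\
  `|B r phi| <= power_bound (sin (a * pi))^-1 a (1 - a) r.
Proof.
move=> r0 hp; rewrite /power_bound opprB addrC subrK if_same.
apply: norm_le_sq; first by rewrite mulr_ge0 ?invr_ge0 ?powR_ge0// ltW.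
rewrite ABE// exprMn mulrC ler_wpM2r ?sqr_ge0// exprVn lef_pV2 ?posrE ?m_gt0 ?exprn_gt0//.
exact: m_lower.
Qed.

Let A0 (r : R) := r `^ a / (r `^ a + 1).

Let ra1 (r : R) : 0 < r `^ a + 1. Proof. by rewrite ltr_wpDl ?powR_ge0. Qed.

Let bnd0 r : 0 < r -> `|A0 r| <= power_bound (sin (a * pi))^-1 a (1 - a) r.
Proof.
move=> r0; rewrite /power_bound opprB addrC subrK if_same /A0.
rewrite ger0_norm ?divr_ge0 ?powR_ge0 ?(ltW (ra1 r))// mulrC ler_wpM2r ?powR_ge0//.
rewrite lef_pV2 ?posrE//; rewrite (le_trans (sin_le1 _))// lerDr; exact: powR_ge0.
Qed.

Let cvg_m0 r : m r (angle R k) @[k --> \oo] --> (r `^ a + 1) ^+ 2.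
Proof.
rewrite -[X in _ --> X]addr0 -[X in _ --> _ + X](expr0n R 2) !expr2.
have h1 : M1 r (angle R k) @[k --> \oo] --> r `^ a + 1.
  by apply: cvgD; [exact: cvg_pow_A0|exact: cvg_cst].
have h2 : M2 r (angle R k) @[k --> \oo] --> (0 : R).
  by rewrite -[X in _ --> X]addr0; apply: cvgD; [exact: cvg_pow_B0|exact: cvg_cst].
by apply: cvgD; exact: cvgM.
Qed.

(** The inversion for f(z) = z^a / (z^a + 1), chosen because f(s) / s is the Laplace transform of
    E_(a,1) (- t^a). *)
Lemma ml_plus_stieltjes (s : R) : 0 < s ->
  mu.-integrable oy (EFin \o (fun r => r `^ a * sin (a * pi) / ((r `^ a) ^+ 2 + 2 * r `^ a * cos (a * pi) + 1) / (r * (r + s)))) /\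
  \int[mu]_(r in oy) (r `^ a * sin (a * pi) / ((r `^ a) ^+ 2 + 2 * r `^ a * cos (a * pi) + 1) / (r * (r + s))) =
  pi * (s `^ a / (s `^ a + 1)) / s.
Proof.
move=> s0.
have a10 : 0 < 1 - a by rewrite subr_gt0; case/andP: a01.
have cM1 r : M1 r (angle R k) @[k --> \oo] --> r `^ a + 1.
  by apply: cvgD; [exact: cvg_pow_A0|exact: cvg_cst].
have cM2 r : M2 r (angle R k) @[k --> \oo] --> (0 : R).
  by rewrite -[X in _ --> X]addr0; apply: cvgD; [exact: cvg_pow_B0|exact: cvg_cst].
have cmV r : (m r (angle R k))^-1 @[k --> \oo] --> (r `^ a + 1) ^- 2.
  by apply: cvgV; [rewrite expf_neq0// gt_eqF|exact: cvg_m0].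
apply: (@stieltjes_representation R A B A0 _ _ a (1 - a) s s0 a0 a10 hol bnd _ bnd0).
- by rewrite /A0; mfun.
- move=> r r0 _.
  rewrite (_ : A0 r = r `^ a * ((r `^ a + 1) * (r `^ a + 1) ^- 2) - 0 * - (0 * (r `^ a + 1) ^- 2)); last first.
    by rewrite /A0; field; rewrite gt_eqF.
  apply: cvgB; first by apply: cvgM; [exact: cvg_pow_A0|exact: cvgM].
  by apply: cvgM; [exact: cvg_pow_B0|apply: cvgN; exact: cvgM].
- move=> r r0 _.
  rewrite (_ : 0 = r `^ a * - (0 * (r `^ a + 1) ^- 2) + 0 * ((r `^ a + 1) * (r `^ a + 1) ^- 2)); last by ring.
  apply: cvgD; first by apply: cvgM; [exact: cvg_pow_A0|apply: cvgN; exact: cvgM].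
  by apply: cvgM; [exact: cvg_pow_B0|exact: cvgM].
- move=> r r0.
  set P := r `^ a * cos (a * pi); set Q := r `^ a * sin (a * pi).
  have dE : (r `^ a) ^+ 2 + 2 * r `^ a * cos (a * pi) + 1 = (P + 1) * (P + 1) + Q * Q.
    rewrite /P /Q -[X in _ = _ + X]expr2 [(_ * sin _) ^+ 2]exprMn sin2cos2; ring.
  have d0 : (r `^ a) ^+ 2 + 2 * r `^ a * cos (a * pi) + 1 != 0.
    rewrite gt_eqF// dE -!expr2 ltr_wpDl ?sqr_ge0// exprn_gt0// mulr_gt0// powR_gt0//.
  have cN1 : M1 r (pi - angle R k) @[k --> \oo] --> P + 1.
    by apply: cvgD; [exact: cvg_pow_Api|exact: cvg_cst].
  have cN2 : M2 r (pi - angle R k) @[k --> \oo] --> Q.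
    by rewrite -[X in _ --> X]addr0; apply: cvgD; [exact: cvg_pow_Bpi|exact: cvg_cst].
  have cm : (m r (pi - angle R k))^-1 @[k --> \oo] --> ((r `^ a) ^+ 2 + 2 * r `^ a * cos (a * pi) + 1)^-1.
    by apply: cvgV => //; rewrite dE; apply: cvgD; exact: cvgM.
  rewrite -/Q.
  rewrite (_ : Q / _ = P * - (Q * ((r `^ a) ^+ 2 + 2 * r `^ a * cos (a * pi) + 1)^-1) + Q * ((P + 1) * ((r `^ a) ^+ 2 + 2 * r `^ a * cos (a * pi) + 1)^-1)); last by ring.
  apply: cvgD; first by apply: cvgM; [exact: cvg_pow_Api|apply: cvgN; exact: cvgM].
  by apply: cvgM; [exact: cvg_pow_Bpi|exact: cvgM].
- by mfun.
- apply: cvgM; first exact: continuous_powR.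
  apply: cvgV; first by rewrite gt_eqF.
  by apply: cvgD; [exact: continuous_powR|exact: cvg_cst].
Qed.

End ml_plus.

Section ml_minus.
Variable a : R.
Hypothesis a01 : 2^-1 <= a < 1.
Let a0 : 0 < a. Proof. by case/andP: a01 => h _; apply: lt_le_trans h. Qed.
Let a1 : 0 < 1 - a. Proof. by case/andP: a01; rewrite subr_gt0. Qed.
Let a01' : 0 < a < 1. Proof. by rewrite a0; case/andP: a01. Qed.
Let sp : 0 < sin (a * pi). Proof. exact: sinpiM_gt0. Qed.

Let M1 (r phi : R) := pow_A a r phi + -1.
Let M2 (r phi : R) := pow_B a r phi + 0.
Let m r phi := M1 r phi ^+ 2 + M2 r phi ^+ 2.
Let U1 (r phi : R) := pow_A 1 r phi + -1.
Let U2 (r phi : R) := pow_B 1 r phi + 0.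

Let mE r phi : m r phi = (r `^ a) ^+ 2 - 2 * r `^ a * cos (a * phi) + 1.
Proof.
rewrite /m /M1 /M2 /pow_A /pow_B !addr0.
by rewrite [(_ * sin _) ^+ 2]exprMn sin2cos2; ring.
Qed.

Let aphi (phi : R) : 0 < phi < pi -> 0 < a * phi < pi.
Proof.
move=> /andP[p0 ppi]; rewrite mulr_gt0//=; apply: lt_trans ppi.
by rewrite -[ltRHS]mul1r ltr_pM2r//; case/andP: a01.
Qed.

(** x^2 - 2 x c + 1 is at least (1 - c) (1 + c), and c = cos (a phi) lies between cos (a hi) and cos
    (a lo). The bound degenerates as [lo] tends to 0, because of the zero of z^a - 1 at 1. *)
Let m_lower lo hi r phi : 0 < lo -> hi < pi -> lo < phi < hi ->
  0 < (1 - cos (a * lo)) * (1 + cos (a * hi)) <= m r phi.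
Proof.
move=> lo0 hipi /andP[l u].
have hi0 : 0 < hi by rewrite (lt_trans lo0)// (lt_trans l u).
have lopi : lo < pi by rewrite (lt_trans (lt_trans l u)).
have /aphi/andP[al0 alpi] : 0 < lo < pi by rewrite lo0.
have /aphi/andP[ah0 ahpi] : 0 < hi < pi by rewrite hi0.
have c1 : cos (a * lo) < 1.
  by rewrite -[ltRHS]cos0 ltr_cos ?in_itv/= ?lexx ?pi_ge0 ?(ltW al0) ?(ltW alpi).
have c2 : - 1 < cos (a * hi).
  by rewrite -[ltLHS]cospi ltr_cos ?in_itv/= ?lexx ?pi_ge0 ?(ltW ah0) ?(ltW ahpi).
have c3 : cos (a * phi) <= cos (a * lo).
  by apply: ler_cos_pi; [exact: ltW|rewrite ler_wpM2l ?ltW|rewrite (le_trans _ (ltW ahpi))// ler_wpM2l ?ltW].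
have c4 : cos (a * hi) <= cos (a * phi).
  by apply: ler_cos_pi; [rewrite mulr_ge0// ltW// (lt_trans lo0)|rewrite ler_wpM2l ?ltW|exact: ltW].
rewrite mulr_gt0 ?subr_gt0 ?(addrC 1) -?ltrBlDr ?sub0r//=.
rewrite mE; have := sqr_ge0 (r `^ a - cos (a * phi)); have := cos_le1 (a * phi); nra.
Qed.

Let m_gt0 r phi : 0 < phi < pi -> 0 < m r phi.
Proof.
move=> /andP[p0 ppi].
have h1 : 0 < phi / 2 by rewrite divr_gt0.
have h2 : (phi + pi) / 2 < pi by lra.
have /andP[h3 h4] : 0 < (1 - cos (a * (phi / 2))) * (1 + cos (a * ((phi + pi) / 2))) <= m r phi.
  by apply: m_lower => //; apply/andP; split; lra.
exact: lt_le_trans h4.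
Qed.

(** Real part of f(z) = (z - 1) / (z^a - 1) - 1, with [B] for the imaginary part. The subtracted 1
    makes f vanish at 0, as integrability against 1 / (r (r + s)) requires. *)
Let A (r phi : R) := U1 r phi * (M1 r phi * (m r phi)^-1) - U2 r phi * - (M2 r phi * (m r phi)^-1) + -1.
Let B (r phi : R) := U1 r phi * - (M2 r phi * (m r phi)^-1) + U2 r phi * (M1 r phi * (m r phi)^-1) + 0.

Let hol lo hi : 0 < lo -> hi < pi -> exists C D, polar_holomorphic lo hi A B C D.
Proof.
move=> lo0 hipi.
have sub phi : lo < phi < hi -> 0 < phi < pi.
  by move=> /andP[h1 h2]; rewrite (lt_trans lo0 h1) (lt_trans h2 hipi).
have [C1 [D1 h1]] := polar_pow a lo hi.
have [C2 [D2 h2]] := polar_pow 1 lo hi.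
have h3 := polarD h1 (polar_cst lo hi (-1)).
have h4 := polarD h2 (polar_cst lo hi (-1)).
do 2 eexists; apply: polarD (polar_cst lo hi (-1)); apply: (polarM h4); apply: (polarV h3).
- by move=> r phi r0 /sub; exact: m_gt0.
- move=> r1 r2 r10; exists ((1 - cos (a * lo)) * (1 + cos (a * hi)))^-1 => r phi _ hp.
  have /andP[q0 qm] := m_lower r lo0 hipi hp.
  rewrite ger0_norm ?invr_ge0 ?(ltW (m_gt0 r (sub _ hp)))//.
  by rewrite lef_pV2 ?posrE// (lt_le_trans q0).
Qed.

Let rX r : 0 < r -> r = r `^ (1 - a) * r `^ a.
Proof. by move=> r0; rewrite -powRD ?subrK ?powRr1 ?ltW// (gt_eqF r0) implybT. Qed.

Let ABE r phi : 0 < r -> 0 < phi < pi -> A r phi ^+ 2 + B r phi ^+ 2 =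
  (r ^+ 2 - 2 * r * r `^ a * cos ((1 - a) * phi) + (r `^ a) ^+ 2) / m r phi.
Proof.
move=> r0 hp; have m0 := lt0r_neq0 (m_gt0 r hp).
have e : A r phi ^+ 2 + B r phi ^+ 2 = ((U1 r phi - M1 r phi) ^+ 2 + (U2 r phi - M2 r phi) ^+ 2) / m r phi.
  by rewrite /A /B; move: m0; rewrite /m => m0; field.
rewrite e; congr (_ / _).
rewrite /U1 /U2 /M1 /M2 /pow_A /pow_B powRr1 ?(ltW r0)// !addr0 mul1r.
have -> : (1 - a) * phi = phi - a * phi by ring.
rewrite cosB; have h1 := cos2Dsin2 phi; have h2 := cos2Dsin2 (a * phi).
transitivity (r ^+ 2 * (cos phi ^+ 2 + sin phi ^+ 2) - 2 * r * r `^ a * (cos phi * cos (a * phi) + sin phi * sin (a * phi))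
  + (r `^ a) ^+ 2 * (cos (a * phi) ^+ 2 + sin (a * phi) ^+ 2)); first by ring.
by rewrite h1 h2 !mulr1.
Qed.

(** Since f = (z - z^a) / (z^a - 1), with X = r^(1 - a) and Y = r^a the claim reads Y |X e^(i (1 -
    a) phi) - 1| <= X |Y e^(i a phi) - 1| for r <= 1, and the same without the outer factors for r >
    1. As 1 - a <= a, X and Y are ordered and cos (a phi) <= cos ((1 - a) phi). Comparing numerator
    and denominator directly keeps the bound uniform near z = 1, where both vanish. *)
Let bnd r phi : 0 < r -> 0 < phi < pi ->
  `|A r phi| <= power_bound 1 (1 - a) (1 - a) r /\
  `|B r phi| <= power_bound 1 (1 - a) (1 - a) r.
Proof.
move=> r0 hp; rewrite /power_bound !mul1r (_ : 1 - (1 - a) = a); last by ring.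
have m0 := m_gt0 r hp.
pose X := r `^ (1 - a); pose Y := r `^ a.
have X0 : 0 < X by rewrite powR_gt0.
have Y0 : 0 < Y by rewrite powR_gt0.
pose ca := cos ((1 - a) * phi); pose cb := cos (a * phi).
have cab : cb <= ca.
  have /andP[h1 h2] := aphi hp; apply: ler_cos_pi; last exact: ltW.
    by case/andP: hp => p0 _; rewrite mulr_ge0 ?ltW.
  by case/andP: hp => p0 _; rewrite ler_wpM2r ?(ltW p0)//; case/andP: a01 => h _; lra.
have ca1 : ca <= 1 by exact: cos_le1.
have cb1 : -1 <= cb by exact: cos_geN1.
have cb1' : cb <= 1 by exact: cos_le1.
have rXY : r = X * Y by exact: rX.
have a12 : 1 - a <= a by case/andP: a01 => h _; lra.
apply: norm_le_sq; first by case: ifP => _; rewrite powR_ge0.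
rewrite ABE// ler_pdivrMr// mE -/Y -/ca -/cb.
case: ifP => r1.
  have YX : Y <= X by rewrite /X /Y; apply: ger_powR; rewrite // r0.
  have X1 : X <= 1.
    by rewrite -[leRHS](powRr0 r); apply: ger_powR; rewrite ?r0 ?r1// ltW.
  rewrite -/X [in leLHS]rXY.
  have k1 : 0 <= (X - Y) * (X + Y - 2 * X * Y).
    rewrite mulr_ge0 ?subr_ge0//; nra.
  have XY : 0 <= X * Y by rewrite mulr_ge0 ?ltW.
  have k2 : - (X - Y) <= Y * ca - X * cb.
    have := ler_wpM2l (ltW Y0) cab; have XYs : 0 <= X - Y by rewrite subr_ge0.
    have := ler_wpM2l XYs cb1'; nra.
  have k3 := ler_wpM2l XY k2.
  have -> : X ^+ 2 * (Y ^+ 2 - 2 * Y * cb + 1) = (X * Y) ^+ 2 - 2 * (X * Y) * Y * ca + Y ^+ 2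
     + ((X - Y) * (X + Y - 2 * X * Y) + 2 * (X * Y * (Y * ca - X * cb) - X * Y * - (X - Y))) by ring.
  by rewrite lerDl addr_ge0// mulr_ge0// subr_ge0.
have r1' : 1 <= r by rewrite ltW// ltNge r1.
have XY : X <= Y by rewrite /X /Y; apply: ler_powR.
have X1 : 1 <= X by rewrite -[leLHS](powRr0 r); apply: ler_powR => //; exact: ltW.
rewrite -/Y [in leLHS]rXY.
have k1 : X ^+ 2 - 2 * X * ca + 1 <= Y ^+ 2 - 2 * Y * cb + 1.
  have := ler_wpM2l (ltW Y0) cab; have YXs : 0 <= Y - X by rewrite subr_ge0.
  have := ler_wpM2l YXs ca1; have : 0 <= (Y - X) * (X + Y - 2) by rewrite mulr_ge0//; lra.
  nra.
have -> : (X * Y) ^+ 2 - 2 * (X * Y) * Y * ca + Y ^+ 2 = Y ^+ 2 * (X ^+ 2 - 2 * X * ca + 1) by ring.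
by rewrite ler_wpM2l ?sqr_ge0.
Qed.

Let A0 (r : R) := (r - 1) / (r `^ a - 1) - 1.

Let ra_neq1 (r : R) : 0 < r -> r != 1 -> r `^ a - 1 != 0.
Proof.
move=> r0; apply: contraNN; rewrite subr_eq0 => /eqP h; apply/eqP.
have : r `^ (a / a) = 1 by rewrite powRrM h powR1.
by rewrite divff ?lt0r_neq0// powRr1// ltW.
Qed.

Let cA0 r : 0 < r -> r != 1 -> A r (angle R k) @[k --> \oo] --> A0 r.
Proof.
move=> r0 r1; have d0 := ra_neq1 r0 r1.
have cM1 : M1 r (angle R k) @[k --> \oo] --> r `^ a - 1.
  by apply: cvgD; [exact: cvg_pow_A0|exact: cvg_cst].
have cM2 : M2 r (angle R k) @[k --> \oo] --> (0 : R).
  by rewrite -[X in _ --> X]addr0; apply: cvgD; [exact: cvg_pow_B0|exact: cvg_cst].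
have cU1 : U1 r (angle R k) @[k --> \oo] --> r - 1.
  rewrite -[X in _ --> X - _](powRr1 (ltW r0)).
  by apply: cvgD; [exact: cvg_pow_A0|exact: cvg_cst].
have cU2 : U2 r (angle R k) @[k --> \oo] --> (0 : R).
  by rewrite -[X in _ --> X]addr0; apply: cvgD; [exact: cvg_pow_B0|exact: cvg_cst].
have cm : (m r (angle R k))^-1 @[k --> \oo] --> ((r `^ a - 1) * (r `^ a - 1) + 0 * 0)^-1.
  apply: cvgV; first by rewrite mulr0 addr0 mulf_neq0.
  by apply: cvgD; exact: cvgM.
set V := (_ + 0 * 0)^-1 in cm.
rewrite (_ : A0 r = (r - 1) * ((r `^ a - 1) * V) - 0 * - (0 * V) + -1); last first.
  by rewrite /A0 /V mul0r mul0r subr0 addr0; congr (_ - _); field.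
apply: cvgD; last exact: cvg_cst.
apply: cvgB; first by apply: cvgM => //; exact: cvgM.
by apply: cvgM => //; apply: cvgN; exact: cvgM.
Qed.

Let cB0 r : 0 < r -> r != 1 -> B r (angle R k) @[k --> \oo] --> (0 : R).
Proof.
move=> r0 r1; have d0 := ra_neq1 r0 r1.
have cM1 : M1 r (angle R k) @[k --> \oo] --> r `^ a - 1.
  by apply: cvgD; [exact: cvg_pow_A0|exact: cvg_cst].
have cM2 : M2 r (angle R k) @[k --> \oo] --> (0 : R).
  by rewrite -[X in _ --> X]addr0; apply: cvgD; [exact: cvg_pow_B0|exact: cvg_cst].
have cU1 : U1 r (angle R k) @[k --> \oo] --> r `^ 1 - 1.
  by apply: cvgD; [exact: cvg_pow_A0|exact: cvg_cst].
have cU2 : U2 r (angle R k) @[k --> \oo] --> (0 : R).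
  by rewrite -[X in _ --> X]addr0; apply: cvgD; [exact: cvg_pow_B0|exact: cvg_cst].
have cm : (m r (angle R k))^-1 @[k --> \oo] --> ((r `^ a - 1) * (r `^ a - 1) + 0 * 0)^-1.
  apply: cvgV; first by rewrite mulr0 addr0 mulf_neq0.
  by apply: cvgD; exact: cvgM.
set V := (_ + 0 * 0)^-1 in cm.
rewrite (_ : 0 = (r `^ 1 - 1) * - (0 * V) + 0 * ((r `^ a - 1) * V) + 0 :> R); last by ring.
apply: cvgD; last exact: cvg_cst.
apply: cvgD; first by apply: cvgM => //; apply: cvgN; exact: cvgM.
by apply: cvgM => //; exact: cvgM.
Qed.

Let bnd0 r : 0 < r -> `|A0 r| <= power_bound 1 (1 - a) (1 - a) r.
Proof.
move=> r0; have [->|r1] := eqVneq r 1.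
  (* At r = 1 the convention x / 0 = 0 gives [A0] the value -1, of modulus 1, instead of its limit 1
     / a - 1. *)
  by rewrite /A0 /power_bound lexx subrr mul0r sub0r normrN !normr1 powR1 mulr1.
apply: (ler_cvg_to (cvg_norm (cA0 r0 r1)) (cvg_cst _)).
by apply: nearW => k; have [] := bnd r0 (angle_bounds R k).
Qed.

(** On the negative axis z - 1 is - (r + 1), whence the factor r + 1. The condition 1 < s keeps away
    from the point 1, where [A0] is not continuous. *)
Lemma ml_minus_stieltjes (s : R) : 1 < s ->
  mu.-integrable oy (EFin \o (fun r => (r + 1) * (r `^ a * sin (a * pi)) / ((r `^ a) ^+ 2 - 2 * r `^ a * cos (a * pi) + 1) / (r * (r + s)))) /\
  \int[mu]_(r in oy) ((r + 1) * (r `^ a * sin (a * pi)) / ((r `^ a) ^+ 2 - 2 * r `^ a * cos (a * pi) + 1) / (r * (r + s))) =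
  pi * ((s - 1) / (s `^ a - 1) - 1) / s.
Proof.
move=> s1; have s0 : 0 < s by exact: lt_trans s1.
apply: (@stieltjes_representation R A B A0 _ 1 (1 - a) (1 - a) s s0 a1 a1 hol bnd _ bnd0 cA0 cB0).
- by rewrite /A0; mfun.
- move=> r r0.
  set P := r `^ a * cos (a * pi); set Q := r `^ a * sin (a * pi).
  have dE : (r `^ a) ^+ 2 - 2 * r `^ a * cos (a * pi) + 1 = (P + -1) * (P + -1) + Q * Q.
    rewrite /P /Q -[X in _ = _ + X]expr2 [(_ * sin _) ^+ 2]exprMn sin2cos2; ring.
  have d0 : (r `^ a) ^+ 2 - 2 * r `^ a * cos (a * pi) + 1 != 0.
    rewrite gt_eqF// dE -!expr2 ltr_wpDl ?sqr_ge0// exprn_gt0// mulr_gt0// powR_gt0//.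
  have cN1 : M1 r (pi - angle R k) @[k --> \oo] --> P + -1.
    by apply: cvgD; [exact: cvg_pow_Api|exact: cvg_cst].
  have cN2 : M2 r (pi - angle R k) @[k --> \oo] --> Q.
    by rewrite -[X in _ --> X]addr0; apply: cvgD; [exact: cvg_pow_Bpi|exact: cvg_cst].
  have cV1 : U1 r (pi - angle R k) @[k --> \oo] --> r `^ 1 * cos (1 * pi) + -1.
    by apply: cvgD; [exact: cvg_pow_Api|exact: cvg_cst].
  have cV2 : U2 r (pi - angle R k) @[k --> \oo] --> r `^ 1 * sin (1 * pi).
    by rewrite -[X in _ --> X]addr0; apply: cvgD; [exact: cvg_pow_Bpi|exact: cvg_cst].
  rewrite mul1r cospi powRr1 ?(ltW r0)// mulrN1 in cV1.
  rewrite mul1r sinpi mulr0 in cV2.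
  have cm : (m r (pi - angle R k))^-1 @[k --> \oo] --> ((r `^ a) ^+ 2 - 2 * r `^ a * cos (a * pi) + 1)^-1.
    by apply: cvgV => //; rewrite dE; apply: cvgD; exact: cvgM.
  set V := (_ + 1)^-1 in cm *.
  rewrite (_ : (r + 1) * Q * V = (- r + -1) * - (Q * V) + 0 * ((P + -1) * V) + 0); last by ring.
  apply: cvgD; last exact: cvg_cst.
  apply: cvgD; first by apply: cvgM => //; apply: cvgN; exact: cvgM.
  by apply: cvgM => //; exact: cvgM.
- by mfun.
- apply: cvgB; last exact: cvg_cst.
  apply: cvgM; first by apply: cvgB; [exact: cvg_id|exact: cvg_cst].
  apply: cvgV; first by apply: ra_neq1 => //; rewrite gt_eqF.
  by apply: cvgB; [exact: continuous_powR|exact: cvg_cst].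
Qed.

End ml_minus.

End stieltjes_instances.

(** * Integral representations of Mittag-Leffler functions *)

Section poisson_laplace.
Variable R : realType.
Local Notation mu := (@lebesgue_measure R).
Local Notation oy := (`]0%R, +oo[%classic : set R).
Local Notation moy := (@measurable_oy R).

(** The substitution r = u^(1 / a) in [ml_plus_stieltjes] turns the trinomial in r^a into a Poisson
    kernel, with angle pi - a pi because of the sign in front of the cosine. *)
Lemma integral_poisson_plus (a s : R) : 0 < a < 1 -> 0 < s ->
  (\int[mu]_(u in oy) (poisson 1 (pi - a * pi) u / (u `^ a^-1 + s))%:E)%E =
  (a * pi * (s `^ (a - 1) / (s `^ a + 1)))%:E.
Proof.
move=> a01 s0; have [i1 i2] := ml_plus_stieltjes a01 s0; case/andP: (a01) => a0 a1.
have sp := sinpiM_gt0 a01.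
have den r : 0 < r -> 0 < r ^+ 2 + 2 * r * cos (a * pi) + 1.
  move=> r0; have -> : r ^+ 2 + 2 * r * cos (a * pi) + 1 = (r + cos (a * pi)) ^+ 2 + sin (a * pi) ^+ 2.
    by rewrite sin2cos2; ring.
  by rewrite ltr_wpDl ?sqr_ge0// exprn_gt0.
pose G (r : R) := r `^ a * sin (a * pi) / ((r `^ a) ^+ 2 + 2 * r `^ a * cos (a * pi) + 1) / (r * (r + s)).
have G0 r : 0 < r -> 0 <= G r.
  move=> r0; apply: divr_ge0; last by rewrite mulr_ge0 ?addr_ge0 ?(ltW r0) ?(ltW s0).
  by rewrite divr_ge0 ?mulr_ge0 ?powR_ge0 ?(ltW sp)// ltW// den// powR_gt0.
have cG : {in oy, continuous G}.
  move=> r; rewrite inE/= in_itv/= andbT => r0.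
  have cp : {for r, continuous (fun r : R => r `^ a)} by exact: continuous_powR.
  apply: cvgM.
    apply: cvgM; first by apply: cvgM => //; exact: cvg_cst.
    apply: cvgV; first by rewrite gt_eqF// den// powR_gt0.
    apply: cvgD; last exact: cvg_cst; apply: cvgD.
      by apply: cvgM.
    by apply: cvgM; [apply: cvgM => //; exact: cvg_cst|exact: cvg_cst].
  apply: cvgV; first by rewrite gt_eqF// mulr_gt0// addr_gt0.
  by apply: cvgM; [exact: cvg_id|apply: cvgD; [exact: cvg_id|exact: cvg_cst]].
have ai0 : 0 < a^-1 by rewrite invr_gt0.
have h := ge0_subst_powR ai0 cG G0.
have e u : 0 < u -> G (u `^ a^-1) * (a^-1 * u `^ (a^-1 - 1)) = a^-1 * (poisson 1 (pi - a * pi) u / (u `^ a^-1 + s)).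
  move=> u0; rewrite /G -powRrM mulVf ?gt_eqF// powRr1 ?(ltW u0)//.
  rewrite powRB ?(gt_eqF u0) ?implybT// powRr1 ?(ltW u0)//.
  rewrite /poisson sinB cosB sinpi cospi.
  have := den u u0; have : 0 < u `^ a^-1 by rewrite powR_gt0.
  set x := u `^ _; set cc := cos _; set ss := sin _ => x0 d0.
  rewrite (_ : u ^+ 2 - 2 * u * 1 * (-1 * cc + 0 * ss) + 1 ^+ 2 = u ^+ 2 + 2 * u * cc + 1); last by ring.
  by field; rewrite !gt_eqF// addr_gt0.
have {}h : (\int[mu]_(u in oy) (poisson 1 (pi - a * pi) u / (u `^ a^-1 + s))%:E)%E = (a%:E * \int[mu]_(r in oy) (G r)%:E)%E.
  rewrite h -ge0_integralZl_fin//; first last.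
  - exact: ltW.
  - by move=> u; rewrite /= in_itv/= andbT => u0; rewrite mulr_ge0 ?G0 ?powR_gt0// mulr_ge0 ?powR_ge0// ltW.
  - by rewrite /G; mfun.
  apply: eq_integral => u; rewrite inE/= in_itv/= andbT => u0.
  by rewrite e// mulrA divff ?mul1r// gt_eqF.
rewrite h (EFin_Rintegral moy i1) i2 -EFinM; congr EFin.
rewrite powRB ?(gt_eqF s0) ?implybT// powRr1 ?(ltW s0)//; ring.
Qed.

(** After the same substitution, (r + 1) / (r + s) = 1 - (s - 1) / (r + s): the first part is the
    mass of the Poisson kernel. Solving for the second leaves, up to the factor a pi, the difference
    of the Laplace transforms of e^t / a and of E_(a,1) (t^a). *)
Lemma integral_poisson_minus (a s : R) : 2^-1 <= a < 1 -> 1 < s ->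
  (\int[mu]_(u in oy) (poisson 1 (a * pi) u / (u `^ a^-1 + s))%:E)%E =
  (a * pi * ((a * (s - 1))^-1 - s `^ (a - 1) / (s `^ a - 1)))%:E.
Proof.
move=> a01 s1; have [i1 i2] := ml_minus_stieltjes a01 s1; case/andP: (a01) => ah a1.
have a0 : 0 < a by apply: lt_le_trans ah.
have s0 : 0 < s by apply: lt_trans s1.
have sp : 0 < sin (a * pi) by apply: sinpiM_gt0; rewrite a0.
have api : 0 < a * pi < pi.
  by rewrite mulr_gt0 ?pi_gt0//= -[ltRHS]mul1r ltr_pM2r// pi_gt0.
have den r : 0 < r -> 0 < r ^+ 2 - 2 * r * cos (a * pi) + 1.
  move=> r0; have -> : r ^+ 2 - 2 * r * cos (a * pi) + 1 = (r - cos (a * pi)) ^+ 2 + sin (a * pi) ^+ 2.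
    by rewrite sin2cos2; ring.
  by rewrite ltr_wpDl ?sqr_ge0// exprn_gt0.
pose G (r : R) := (r + 1) * (r `^ a * sin (a * pi)) / ((r `^ a) ^+ 2 - 2 * r `^ a * cos (a * pi) + 1) / (r * (r + s)).
have G0 r : 0 < r -> 0 <= G r.
  move=> r0; apply: divr_ge0; last by rewrite mulr_ge0 ?addr_ge0 ?(ltW r0) ?(ltW s0).
  apply: divr_ge0; last by rewrite ltW// den// powR_gt0.
  by apply: mulr_ge0; [rewrite addr_ge0 ?(ltW r0)|rewrite mulr_ge0 ?powR_ge0 ?(ltW sp)].
have cG : {in oy, continuous G}.
  move=> r; rewrite inE/= in_itv/= andbT => r0.
  have cp : {for r, continuous (fun r : R => r `^ a)} by exact: continuous_powR.
  apply: cvgM.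
    apply: cvgM.
      apply: cvgM; first by apply: cvgD; [exact: cvg_id|exact: cvg_cst].
      by apply: cvgM => //; exact: cvg_cst.
    apply: cvgV; first by rewrite gt_eqF// den// powR_gt0.
    apply: cvgD; last exact: cvg_cst; apply: cvgB.
      by apply: cvgM.
    by apply: cvgM; [apply: cvgM => //; exact: cvg_cst|exact: cvg_cst].
  apply: cvgV; first by rewrite gt_eqF// mulr_gt0// addr_gt0.
  by apply: cvgM; [exact: cvg_id|apply: cvgD; [exact: cvg_id|exact: cvg_cst]].
have ai0 : 0 < a^-1 by rewrite invr_gt0.
have h := ge0_subst_powR ai0 cG G0.
have e u : 0 < u -> G (u `^ a^-1) * (a^-1 * u `^ (a^-1 - 1)) =
    a^-1 * (poisson 1 (a * pi) u - (s - 1) * (poisson 1 (a * pi) u / (u `^ a^-1 + s))).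
  move=> u0; rewrite /G -powRrM mulVf ?gt_eqF// powRr1 ?(ltW u0)//.
  rewrite powRB ?(gt_eqF u0) ?implybT// powRr1 ?(ltW u0)//.
  rewrite /poisson.
  have := den u u0; have : 0 < u `^ a^-1 by rewrite powR_gt0.
  set x := u `^ _; set cc := cos _; set ss := sin _ => x0 d0.
  rewrite (_ : u ^+ 2 - 2 * u * 1 * cc + 1 ^+ 2 = u ^+ 2 - 2 * u * cc + 1); last by ring.
  by field; rewrite !gt_eqF// addr_gt0.
have P0 u : oy u -> 0 <= poisson 1 (a * pi) u / (u `^ a^-1 + s).
  rewrite /= in_itv/= andbT => u0; rewrite divr_ge0 ?addr_ge0 ?powR_ge0 ?(ltW s0)//.
  exact: poisson_ge0.
have mP : measurable_fun oy (fun u => poisson 1 (a * pi) u / (u `^ a^-1 + s)).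
  by apply: measurable_funM; [exact: measurable_funTS (measurable_poisson _ _)|mfun].
have iP : mu.-integrable oy (EFin \o (fun u => poisson 1 (a * pi) u / (u `^ a^-1 + s))).
  apply: (@integrable_dom _ _ R mu oy moy _ (fun u => s^-1 * poisson 1 (a * pi) u) mP); last first.
    by apply: integrableZ; [exact: moy|exact: integrable_poisson].
  move=> u hu; rewrite ger0_norm ?P0//; move: hu; rewrite /= in_itv/= andbT => u0.
  rewrite mulrC ler_wpM2r ?poisson_ge0// lef_pV2 ?posrE ?ltr_wpDl ?powR_ge0//.
  by rewrite lerDr powR_ge0.
rewrite (EFin_Rintegral moy iP); congr EFin; set J := Rintegral _ _ _.
have E1 : \int[mu]_(r in oy) (G r) = a^-1 * ((pi - a * pi) - (s - 1) * J).
  have iQ : mu.-integrable oy (EFin \o (fun u => (s - 1) * (poisson 1 (a * pi) u / (u `^ a^-1 + s)))).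
    by apply: integrableZ; [exact: moy|exact: iP].
  have ip := integrable_poisson ltr01 api.
  have iPQ : mu.-integrable oy (EFin \o (fun u => poisson 1 (a * pi) u - (s - 1) * (poisson 1 (a * pi) u / (u `^ a^-1 + s)))).
    by apply: integrableBr.
  have E : Rintegral mu oy (poisson 1 (a * pi)) = pi - a * pi.
    by apply: EFin_inj; rewrite -(EFin_Rintegral moy ip) poisson_mass// divr1.
  rewrite -E -(RintegralZl _ moy iP) -(RintegralB moy ip iQ) -(RintegralZl _ moy iPQ).
  apply: EFin_inj; rewrite -(EFin_Rintegral moy i1) -EFin_Rintegral; first last.
  - by apply: integrableZ; [exact: moy|exact: iPQ].
  - exact: moy.
  rewrite h; apply: eq_integral => u; rewrite inE/= in_itv/= andbT => u0.
  by rewrite e.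
have sa1 : 1 < s `^ a.
  by have /(_ 1 s) := gt0_ltr_powR a0; rewrite powR1 => -> //; rewrite nnegrE ltW.
have : a^-1 * ((pi - a * pi) - (s - 1) * J) = pi * ((s - 1) / (s `^ a - 1) - 1) / s by rewrite -E1.
rewrite powRB ?(gt_eqF s0) ?implybT// powRr1 ?(ltW s0)//.
move: {E1} sa1; set S := s `^ a; move: J pi (pi_gt0 R) => J p p0 S1 hJ.
have s10 : s - 1 != 0 by rewrite subr_eq0 gt_eqF.
have S10 : S - 1 != 0 by rewrite subr_eq0 gt_eqF.
have J1 : (s - 1) * J = p - a * p - a * (p * ((s - 1) / (S - 1) - 1) / s).
  by rewrite -hJ; field; rewrite gt_eqF.
apply: (mulfI s10); rewrite J1; field.
by rewrite s10 S10 !gt_eqF.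
Qed.

(** With p = 1 / a and t = y^(1 / a), up to a constant the integral of both representations: angle
    pi - a pi for E_(a,1) (- y), angle a pi for F y. *)
Definition poisson_exp (d p t : R) : R := \int[mu]_(u in oy) (poisson 1 d u * expR (- (t * u `^ p))).

Let pe_ge0 (d u x : R) : 0 < d < pi -> 0 <= poisson 1 d u * expR x.
Proof. by move=> d0; apply: mulr_ge0; [exact: poisson_ge0|exact: expR_ge0]. Qed.

Let pe_le (d u x : R) : 0 < d < pi -> 0 <= x -> poisson 1 d u * expR (- x) <= poisson 1 d u.
Proof.
move=> d0 x0; apply: ler_piMr; first exact: poisson_ge0.
by rewrite -expR0 ler_expR oppr_le0.
Qed.

Lemma integrable_poisson_exp (d p t : R) : 0 < d < pi -> 0 <= t ->
  mu.-integrable oy (EFin \o (fun u => poisson 1 d u * expR (- (t * u `^ p)))).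
Proof.
move=> d0 t0; apply: (@integrable_dom _ _ R mu oy moy _ (poisson 1 d)).
- by apply: measurable_funM; [exact: measurable_funTS (measurable_poisson _ _)|mfun].
- move=> u _; rewrite ger0_norm ?pe_ge0//.
  by apply: pe_le => //; rewrite mulr_ge0 ?powR_ge0.
- exact: integrable_poisson ltr01 d0.
Qed.

Lemma poisson_exp_ge0 (d p t : R) : 0 < d < pi -> 0 <= poisson_exp d p t.
Proof.
by move=> d0; apply: Rintegral_ge0 => u _; exact: pe_ge0.
Qed.

Lemma continuous_poisson_exp (d p : R) : 0 < d < pi -> {in oy, continuous (poisson_exp d p)}.
Proof.
move=> d0 t; rewrite inE/= in_itv/= andbT => t0.
have tI : `](0 : R), t + 1[%classic t by rewrite /= in_itv/= t0 ltrDl ltr01.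
apply: (@continuity_under_integral R _ _ mu (fun t u => poisson 1 d u * expR (- (t * u `^ p))) oy moy 0 (t + 1) _ _ (poisson 1 d) _ _ t (mem_set tI)).
- by move=> x; rewrite /= in_itv/= => /andP[x0 _]; apply: integrable_poisson_exp => //; exact: ltW.
- apply: (@aeW _ (measurableTypeR R) R mu) => u _ x _.
  apply: cvgM; first exact: cvg_cst.
  apply: (cvg_comp _ expR); last exact: continuous_expR.
  by apply: cvgN; apply: cvgM; [exact: cvg_id|exact: cvg_cst].
- exact: integrable_poisson ltr01 d0.
- move=> x; rewrite /= in_itv/= => /andP[x0 _].
  apply: (@aeW _ (measurableTypeR R) R mu) => u _.
  rewrite ger0_norm ?pe_ge0//.
  by apply: pe_le => //; rewrite mulr_ge0 ?powR_ge0// ltW.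
Qed.

(** By Tonelli, the inner integral over t of e^(- (u^p + s) t) being 1 / (u^p + s). *)
Lemma laplace_poisson_exp (d p s : R) : 0 < d < pi -> 0 < s ->
  (\int[mu]_(t in oy) (expR (- (s * t)) * poisson_exp d p t)%:E)%E =
  (\int[mu]_(u in oy) (poisson 1 d u / (u `^ p + s))%:E)%E.
Proof.
move=> d0 s0.
transitivity (\int[mu]_(t in oy) \int[mu]_(u in oy) (expR (- (s * t)) * (poisson 1 d u * expR (- (t * u `^ p))))%:E)%E.
  apply: eq_integral => t; rewrite inE/= in_itv/= andbT => t0.
  have ip := integrable_poisson_exp p d0 (ltW t0).
  rewrite ge0_integralZl_fin//; first last.
  - by move=> u _; exact: pe_ge0.
  - exact: (integrable_mfun ip).
  by rewrite EFin_Rintegral// -EFinM.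
rewrite (@tonelli_on _ _ _ _ R mu mu oy oy _ moy moy); first last.
- by move=> t u _ _; rewrite mulr_ge0 ?pe_ge0 ?expR_ge0.
- apply: measurable_funM; first by mfun.
  apply: measurable_funM; last by mfun.
  exact: measurableT_comp (measurable_poisson 1 d) measurable_snd.
apply: eq_integral => u; rewrite inE/= in_itv/= andbT => u0.
have us : 0 < u `^ p + s by rewrite ltr_wpDl ?powR_ge0.
transitivity (\int[mu]_(t in oy) (poisson 1 d u * (t `^ (1 - 1) * expR (- ((u `^ p + s) * t))))%:E)%E.
  apply: eq_integral => t; rewrite inE/= in_itv/= andbT => t0; congr EFin.
  rewrite subrr powRr0 mul1r mulrCA -expRD; congr (_ * expR _); ring.
rewrite ge0_integralZl_fin//; first last.
- exact: poisson_ge0 _ ltr01 d0.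
- by move=> t _; rewrite mulr_ge0 ?powR_ge0 ?expR_ge0.
- by mfun.
rewrite integral_gamma_scale// Gamma1 mul1r -EFinM powRN powRr1// ltW//.
Qed.

End poisson_laplace.

(** * Entire series and the Laplace transform of the Mittag-Leffler function *)

Section mittag_leffler_series.
Variable R : realType.
Local Notation mu := (@lebesgue_measure R).
Local Notation oy := (`]0%R, +oo[%classic : set R).
Local Notation moy := (@measurable_oy R).

Lemma nneseries_lty (u v : R ^nat) : (forall n, 0 <= u n) -> (forall n, u n <= v n) ->
  cvgn (series v) -> (\sum_(0 <= n <oo) (u n)%:E < +oo)%E.
Proof.
move=> u0 uv cv.
have v0 n : 0 <= v n by apply: le_trans (uv n).
have cu := series_le_cvg u0 v0 uv cv.
rewrite (_ : (fun n => _) = EFin \o series u); last by apply/funext => n; rewrite /= -sumEFin.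
by rewrite EFin_lim// ltry.
Qed.

(** Infinite radius of convergence, phrased by bounds so that it passes to [pseries_diffs] on
    replacing [K] by [2 * K]. *)
Definition entire_coef (c : R ^nat) := forall K : R, 0 < K -> exists M, forall n, `|c n| * K ^+ n <= M.

Lemma entire_coef_le (c : R ^nat) (x : R) : entire_coef c -> exists M, forall n, `|c n * x ^+ n| <= M * 2^-1 ^+ n.
Proof.
(* The factor 2 leaves a geometric majorant of ratio 1/2; the summand 1 keeps [K] positive at x =
   0. *)
move=> ec; have K0 : 0 < 2 * (`|x| + 1) by rewrite mulr_gt0// ltr_wpDl.
have [M hM] := ec _ K0; exists M => n; rewrite normrM normrX.
have /(ler_wpM2r (_ : 0 <= 2^-1 ^+ n)) := hM n; rewrite exprn_ge0 ?invr_ge0// => /(_ isT).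
apply: le_trans; rewrite -mulrA ler_wpM2l// -exprMn mulrAC mulfV// mul1r.
by rewrite lerXn2r ?nnegrE ?addr_ge0// lerDl.
Qed.

Lemma is_cvg_series_half (M : R) : cvgn (series (fun n => M * 2^-1 ^+ n)).
Proof. by apply: is_cvg_geometric_series; rewrite ger0_norm ?invr_ge0// invf_lt1// ltr1n. Qed.

Lemma is_cvg_entire (c : R ^nat) (x : R) : entire_coef c -> cvgn (pseries c x).
Proof.
move=> /(@entire_coef_le _ x)[M hM]; apply: (@normed_cvg _ R^o).
apply: (@series_le_cvg _ _ (fun n => M * 2^-1 ^+ n)); [move=> n; exact: normr_ge0| |exact: hM|exact: is_cvg_series_half].
by move=> n; exact: le_trans (normr_ge0 _) (hM n).
Qed.

Lemma entire_coef_diffs (c : R ^nat) : entire_coef c -> entire_coef (pseries_diffs c).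
Proof.
move=> ec K K0; have [M hM] := ec (2 * K) (mulr_gt0 (ltr0Sn _ 1) K0).
exists (M / K) => n; rewrite /pseries_diffs normrM ger0_norm//.
rewrite ler_pdivlMr// -mulrA -exprSr; apply: le_trans (hM n.+1).
have h : n.+1%:R <= 2 ^+ n.+1 :> R by rewrite -natrX ler_nat; exact: ltnW (ltn_expl _ _).
by rewrite exprMn -mulrA mulrCA ler_wpM2l// ler_wpM2r// exprn_ge0// ltW.
Qed.

Lemma is_derive_entire (c : R ^nat) (x : R) : entire_coef c ->
  is_derive x 1 (fun x => limn (pseries c x)) (limn (pseries (pseries_diffs c) x)).
Proof.
move=> ec; apply: (@pseries_snd_diffs _ c (`|x| + 1)).
- exact: is_cvg_entire.
- exact: is_cvg_entire (entire_coef_diffs ec).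
- exact: is_cvg_entire (entire_coef_diffs (entire_coef_diffs ec)).
- by rewrite [ltRHS]ger0_norm ?addr_ge0// ltrDl.
Qed.

Lemma entire_coef_mittag_leffler (a b : R) : 0 < a -> 1 <= b ->
  entire_coef (fun n => (Gamma (b + a * n%:R))^-1).
Proof.
(* With this [X] in [Gamma_lower], X^(a n) = (K + 1)^n, which beats K^n. *)
move=> a0 b1 K K0; pose X := (K + 1) `^ a^-1.
have K1 : 1 <= K + 1 by rewrite lerDr ltW.
have X1 : 1 <= X by rewrite -(powRr0 (K + 1)) ler_powR// invr_ge0 ltW.
have X0 : 0 < X by apply: lt_le_trans X1.
exists (expR (X + 1)) => n.
have u1 : 1 <= b + a * n%:R by rewrite (le_trans b1)// lerDl mulr_ge0// ltW.
have G0 : 0 < Gamma (b + a * n%:R) by rewrite Gamma_gt0// (lt_le_trans _ u1).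
have := Gamma_lower u1 X0; rewrite expRN => h.
rewrite ger0_norm ?invr_ge0 ?(ltW G0)// mulrC ler_pdivrMr// mulrC -ler_pdivrMr ?expR_gt0//.
apply: le_trans h; rewrite ler_wpM2r ?invr_ge0 ?expR_ge0//.
apply: (@le_trans _ _ (X `^ (a * n%:R))); last by apply: ler_powR => //; rewrite addrAC lerDr subr_ge0.
rewrite -powRrM mulrA mulVf ?gt_eqF// mul1r powR_mulrn ?addr_ge0 ?(ltW K0)//.
by rewrite lerXn2r ?nnegrE ?addr_ge0 ?(ltW K0)// lerDl.
Qed.

Lemma mittag_lefflerE (a b z : R) :
  mittag_leffler a b z = limn (pseries (fun n => (Gamma (b + a * n%:R))^-1) z).
Proof.
rewrite /mittag_leffler /pseries; congr (limn (series _)).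
by apply/funext => n; rewrite mulrC.
Qed.

Lemma cvg_mittag_leffler (a b z : R) : 0 < a -> 1 <= b ->
  series (fun n => z ^+ n / Gamma (b + a * n%:R)) n @[n --> \oo] --> mittag_leffler a b z.
Proof.
move=> a0 b1; have := @is_cvg_entire _ z (entire_coef_mittag_leffler a0 b1).
rewrite /pseries (_ : [sequence _]_n = (fun n => z ^+ n / Gamma (b + a * n%:R))) => //.
by apply/funext => n; rewrite mulrC.
Qed.

Lemma continuous_mittag_leffler (a b z : R) : 0 < a -> 1 <= b ->
  {for z, continuous (mittag_leffler a b)}.
Proof.
move=> a0 b1; rewrite (_ : mittag_leffler a b = fun z => limn (pseries (fun n => (Gamma (b + a * n%:R))^-1) z)).
  exact: is_derive_continuous (is_derive_entire z (entire_coef_mittag_leffler a0 b1)).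
by apply/funext => x; exact: mittag_lefflerE.
Qed.

(** Termwise, t^(a n) contributes Gamma (1 + a n) s^(- 1 - a n), which cancels the coefficient and
    leaves a geometric series of ratio c / s^a, below 1 in modulus. The parameter [c] serves both
    signs. *)
Lemma laplace_mittag_leffler (a c s : R) : 0 < a -> `|c| <= 1 -> 1 < s ->
  mu.-integrable oy (EFin \o (fun t => expR (- (s * t)) * mittag_leffler a 1 (c * t `^ a))) /\
  \int[mu]_(t in oy) (expR (- (s * t)) * mittag_leffler a 1 (c * t `^ a)) = s^-1 / (1 - c / s `^ a).
Proof.
move=> a0 c1 s1; have s0 : 0 < s by apply: lt_trans s1.
have sa : 1 < s `^ a.
  by have /(_ 1 s) := gt0_ltr_powR a0; rewrite powR1 => -> //; rewrite nnegrE ltW.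
have sa0 : 0 < s `^ a by apply: lt_trans sa.
pose f n (t : R) := expR (- (s * t)) * ((c * t `^ a) ^+ n / Gamma (1 + a * n%:R)).
have u0 n : 0 < 1 + a * n%:R by rewrite ltr_wpDr ?mulr_ge0// ltW.
have mf n : measurable_fun oy (f n) by rewrite /f; mfun.
pose g n (t : R) := t `^ (1 + a * n%:R - 1) * expR (- (s * t)).
have fE n t : 0 < t -> f n t = c ^+ n / Gamma (1 + a * n%:R) * g n t.
  move=> t0; rewrite /f /g addrAC subrr add0r exprMn powRrM powR_mulrn ?powR_ge0//; ring.
have g0 n t : 0 <= g n t by rewrite mulr_ge0 ?powR_ge0 ?expR_ge0.
have sE n : s `^ (- (1 + a * n%:R)) = s^-1 * (s `^ a)^-1 ^+ n.
  by rewrite powRN powRD ?(gt_eqF s0) ?implybT// powRr1 ?(ltW s0)// powRrM powR_mulrn ?powR_ge0// invfM exprVn.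
have ig n : (\int[mu]_(t in oy) (g n t)%:E)%E = (Gamma (1 + a * n%:R) * (s^-1 * (s `^ a)^-1 ^+ n))%:E.
  by rewrite integral_gamma_scale// sE.
have mg n : measurable_fun oy (g n) by rewrite /g; mfun.
have iG n : mu.-integrable oy (EFin \o g n).
  apply: (ge0_integral_eq_integrable (m := mu) (mg n) _ (ig n)) => t _; exact: g0.
have [||i1 i2] := @cvg_Rintegral_series _ _ R mu oy moy f
  (fun t => expR (- (s * t)) * mittag_leffler a 1 (c * t `^ a)) mf.
- move=> t _; have := @cvg_mittag_leffler a 1 (c * t `^ a) a0 (lexx 1).
  rewrite /f => h; rewrite (_ : series _ = fun n => expR (- (s * t)) * series (fun n => (c * t `^ a) ^+ n / Gamma (1 + a * n%:R)) n).
    by apply: cvgM => //; exact: cvg_cst.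
  by apply/funext => n; rewrite /series/= mulr_sumr.
- apply: (@le_lt_trans _ _ (\sum_(0 <= n <oo) (s^-1 * (s `^ a)^-1 ^+ n)%:E)%E).
    apply: lee_nneseries => [n *|n *]; first by apply: integral_ge0 => t _; rewrite lee_fin.
    have -> : (s^-1 * (s `^ a)^-1 ^+ n)%:E = (\int[mu]_(t in oy) ((Gamma (1 + a * n%:R))^-1 * g n t)%:E)%E.
      rewrite ge0_integralZl_fin//; last 1 first.
      - by rewrite invr_ge0 ltW// Gamma_gt0.
        by rewrite ig -EFinM mulKf// gt_eqF// Gamma_gt0.
      exact: mg.
    apply: ge0_le_integral => //.
    + by apply/measurable_EFinP; apply: measurableT_comp => //; exact: mf.
    + by apply/measurable_EFinP; apply: measurable_funM; [exact: measurable_cst|exact: mg].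
    + move=> t; rewrite /= in_itv/= andbT => t0; rewrite lee_fin fE// normrM (ger0_norm (g0 n t)) normrM.
      apply: ler_wpM2r => //; rewrite normfV (gtr0_norm (Gamma_gt0 (u0 n))).
      by apply: ler_piMl; [rewrite invr_ge0 ltW// Gamma_gt0|rewrite normrX exprn_ile1].
  apply: (@nneseries_lty _ (fun n => s^-1 * (s `^ a)^-1 ^+ n)) => //.
    by move=> n; rewrite mulr_ge0 ?exprn_ge0 ?invr_ge0 ?ltW.
  by apply: is_cvg_geometric_series; rewrite ger0_norm ?invr_ge0 ?(ltW sa0)// invf_lt1.
split => //; apply: (cvg_unique (@Rhausdorff R) i2).
rewrite (_ : series _ = series (fun n => s^-1 * (c / s `^ a) ^+ n)).
  apply: cvg_geometric_series; rewrite normrM normfV (gtr0_norm sa0) ltr_pdivrMr// mul1r.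
  exact: le_lt_trans sa.
congr series; apply/funext => n.
transitivity (\int[mu]_(t in oy) (c ^+ n / Gamma (1 + a * n%:R) * g n t)).
  by apply: eq_Rintegral => t; rewrite inE/= in_itv/= andbT => t0; rewrite fE.
rewrite (RintegralZl _ moy (iG n)).
have -> : \int[mu]_(t in oy) g n t = Gamma (1 + a * n%:R) * (s^-1 * (s `^ a)^-1 ^+ n).
  by apply: EFin_inj; rewrite -(EFin_Rintegral moy (iG n)).
have := Gamma_gt0 (u0 n); set G := Gamma _ => G0.
rewrite exprMn; move: ((s `^ a)^-1 ^+ n) (c ^+ n) s^-1 => x y z.
by field; rewrite gt_eqF.
Qed.

End mittag_leffler_series.

Section mittag_leffler_integral.
Variable R : realType.
Local Notation mu := (@lebesgue_measure R).
Local Notation oy := (`]0%R, +oo[%classic : set R).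
Local Notation moy := (@measurable_oy R).

Lemma laplace_injective (f g : R -> R) :
  {in oy, continuous f} -> {in oy, continuous g} ->
  (forall s, 1 < s -> mu.-integrable oy (EFin \o (fun t => expR (- (s * t)) * f t))) ->
  (forall s, 1 < s -> mu.-integrable oy (EFin \o (fun t => expR (- (s * t)) * g t))) ->
  (forall s, 1 < s -> \int[mu]_(t in oy) (expR (- (s * t)) * f t) = \int[mu]_(t in oy) (expR (- (s * t)) * g t)) ->
  forall t, 0 < t -> f t = g t.
Proof.
move=> cf cg If Ig fg t t0; apply/eqP; rewrite -subr_eq0.
have e n (x k : R) : expR (- x) ^+ n * (expR (- (2 * x)) * k) = expR (- ((n.+2)%:R * x)) * k.
  rewrite mulrA -expRM_natr -expRD; congr (expR _ * _).
  by rewrite -[n.+2]addn2 natrD; ring.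
have n1 n : 1 < n.+2%:R :> R by rewrite ltr1n.
have /eqP : expR (- (2 * t)) * (f t - g t) = 0; last first.
  by rewrite mulf_eq0 gt_eqF ?expR_gt0.
apply: (@laplace_uniqueness R (fun t => expR (- (2 * t)) * (f t - g t))) => //.
- have := integrableBr moy (If _ (n1 0)) (Ig _ (n1 0)).
  by apply: eq_integrable; [exact: moy|move=> x _ /=; rewrite mulrBr].
- move=> x xo; apply: cvgM; last by apply: cvgB; [exact: cf|exact: cg].
  apply: (cvg_comp _ expR); last exact: continuous_expR.
  by apply: cvgN; apply: cvgM; [exact: cvg_cst|exact: cvg_id].
- move=> n; transitivity (\int[mu]_(t in oy) (expR (- ((n.+2)%:R * t)) * f t - expR (- ((n.+2)%:R * t)) * g t)).
    by apply: eq_Rintegral => x _; rewrite e mulrBr.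
  by rewrite (RintegralB moy (If _ (n1 n)) (Ig _ (n1 n))) fg// subrr.
Qed.

Let laplace_pe (d p s k I : R) : 0 < d < pi -> 0 < s ->
  (\int[mu]_(u in oy) (poisson 1 d u / (u `^ p + s))%:E)%E = I%:E ->
  mu.-integrable oy (EFin \o (fun t => expR (- (s * t)) * (k * poisson_exp d p t))) /\
  \int[mu]_(t in oy) (expR (- (s * t)) * (k * poisson_exp d p t)) = k * I.
Proof.
move=> d0 s0 hI; rewrite -(laplace_poisson_exp p d0 s0) in hI.
have m : measurable_fun oy (fun t => expR (- (s * t)) * poisson_exp d p t).
  apply: measurable_funM; first by mfun.
  by apply: open_continuous_measurable_fun; [exact: open_oy|exact: continuous_poisson_exp].
have i : mu.-integrable oy (EFin \o (fun t => expR (- (s * t)) * poisson_exp d p t)).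
  apply: (ge0_integral_eq_integrable (m := mu) m _ hI) => t _.
  by rewrite mulr_ge0 ?expR_ge0 ?poisson_exp_ge0.
have e t : expR (- (s * t)) * (k * poisson_exp d p t) = k * (expR (- (s * t)) * poisson_exp d p t).
  by rewrite mulrCA.
have i' : mu.-integrable oy (EFin \o (fun t => expR (- (s * t)) * (k * poisson_exp d p t))).
  have := integrableZ moy k i.
  by apply: eq_integrable; [exact: moy|move=> x _ /=; rewrite e].
split => //; under eq_Rintegral do rewrite e.
rewrite (RintegralZl _ moy i); congr (_ * _).
by apply: EFin_inj; rewrite -(EFin_Rintegral moy i).
Qed.

Let continuous_ml (a c : R) : 0 < a -> {in oy, continuous (fun t => mittag_leffler a 1 (c * t `^ a))}.
Proof.
move=> a0 t; rewrite inE/= in_itv/= andbT => t0.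
apply: (cvg_comp (fun t => c * t `^ a) (mittag_leffler a 1)).
  by apply: cvgM; [exact: cvg_cst|exact: continuous_powR].
exact: continuous_mittag_leffler.
Qed.

Let continuous_kpe (d p k : R) : 0 < d < pi -> {in oy, continuous (fun t => k * poisson_exp d p t)}.
Proof. by move=> d0 t t0; apply: cvgM; [exact: cvg_cst|exact: continuous_poisson_exp]. Qed.

Lemma mittag_leffler_negE (a t : R) : 0 < a < 1 -> 0 < t ->
  mittag_leffler a 1 (- t `^ a) = (a * pi)^-1 * poisson_exp (pi - a * pi) a^-1 t.
Proof.
move=> a01 t0; case/andP: (a01) => a0 a1.
have ap0 : 0 < a * pi by rewrite mulr_gt0 ?pi_gt0.
have d0 : 0 < pi - a * pi < pi.
  by rewrite subr_gt0 gtrBl ap0 andbT -[ltRHS]mul1r ltr_pM2r// pi_gt0.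
have c1 : `|(-1 : R)| <= 1 by rewrite normrN normr1.
rewrite -mulN1r.
apply: (laplace_injective (f := fun t => mittag_leffler a 1 (-1 * t `^ a))
  (g := fun t => (a * pi)^-1 * poisson_exp (pi - a * pi) a^-1 t)) => //.
- exact: continuous_ml.
- exact: continuous_kpe.
- by move=> s s1; have [] := laplace_mittag_leffler a0 c1 s1.
- move=> s s1; have s0 : 0 < s by apply: lt_trans s1.
  by have [] := laplace_pe (a * pi)^-1 d0 s0 (integral_poisson_plus a01 s0).
move=> s s1; have s0 : 0 < s by apply: lt_trans s1.
have [_ ->] := laplace_mittag_leffler a0 c1 s1.
have [_ ->] := laplace_pe (a * pi)^-1 d0 s0 (integral_poisson_plus a01 s0).
rewrite mulKf ?gt_eqF// powRB ?(gt_eqF s0) ?implybT// powRr1 ?(ltW s0)//.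
have : 0 < s `^ a by rewrite powR_gt0.
by set S := s `^ a => S0; field; rewrite !gt_eqF// addr_gt0.
Qed.

(** For s > 1 both sides have Laplace transform 1 / (a (s - 1)) - s^(a - 1) / (s^a - 1), the
    right-hand one by [integral_poisson_minus]. *)
Lemma mittag_leffler_posE (a t : R) : 2^-1 <= a < 1 -> 0 < t ->
  expR t / a - mittag_leffler a 1 (t `^ a) = (a * pi)^-1 * poisson_exp (a * pi) a^-1 t.
Proof.
move=> a01 t0; case/andP: (a01) => ah a1.
have a0 : 0 < a by apply: lt_le_trans ah.
have ap0 : 0 < a * pi by rewrite mulr_gt0 ?pi_gt0.
have d0 : 0 < a * pi < pi.
  by rewrite ap0 -[ltRHS]mul1r ltr_pM2r// pi_gt0.
have c1 : `|(1 : R)| <= 1 by rewrite normr1.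
have exp_laplace (s : R) : 1 < s ->
    mu.-integrable oy (EFin \o (fun t => expR (- (s * t)) * (expR t / a))) /\
    \int[mu]_(t in oy) (expR (- (s * t)) * (expR t / a)) = a^-1 * (s - 1)^-1.
  move=> s1; have s10 : 0 < s - 1 by rewrite subr_gt0.
  have h : (\int[mu]_(t in oy) (expR (- ((s - 1) * t)))%:E)%E = ((s - 1)^-1)%:E.
    have := integral_gamma_scale (@ltr01 R) s10.
    rewrite Gamma1 mul1r powRN powRr1 ?(ltW s10)// => <-.
    by apply: eq_integral => t' _; rewrite subrr powRr0 mul1r.
  have i : mu.-integrable oy (EFin \o (fun t => expR (- ((s - 1) * t)))).
    by apply: (ge0_integral_eq_integrable (m := mu) _ _ h); [mfun|move=> *; exact: expR_ge0].
  have e t' : expR (- (s * t')) * (expR t' / a) = a^-1 * expR (- ((s - 1) * t')).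
    by rewrite mulrA -expRD mulrC; congr (_ * expR _); ring.
  split.
    have := integrableZ moy a^-1 i.
    by apply: eq_integrable; [exact: moy|move=> x _ /=; rewrite e].
  under eq_Rintegral do rewrite e.
  rewrite (RintegralZl _ moy i); congr (_ * _).
  by apply: EFin_inj; rewrite -(EFin_Rintegral moy i).
rewrite -[t `^ a]mul1r.
apply: (laplace_injective (f := fun t => expR t / a - mittag_leffler a 1 (1 * t `^ a))
  (g := fun t => (a * pi)^-1 * poisson_exp (a * pi) a^-1 t)) => //.
- move=> x xo; apply: cvgB; last exact: continuous_ml.
  by apply: cvgM; [exact: continuous_expR|exact: cvg_cst].
- exact: continuous_kpe.
- move=> s s1; have [i1 _] := exp_laplace s s1; have [i2 _] := laplace_mittag_leffler a0 c1 s1.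
  have := integrableBr moy i1 i2.
  by apply: eq_integrable; [exact: moy|move=> x _ /=; rewrite mulrBr].
- move=> s s1; have s0 : 0 < s by apply: lt_trans s1.
  by have [] := laplace_pe (a * pi)^-1 d0 s0 (integral_poisson_minus a01 s1).
move=> s s1; have s0 : 0 < s by apply: lt_trans s1.
have [i1 e1] := exp_laplace s s1; have [i2 e2] := laplace_mittag_leffler a0 c1 s1.
have [_ ->] := laplace_pe (a * pi)^-1 d0 s0 (integral_poisson_minus a01 s1).
transitivity (\int[mu]_(t in oy) (expR (- (s * t)) * (expR t / a) - expR (- (s * t)) * mittag_leffler a 1 (1 * t `^ a))).
  by apply: eq_Rintegral => x _; rewrite mulrBr.
rewrite (RintegralB moy i1 i2) e1 e2.
rewrite mulKf ?gt_eqF// powRB ?(gt_eqF s0) ?implybT// powRr1 ?(ltW s0)//.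
have : 1 < s `^ a.
  by have /(_ 1 s) := gt0_ltr_powR a0; rewrite powR1 => -> //; rewrite nnegrE ltW.
set S := s `^ a => S1.
by field; rewrite !gt_eqF ?subr_gt0// (lt_trans _ S1).
Qed.

End mittag_leffler_integral.

(** * The quotient with numerator y^p + 1 as a Stieltjes function *)

Section stieltjes_quotient.
Variable R : realType.
Local Notation mu := (@lebesgue_measure R).
Local Notation oy := (`]0%R, +oo[%classic : set R).
Local Notation moy := (@measurable_oy R).

Lemma ge0_subst_inv (G : R -> R) :
  {in oy, continuous G} -> (forall x, 0 < x -> 0 <= G x) ->
  (\int[mu]_(x in oy) (G x)%:E = \int[mu]_(x in oy) (G x^-1 * x ^- 2)%:E)%E.
Proof.
move=> cG G0.
have cV (x : R) : 0 < x -> {for x, continuous (fun x : R => x^-1)}.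
  by move=> x0; apply: inv_continuous; rewrite gt_eqF.
have dV (x : R) : 0 < x -> is_derive x 1 (fun x : R => x^-1) (- x ^- 2).
  move=> x0; apply: (is_derive_eq (is_derive_fV (is_derive_fid x) (lt0r_neq0 x0))).
  by rewrite mulN1r.
have d1V (x : R) : 0 < x -> derive1 (fun x : R => x^-1) x = - x ^- 2.
  by move=> x0; rewrite derive1E; have [_ ->] := dV x x0.
have cV' (x : R) : 0 < x -> {for x, continuous (derive1 (fun x : R => x^-1))}.
  move=> x0; rewrite /prop_for /continuous_at d1V//.
  apply: (@cvg_trans _ ((fun x => - x ^- 2) @ x)).
    apply: near_eq_cvg; near=> y; rewrite d1V//; near: y.
    exact: lt_nbhsr.
  have x20 : x * x != 0 by rewrite mulf_neq0// gt_eqF.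
  exact: is_derive_continuous (is_derive_fN (is_derive_fV (is_derive_fM (is_derive_fid x) (is_derive_fid x)) x20)).
have cG' : {in oy, continuous (fun x : R => G x^-1 * x ^- 2)}.
  move=> x; rewrite inE/= in_itv/= andbT => x0; apply: cvgM.
    apply: (cvg_comp (fun x : R => x^-1) G (cV x x0)).
    by apply: cG; rewrite inE/= in_itv/= invr_gt0 x0.
  apply: cvgV; first by rewrite expf_neq0// gt_eqF.
  by apply: cvgM; exact: cvg_id.
pose E (n : nat) : set R := `[(n.+1%:R)^-1, n.+1%:R]%classic.
have c (H : R -> R) : {in oy, continuous H} -> (forall x, 0 < x -> 0 <= H x) ->
    (\int[mu]_(x in E n) (H x)%:E)%E @[n --> \oo] --> (\int[mu]_(x in oy) (H x)%:E)%E.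
  move=> cH H0; apply: (@cvg_integral_exhaust _ oy (fun n => (n.+1%:R)^-1) (fun n => n.+1%:R)).
  - exact: invn_anti.
  - exact: natS_mono.
  - exact: bigcup_itv_oy.
  - by apply: open_continuous_measurable_fun => //; exact: open_oy.
  - by move=> x; rewrite /= in_itv/= andbT; exact: H0.
have c1 := c _ cG G0.
have c2 : (\int[mu]_(x in E n) (G x^-1 * x ^- 2)%:E)%E @[n --> \oo] -->
    (\int[mu]_(x in oy) (G x^-1 * x ^- 2)%:E)%E.
  apply: c => // x x0; rewrite mulr_ge0 ?invr_ge0 ?exprn_ge0 ?(ltW x0)//.
  by rewrite G0// invr_gt0.
apply: cvg_unique c1 _ => //.
rewrite (_ : (fun n => _) = (fun n => \int[mu]_(x in E n) (G x^-1 * x ^- 2)%:E)%E) //.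
apply/funext => n; rewrite /E.
have pos (x : R) : (n.+1%:R)^-1 <= x -> 0 < x by apply: lt_le_trans; rewrite invr_gt0.
have := @integration_by_substitution_decreasing R (fun x : R => x^-1) G _ _ (@invn_le_n R n).
rewrite invrK => -> //.
- apply: eq_integral => x; rewrite inE/= in_itv/= => /andP[/pos x0 _].
  by congr (_%:E); rewrite -[LHS]/(G x^-1 * - derive1 (fun x : R => x^-1) x) d1V// opprK.
- move=> x y; rewrite !in_itv/= => /andP[/pos x0 _] /andP[/pos y0 _] xy.
  by rewrite ltf_pV2.
- by move=> x; rewrite in_itv/= => /andP[/ltW/pos x0 _]; exact: cV'.
- apply/cvg_ex; exists (derive1 (fun x : R => x^-1) (n.+1%:R)^-1).
  by apply: cvg_at_right_filter; apply: cV'; rewrite invr_gt0.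
- apply/cvg_ex; exists (derive1 (fun x : R => x^-1) n.+1%:R).
  by apply: cvg_at_left_filter; exact: cV'.
- split.
  + by move=> x; rewrite in_itv/= => /andP[/ltW/pos x0 _]; have [] := dV x x0.
  + by apply: cvg_at_right_filter; apply: cV; rewrite invr_gt0.
  + by apply: cvg_at_left_filter; exact: cV.
- apply: continuous_in_subspaceT => x; rewrite inE/= in_itv/= => /andP[/pos x0 _].
  by apply: cG; rewrite inE/= in_itv/= x0.
Unshelve. all: by end_near. Qed.

(** The trinomial is at least (sin th)^2 and at least (r sin th)^2, which settles 0 for b > -1 and
    infinity for b < 1. *)
Lemma integrable_powR_trinomial (b th : R) : - 1 < b < 1 -> 0 < th < pi ->
  mu.-integrable oy (EFin \o (fun r => r `^ b * (sin th / (r ^+ 2 + 2 * r * cos th + 1)))).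
Proof.
move=> /andP[b1 b2] th0; have st : 0 < sin th by exact: sin_gt0_pi.
have p0 : 0 < b + 1 by rewrite -ltrBlDr sub0r.
have q0 : 0 < 1 - b by rewrite subr_gt0.
have dE r : r ^+ 2 + 2 * r * cos th + 1 = (r + cos th) ^+ 2 + sin th ^+ 2.
  by rewrite sin2cos2; ring.
have dE' r : r ^+ 2 + 2 * r * cos th + 1 = (1 + r * cos th) ^+ 2 + (sin th * r) ^+ 2.
  by rewrite exprMn sin2cos2; ring.
have d0 r : 0 < r ^+ 2 + 2 * r * cos th + 1.
  by rewrite dE ltr_wpDl ?sqr_ge0// exprn_gt0.
apply: (integrable_dom (m := mu) moy _ _ (integrable_tail (sin th)^-1 p0 q0)); first by mfun.
move=> r; rewrite /= in_itv/= andbT => r0.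
rewrite ger0_norm; last by rewrite mulr_ge0 ?powR_ge0 ?divr_ge0// ltW.
case: ifP => r1.
  rewrite addrK mulrC ler_wpM2r ?powR_ge0// ler_pdivrMr// ler_pdivlMl//.
  by rewrite dE -expr2 lerDr sqr_ge0.
rewrite opprB (_ : b - 1 - 1 = b - 2%:R); last by rewrite -natr1; ring.
rewrite powRB ?(gt_eqF r0) ?implybT// powR_mulrn ?(ltW r0)// [leRHS]mulrCA ler_wpM2l ?powR_ge0//.
rewrite ler_pdivrMr// mulrAC ler_pdivlMr ?exprn_gt0// ler_pdivlMl//.
by rewrite dE' mulrA -expr2 -exprMn lerDr sqr_ge0.
Qed.

(** The measure dr / (r^2 + 2 r cos th + 1) is invariant under r -> 1 / r, which carries the
    exponent a - 1 to 1 - a, in the range of [integral_powR_trinomial]. *)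
Lemma integral_powR_trinomialV (a th : R) : 0 < a < 1 -> 0 < th < pi ->
  \int[mu]_(r in oy) (r `^ (a - 1) * (sin th / (r ^+ 2 + 2 * r * cos th + 1))) =
  pi * sin ((1 - a) * th) / sin (a * pi).
Proof.
move=> a01 th0; case/andP: (a01) => a0 a1; have st : 0 < sin th by exact: sin_gt0_pi.
have d0 r : 0 < r ^+ 2 + 2 * r * cos th + 1.
  have -> : r ^+ 2 + 2 * r * cos th + 1 = (r + cos th) ^+ 2 + sin th ^+ 2 by rewrite sin2cos2; ring.
  by rewrite ltr_wpDl ?sqr_ge0// exprn_gt0.
have b1 : - 1 < a - 1 < 1 by apply/andP; split; lra.
have b2 : - 1 < 1 - a < 1 by apply/andP; split; lra.
have a01' : 0 < 1 - a < 1 by apply/andP; split; lra.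
have <- : sin ((1 - a) * pi) = sin (a * pi).
  by rewrite mulrBl mul1r sinB sinpi cospi mul0r sub0r mulN1r opprK.
rewrite -(integral_powR_trinomial a01' th0).
apply: EFin_inj; rewrite -(EFin_Rintegral moy (integrable_powR_trinomial b1 th0)).
rewrite -(EFin_Rintegral moy (integrable_powR_trinomial b2 th0)).
rewrite ge0_subst_inv; first last.
- by move=> r r0; rewrite mulr_ge0 ?powR_ge0 ?divr_ge0// ltW.
- move=> r; rewrite inE/= in_itv/= andbT => r0; apply: cvgM; first exact: continuous_powR.
  apply: cvgM; first exact: cvg_cst.
  apply: cvgV; first by rewrite gt_eqF.
  apply: cvgD; last exact: cvg_cst; apply: cvgD; first by apply: cvgM; exact: cvg_id.
  by apply: cvgM; [apply: cvgM; [exact: cvg_cst|exact: cvg_id]|exact: cvg_cst].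
apply: eq_integral => r; rewrite inE/= in_itv/= andbT => r0; congr EFin.
have -> : r^-1 `^ (a - 1) = r `^ (1 - a).
  by rewrite -[r^-1]powR_inv1 ?(ltW r0)// -powRrM mulN1r opprB.
have := d0 r; have := d0 r^-1; set D := _ + 1; set D' := _ + 1 => D0 D0'.
have E : D = D' / r ^+ 2 by rewrite /D /D'; field; rewrite gt_eqF.
by rewrite E; field; rewrite !gt_eqF.
Qed.

(** Partial fractions in [l] reduce the integral to the three already computed. The angle th = pi /
    p satisfies p th = pi, hence sin ((p - 1) th) = sin th and sin ((2 - p) th) = - 2 cos th sin th,
    and the three terms combine into y^p + 1. *)
Lemma stieltjes_quotient (p y : R) : 1 < p < 2 -> 0 < y ->
  mu.-integrable oy (EFin \o (fun l => l `^ p / (l ^+ 2 + 2 * l * cos (pi / p) + 1) / (l + y))) /\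
  \int[mu]_(l in oy) (l `^ p / (l ^+ 2 + 2 * l * cos (pi / p) + 1) / (l + y)) =
  pi / sin ((p - 1) * pi) * ((y `^ p + 1) / (y ^+ 2 - 2 * y * cos (pi / p) + 1)).
Proof.
move=> /andP[p1 p2] y0; set th := pi / p.
have p0 : 0 < p by apply: lt_trans p1.
have th0 : 0 < th < pi.
  by rewrite divr_gt0 ?pi_gt0//= ltr_pdivrMr// ltr_pMr// pi_gt0.
have st : 0 < sin th by exact: sin_gt0_pi.
have a01 : 0 < p - 1 < 1 by apply/andP; split; lra.
have sp := sinpiM_gt0 a01.
have b1 : - 1 < p - 1 < 1 by apply/andP; split; lra.
have b2 : - 1 < p - 1 - 1 < 1 by apply/andP; split; lra.
have pth : p * th = pi by rewrite /th mulrC divfK// gt_eqF.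
have [i1 e1] := integral_powR_addV a01 y0.
have i2 := integrable_powR_trinomial b1 th0.
have e2 := integral_powR_trinomial a01 th0.
have i3 := integrable_powR_trinomial b2 th0.
have e3 := integral_powR_trinomialV a01 th0.
have d0 l : 0 < l ^+ 2 + 2 * l * cos th + 1.
  have -> : l ^+ 2 + 2 * l * cos th + 1 = (l + cos th) ^+ 2 + sin th ^+ 2 by rewrite sin2cos2; ring.
  by rewrite ltr_wpDl ?sqr_ge0// exprn_gt0.
have D0 : 0 < y ^+ 2 - 2 * y * cos th + 1.
  have -> : y ^+ 2 - 2 * y * cos th + 1 = (y - cos th) ^+ 2 + sin th ^+ 2 by rewrite sin2cos2; ring.
  by rewrite ltr_wpDl ?sqr_ge0// exprn_gt0.
set c := cos th in d0 D0 i2 i3 e2 e3 *.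
set D := y ^+ 2 - 2 * y * c + 1 in D0 *.
(* Residue of l^2 / (l^2 + 2 l c + 1) / (l + y) at l = - y. *)
pose w := y ^+ 2 / D.
pose f l := w * (l `^ (p - 1 - 1) / (l + y)) + (1 - w) / sin th * (l `^ (p - 1) * (sin th / (l ^+ 2 + 2 * l * c + 1)))
   - w / y / sin th * (l `^ (p - 1 - 1) * (sin th / (l ^+ 2 + 2 * l * c + 1))).
have fE l : 0 < l -> l `^ p / (l ^+ 2 + 2 * l * c + 1) / (l + y) = f l.
  move=> l0; have -> : l `^ p = l `^ (p - 1 - 1) * l ^+ 2.
    by rewrite -powR_mulrn ?(ltW l0)// -powRD ?(gt_eqF l0) ?implybT//; congr powR; ring.
  rewrite /f (_ : l `^ (p - 1) = l `^ (p - 1 - 1) * l); last first.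
    by rewrite [RHS]mulrC mulr_powRB1// ?(ltW l0)//; lra.
  have ly : l + y != 0 by rewrite gt_eqF// addr_gt0.
  have q0 := lt0r_neq0 (d0 l).
  have w' : (l ^+ 2) / (l ^+ 2 + 2 * l * c + 1) / (l + y) = w / (l + y) + ((1 - w) * l - w / y) / (l ^+ 2 + 2 * l * c + 1).
    by rewrite /w /D; field; rewrite q0 ly !gt_eqF.
  move: w' q0; set q := _ + 1 => w' q0; set t := l `^ _.
  transitivity (t * (l ^+ 2 / q / (l + y))); first by ring.
  by rewrite w'; field; rewrite q0 ly !gt_eqF.
have if1 := integrableZ moy w i1.
have if2 := integrableZ moy ((1 - w) / sin th) i2.
have if3 := integrableZ moy (w / y / sin th) i3.
have if12 := integrableDr moy if1 if2.
have i : mu.-integrable oy (EFin \o f) by exact: (integrableBr moy if12 if3).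
split.
  apply: eq_integrable i; first exact: moy.
  by move=> l; rewrite inE/= in_itv/= andbT => l0 /=; rewrite fE.
transitivity (\int[mu]_(l in oy) f l).
  by apply: eq_Rintegral => l; rewrite inE/= in_itv/= andbT => l0; rewrite fE.
rewrite /f (RintegralB moy if12 if3) (RintegralD moy if1 if2).
rewrite (RintegralZl _ moy i1) (RintegralZl _ moy i2) (RintegralZl _ moy i3) e1 e2 e3.
have -> : (p - 1) * th = pi - th by rewrite mulrBl mul1r pth.
have -> : (1 - (p - 1)) * th = th *+ 2 - pi by rewrite -pth; ring.
have -> : sin (pi - th) = sin th by rewrite sinB sinpi cospi mul0r sub0r mulN1r opprK.
have -> : sin (th *+ 2 - pi) = - (2 * c * sin th).
  by rewrite sinB sinpi cospi mulr0 subr0 mulrN1 sin_mulr2n -mulr_natl; congr (- _); rewrite -/c; ring.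
have -> : y `^ (p - 1 - 1) = y `^ p / y ^+ 2.
  by rewrite -powR_mulrn ?(ltW y0)// -powRB ?(gt_eqF y0) ?implybT//; congr powR; ring.
move: (sin ((p - 1) * pi)) (sin th) (y `^ p) pi sp st => S s Y P S0 s0.
by rewrite /w /D; field; rewrite !gt_eqF.
Qed.

End stieltjes_quotient.

(** * Complete monotonicity through alternating differences *)

Section alternating_differences.
Variable R : realType.
Local Notation mu := (@lebesgue_measure R).
Local Notation oy := (`]0%R, +oo[%classic : set R).
Local Notation moy := (@measurable_oy R).
Implicit Types (f g b : R -> R) (hs : seq R).

(** Each step has its sign reversed, so n steps give (-1)^n times an n-th difference. The steps may
    be unequal, which leaves each one free in inductions on the list. *)
Fixpoint alt_diff hs f : R -> R :=
  if hs is h :: hs' then alt_diff hs' (fun x => f x - f (x + h)) else f.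

(* Bernstein's form of complete monotonicity: unlike the one with derivatives, it passes to pointwise limits and integrals for free. *)
Definition alt_monotonic f := forall hs, all (fun h => 0 < h) hs -> forall x, 0 < x -> 0 <= alt_diff hs f x.

Lemma eq_alt_diff hs f g : all (fun h => 0 < h) hs -> (forall x, 0 < x -> f x = g x) ->
  forall x, 0 < x -> alt_diff hs f x = alt_diff hs g x.
Proof.
elim: hs f g => [|h hs IH] f g /=; first by move=> _ fg x; exact: fg.
by move=> /andP[h0 hs0] fg; apply: IH => // x x0; rewrite !fg// addr_gt0.
Qed.

Lemma eq_alt_monotonic f g : (forall x, 0 < x -> f x = g x) -> alt_monotonic f -> alt_monotonic g.
Proof. by move=> fg cf hs p x x0; rewrite -(eq_alt_diff p fg)// cf. Qed.

Lemma alt_diffD hs f g x : alt_diff hs (fun y => f y + g y) x = alt_diff hs f x + alt_diff hs g x.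
Proof.
elim: hs f g x => [//|h hs IH] f g x /=; rewrite -IH; congr (alt_diff hs _ x).
by apply/funext => y; rewrite opprD addrACA.
Qed.

Lemma alt_diffZ hs k f x : alt_diff hs (fun y => k * f y) x = k * alt_diff hs f x.
Proof.
elim: hs f x => [//|h hs IH] f x /=; rewrite -IH; congr (alt_diff hs _ x).
by apply/funext => y; rewrite mulrBr.
Qed.

Lemma alt_diff_shift hs f u x : alt_diff hs (fun y => f (y + u)) x = alt_diff hs f (x + u).
Proof.
elim: hs f x => [//|h hs IH] f x /=; rewrite -IH; congr (alt_diff hs _ x).
by apply/funext => y; rewrite addrAC.
Qed.

Lemma alt_monotonicD f g : alt_monotonic f -> alt_monotonic g -> alt_monotonic (fun x => f x + g x).
Proof. by move=> cf cg hs p x x0; rewrite alt_diffD addr_ge0 ?cf ?cg. Qed.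

Lemma alt_monotonicZ k f : 0 <= k -> alt_monotonic f -> alt_monotonic (fun x => k * f x).
Proof. by move=> k0 cf hs p x x0; rewrite alt_diffZ mulr_ge0 ?cf. Qed.

Lemma alt_monotonic_cst k : 0 <= k -> alt_monotonic (fun=> k).
Proof.
move=> k0 hs _ x _; case: hs => [//|h hs] /=.
rewrite (_ : (fun=> k - k) = (fun y => 0 * y)); last by apply/funext => y; rewrite subrr mul0r.
by rewrite alt_diffZ mul0r.
Qed.

Lemma alt_monotonic_shift u f : 0 <= u -> alt_monotonic f -> alt_monotonic (fun x => f (x + u)).
Proof. by move=> u0 cf hs p x x0; rewrite alt_diff_shift cf// ltr_wpDr. Qed.

Lemma alt_monotonic_diff h f : 0 < h -> alt_monotonic f -> alt_monotonic (fun x => f x - f (x + h)).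
Proof. by move=> h0 cf hs p; apply: (cf (h :: hs)); rewrite /= h0. Qed.

(** Leibniz rule for one step: the difference of f g is (f - f(. + h)) g + f(. + h) (g - g(. + h)),
    a sum of products of functions of the class, so the induction on the list runs for all [f] and
    [g]. *)
Lemma alt_monotonicM f g : alt_monotonic f -> alt_monotonic g -> alt_monotonic (fun x => f x * g x).
Proof.
move=> cf cg hs; elim: hs f g cf cg => [|h hs IH] f g cf cg /=.
  by move=> _ x x0; rewrite mulr_ge0 ?(cf [::]) ?(cg [::]).
move=> /andP[h0 p] x x0.
rewrite (_ : (fun y => _) = (fun y => (f y - f (y + h)) * g y + f (y + h) * (g y - g (y + h)))); last first.
  by apply/funext => y; ring.
rewrite alt_diffD addr_ge0//.
  by apply: IH => //; exact: alt_monotonic_diff.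
by apply: IH => //; [exact: alt_monotonic_shift (ltW h0) cf|exact: alt_monotonic_diff].
Qed.

Lemma alt_monotonic_lim (f_ : nat -> R -> R) f : (forall n, alt_monotonic (f_ n)) ->
  (forall x, 0 < x -> f_ n x @[n --> \oo] --> f x) -> alt_monotonic f.
Proof.
move=> cf cvf hs p x x0.
have : alt_diff hs (f_ n) x @[n --> \oo] --> alt_diff hs f x.
  elim: hs f_ f {cf} cvf p => [|h hs IH] f_ f cvf /=; first by move=> _; exact: cvf.
  move=> /andP[h0 p]; apply: IH => // y y0.
  by apply: cvgB; apply: cvf => //; rewrite addr_gt0.
move=> c; apply: (ler_cvg_to (cvg_cst 0) c); apply: nearW => n; exact: cf.
Qed.

(** Finite differences commute with the integral by linearity alone; integrability at each point is
    all that has to be checked. *)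
Lemma alt_monotonic_integral d (T : measurableType d) (m : {measure set T -> \bar R}) (D : set T) (f : R -> T -> R) :
  measurable D -> (forall x, 0 < x -> m.-integrable D (EFin \o f x)) ->
  (forall u, D u -> alt_monotonic (f ^~ u)) -> alt_monotonic (fun x => \int[m]_(u in D) f x u).
Proof.
move=> mD fi cf hs p x x0.
have -> : alt_diff hs (fun x => \int[m]_(u in D) f x u) x = \int[m]_(u in D) alt_diff hs (f ^~ u) x.
  elim: hs f fi {cf} p => [//|h hs IH] f fi /= /andP[h0 p].
  rewrite -(IH (fun x u => f x u - f (x + h) u))//; last first.
    by move=> y y0; apply: integrableBr => //; apply: fi => //; rewrite addr_gt0.
  apply: eq_alt_diff => // y y0; rewrite RintegralB//; apply: fi => //; exact: addr_gt0.
by apply: Rintegral_ge0 => u Du; exact: cf.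
Qed.

Lemma alt_monotonicX n f : alt_monotonic f -> alt_monotonic (fun x => f x ^+ n).
Proof.
move=> cf; elim: n => [|n IH]; first exact: alt_monotonic_cst.
apply: (eq_alt_monotonic (f := fun x => f x * f x ^+ n)); first by move=> x _; rewrite exprS.
exact: alt_monotonicM.
Qed.

(** e^z - 1 has nonnegative Taylor coefficients, and the class is closed under sums, products and
    limits. *)
Lemma alt_monotonic_expRB1 f : alt_monotonic f -> alt_monotonic (fun x => expR (f x) - 1).
Proof.
move=> cf; apply: (@alt_monotonic_lim (fun n x => \sum_(k < n) f x ^+ k.+1 / (k.+1)`!%:R)).
  elim=> [|n IH].
    by apply: (eq_alt_monotonic _ (alt_monotonic_cst (lexx 0))) => x _; rewrite big_ord0.
  apply: (eq_alt_monotonic (f := fun x => \sum_(k < n) f x ^+ k.+1 / (k.+1)`!%:R + ((n.+1)`!%:R)^-1 * f x ^+ n.+1)).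
    by move=> x _; rewrite big_ord_recr/= [X in _ + X]mulrC.
  by apply: alt_monotonicD => //; apply: alt_monotonicZ; [rewrite invr_ge0|exact: alt_monotonicX].
move=> x _.
rewrite (_ : (fun n => _) = (fun n => series (exp_coeff (f x)) n.+1 - 1)); last first.
  apply/funext => n; rewrite /series/= big_mkord big_ord_recl /exp_coeff/= expr0 fact0 divr1 [RHS]addrC addKr.
  by [].
apply: cvgB; last exact: cvg_cst.
rewrite (cvg_shiftS (series (exp_coeff (f x)))).
exact: is_cvg_series_exp_coeff.
Qed.

(* The hypothesis says that [b] has a completely monotone derivative. *)
Lemma alt_monotonic_expRN b : (forall h, 0 < h -> alt_monotonic (fun x => b (x + h) - b x)) ->
  alt_monotonic (fun x => expR (- b x)).
Proof.
move=> cb.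
(* A factor [k] is carried along: one step turns e^(- b) k into e^(- b(. + h)) k', where k' is again
   of the class, so the shape survives the induction. *)
suff H hs : all (fun h => 0 < h) hs -> forall b k, (forall h, 0 < h -> alt_monotonic (fun x => b (x + h) - b x)) ->
    alt_monotonic k -> forall x, 0 < x -> 0 <= alt_diff hs (fun x => expR (- b x) * k x) x.
  move=> hs p x x0; have := H hs p b (fun=> 1) cb (alt_monotonic_cst ler01) x x0.
  by congr (0 <= alt_diff hs _ x); apply/funext => y; rewrite mulr1.
elim: hs => [|h hs IH] /=.
  by move=> _ b' k _ ck x x0; rewrite mulr_ge0 ?expR_ge0// (ck [::]).
move=> /andP[h0 p] {cb} {}b k cb ck x x0.
pose k' x := (expR (b (x + h) - b x) - 1) * k x + (k x - k (x + h)).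
rewrite (_ : (fun y => _) = (fun y => expR (- b (y + h)) * k' y)); last first.
  apply/funext => y; rewrite /k'.
  have -> : expR (- b y) = expR (- b (y + h)) * expR (b (y + h) - b y) by rewrite -expRD addrA addNr sub0r.
  by ring.
apply: IH => //.
  move=> u u0; have := alt_monotonic_shift (ltW h0) (cb u u0).
  by apply: eq_alt_monotonic => y _; rewrite addrAC.
apply: alt_monotonicD; last exact: alt_monotonic_diff.
by apply: alt_monotonicM => //; apply: alt_monotonic_expRB1; exact: cb.
Qed.

(** f(x + h) - f(x) is the integral of g(x + v) over v in [0, h], a mixture of shifts of [g]. *)
Lemma alt_monotonic_of_derive f g : (forall x : R, 0 < x -> is_derive x 1 f (g x)) ->
  {in oy, continuous g} -> alt_monotonic g ->
  forall h, 0 < h -> alt_monotonic (fun x => f (x + h) - f x).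
Proof.
move=> df cg mg h h0.
have cgv (x v : R) : 0 < x -> 0 <= v -> {for v, continuous (fun v => g (x + v))}.
  move=> x0 v0; apply: (cvg_comp (fun v => x + v) g); first by apply: cvgD; [exact: cvg_cst|exact: cvg_id].
  by apply: cg; rewrite inE/= in_itv/= andbT ltr_wpDr.
have dfv (x v : R) : 0 < x -> 0 <= v -> is_derive v 1 (fun v => f (x + v)) (g (x + v)).
  move=> x0 v0; apply: (is_derive_eq (is_derive_fcomp (f := f) (g := fun v => x + v) (df _ _) (is_derive_fD (is_derive_fC x v) (is_derive_fid v)))).
    by rewrite ltr_wpDr.
  by rewrite add0r mulr1.
have cw (x : R) : 0 < x -> {within `[0, h], continuous (fun v => g (x + v))}.
  move=> x0; apply: continuous_in_subspaceT => v; rewrite inE/= in_itv/= => /andP[v0 _]; exact: cgv.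
have ig (x : R) : 0 < x -> mu.-integrable `[0, h] (EFin \o (fun v => g (x + v))).
  by move=> x0; apply: continuous_compact_integrable; [exact: segment_compact|exact: cw].
apply: (eq_alt_monotonic (f := fun x => \int[mu]_(v in `[0, h]) g (x + v))).
  move=> x x0; apply: EFin_inj; rewrite -EFin_Rintegral//; last exact: ig.
  rewrite (@continuous_FTC2 _ _ (fun v => f (x + v)) 0 h h0 (cw x x0)) ?addr0//.
    split.
    - by move=> v; rewrite in_itv/= => /andP[/ltW v0 _]; have [] := dfv x v x0 v0.
    - apply: cvg_at_right_filter; exact: is_derive_continuous (dfv x 0 x0 (lexx 0)).
    - apply: cvg_at_left_filter; exact: is_derive_continuous (dfv x h x0 (ltW h0)).
  move=> v; rewrite in_itv/= => /andP[/ltW v0 _]; rewrite derive1E.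
  by have [_ ->] := dfv x v x0 v0.
apply: (@alt_monotonic_integral _ _ mu _ (fun x v => g (x + v))) => //.
move=> v; rewrite /= in_itv/= => /andP[v0 _]; exact: alt_monotonic_shift.
Qed.

End alternating_differences.

Section alt_monotonic_examples.
Variable R : realType.
Local Notation mu := (@lebesgue_measure R).
Local Notation oy := (`]0%R, +oo[%classic : set R).
Local Notation moy := (@measurable_oy R).

Lemma alt_monotonic_le (f : R -> R) (x y : R) : alt_monotonic f -> 0 < x -> x <= y -> f y <= f x.
Proof.
move=> cf x0; rewrite le_eqVlt => /predU1P[->//|xy].
have h0 : 0 < y - x by rewrite subr_gt0.
by have := cf [:: y - x]; rewrite /= h0 => /(_ isT x x0); rewrite subrKC subr_ge0.
Qed.

Lemma alt_monotonic_scale (k : R) f : 0 < k -> alt_monotonic f -> alt_monotonic (fun x => f (k * x)).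
Proof.
move=> k0 cf hs p x x0.
suff -> : alt_diff hs (fun x => f (k * x)) x = alt_diff [seq k * h | h <- hs] f (k * x).
  by apply: cf; [rewrite all_map; apply: sub_all p => h h0 /=; exact: mulr_gt0|exact: mulr_gt0].
elim: hs f {cf p} x {x0} => [//|h hs IH] f x /=; rewrite -IH; congr (alt_diff hs _ x).
by apply/funext => y; rewrite mulrDr.
Qed.

Lemma alt_monotonic_expRZ (t : R) : 0 <= t -> alt_monotonic (fun x => expR (- (x * t))).
Proof.
move=> t0; apply: (@alt_monotonic_expRN R (fun x => x * t)) => h h0.
apply: (eq_alt_monotonic (f := fun=> h * t)); first by move=> x _; ring.
by apply: alt_monotonic_cst; rewrite mulr_ge0// ltW.
Qed.

(** For s > 0 a Gamma integral presents the power as a mixture of exponentials; s = 0, which serves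
    p = 2 below, is a constant. *)
Lemma alt_monotonic_powRN (s : R) : 0 <= s -> alt_monotonic (fun x : R => x `^ (- s)).
Proof.
rewrite le_eqVlt => /predU1P[<-|s0].
  by apply: (eq_alt_monotonic (f := fun=> 1)); [move=> x _; rewrite oppr0 powRr0|exact: alt_monotonic_cst].
have mf (x : R) : measurable_fun oy (fun t => t `^ (s - 1) * expR (- (x * t))) by mfun.
have fi (x : R) : 0 < x -> mu.-integrable oy (EFin \o (fun t => t `^ (s - 1) * expR (- (x * t)))).
  move=> x0; apply: (ge0_integral_eq_integrable (m := mu) (mf x) _ (integral_gamma_scale s0 x0)) => t _.
  by rewrite mulr_ge0 ?powR_ge0 ?expR_ge0.
have gs := Gamma_gt0 s0.
apply: (eq_alt_monotonic (f := fun x => (Gamma s)^-1 * \int[mu]_(t in oy) (t `^ (s - 1) * expR (- (x * t))))).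
  move=> x x0; apply: (mulfI (lt0r_neq0 gs)); rewrite mulVKf ?gt_eqF//.
  by apply: EFin_inj; rewrite -(EFin_Rintegral moy (fi x x0)) integral_gamma_scale.
apply: alt_monotonicZ; first by rewrite invr_ge0 ltW.
apply: (@alt_monotonic_integral _ _ _ mu oy (fun x t => t `^ (s - 1) * expR (- (x * t)))) => //.
move=> t; rewrite /= in_itv/= andbT => t0; apply: (alt_monotonicZ (f := fun x => expR (- (x * t)))); first exact: powR_ge0.
by apply: alt_monotonic_expRZ; exact: ltW.
Qed.

Lemma alt_monotonic_addV (l : R) : 0 <= l -> alt_monotonic (fun x : R => (x + l)^-1).
Proof.
move=> l0; have := alt_monotonic_shift l0 (alt_monotonic_powRN (@ler01 R)).
by apply: eq_alt_monotonic => x x0; rewrite powR_inv1// addr_ge0// ltW.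
Qed.

(** x^(p - 2) is of the class because p <= 2. One integration shows that the increments of x^(p - 1)
    are too, a second one that the second differences of x^p are; these are the increments of the
    exponent, as [alt_monotonic_expRN] asks. *)
Lemma alt_monotonic_exp_gap (p u : R) : 1 < p <= 2 -> 0 < u ->
  alt_monotonic (fun x => expR (- ((x + u) `^ p - x `^ p))).
Proof.
move=> /andP[p1 p2] u0; have p0 : 0 < p by apply: lt_trans p1.
have p10 : 0 < p - 1 by rewrite subr_gt0.
have dpow (q x h : R) : 0 < x -> 0 <= h -> is_derive x 1 (fun x => (x + h) `^ q) (q * (x + h) `^ (q - 1)).
  move=> x0 h0; have xh : 0 < x + h by rewrite ltr_wpDr.
  apply: (is_derive_eq (is_derive_fcomp (f := fun z => z `^ q) (g := fun x => x + h)
    (is_derive_fpowR q xh) (is_derive_fD (is_derive_fid x) (is_derive_fC h x)))).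
  by rewrite addr0 mulr1.
have cpow (q x h : R) : 0 < x -> 0 <= h -> {for x, continuous (fun x => (x + h) `^ q)}.
  by move=> x0 h0; exact: is_derive_continuous (dpow q x h x0 h0).
have dpow0 (q x : R) : 0 < x -> is_derive x 1 (fun x => x `^ q) (q * x `^ (q - 1)) by exact: is_derive_fpowR.
have am1 h : 0 < h -> alt_monotonic (fun x => (x + h) `^ (p - 1) - x `^ (p - 1)).
  apply: (alt_monotonic_of_derive (f := fun x => x `^ (p - 1)) (dpow0 (p - 1))).
    move=> x; rewrite inE/= in_itv/= andbT => x0; apply: cvgM; first exact: cvg_cst.
    exact: continuous_powR.
  apply: alt_monotonicZ; first exact: ltW.
  have := @alt_monotonic_powRN (2 - p); rewrite subr_ge0 => /(_ p2).
  by apply: eq_alt_monotonic => x _; congr (_ `^ _); ring.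
apply: (@alt_monotonic_expRN R (fun x => (x + u) `^ p - x `^ p)) => h h0.
(* The second difference of x^p is symmetric in [u] and [h]: it is read as the increment by [u] of
   (x + h)^p - x^p, whose derivative is controlled by [am1]. *)
have dg (x : R) : 0 < x -> is_derive x 1 (fun x => (x + h) `^ p - x `^ p) (p * ((x + h) `^ (p - 1) - x `^ (p - 1))).
  move=> x0; apply: (is_derive_eq (is_derive_fB (dpow p x h x0 (ltW h0)) (dpow0 p x x0))).
  by rewrite mulrBr.
have := alt_monotonic_of_derive dg _ (alt_monotonicZ (ltW p0) (am1 h h0)).
move=> /(_ _ u u0) H; apply: (eq_alt_monotonic _ (H _)).
  by move=> x x0; rewrite [x + u + h]addrAC; ring.
move=> x; rewrite inE/= in_itv/= andbT => x0; apply: cvgM; first exact: cvg_cst.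
by apply: cvgB; [apply: cpow => //; exact: ltW|exact: continuous_powR].
Qed.

(** For p < 2, [stieltjes_quotient] gives a mixture of the functions 1 / (l + y) with positive
    weights. At p = 2 the cosine vanishes and the quotient is the constant 1. *)
Lemma alt_monotonic_quotient (p : R) : 1 < p <= 2 ->
  alt_monotonic (fun y : R => (y `^ p + 1) / (y ^+ 2 - 2 * y * cos (pi / p) + 1)).
Proof.
rewrite le_eqVlt => /andP[p1 /predU1P[->|p2]].
  apply: (eq_alt_monotonic (f := fun=> 1)) (alt_monotonic_cst ler01) => y y0.
  rewrite cos_pihalf mulr0 subr0 powR_mulrn ?(ltW y0)// divff//.
  by rewrite gt_eqF// ltr_wpDl ?sqr_ge0.
have p12 : 1 < p < 2 by rewrite p1.
have p0 : 0 < p by apply: lt_trans p1.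
have a01 : 0 < p - 1 < 1 by apply/andP; split; lra.
have sp := sinpiM_gt0 a01.
have st : 0 < sin (pi / p).
  by apply: sin_gt0_pi; rewrite divr_gt0 ?pi_gt0//= ltr_pdivrMr// ltr_pMr// pi_gt0.
apply: (eq_alt_monotonic (f := fun y => sin ((p - 1) * pi) / pi *
    \int[mu]_(l in oy) (l `^ p / (l ^+ 2 + 2 * l * cos (pi / p) + 1) / (l + y)))).
  move=> y y0; have [_ ->] := stieltjes_quotient p12 y0.
  rewrite mulrA (_ : _ / pi * _ = 1) ?mul1r//.
  by rewrite mulrA divfK ?divff// gt_eqF// pi_gt0.
apply: alt_monotonicZ; first by rewrite divr_ge0 ?pi_ge0// ltW.
apply: (@alt_monotonic_integral _ _ _ mu oy (fun y l => l `^ p / (l ^+ 2 + 2 * l * cos (pi / p) + 1) / (l + y))).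
- exact: moy.
- by move=> y y0; have [] := stieltjes_quotient p12 y0.
move=> l; rewrite /= in_itv/= andbT => l0; apply: (alt_monotonicZ (f := fun y => (l + y)^-1)).
  rewrite divr_ge0 ?powR_ge0//.
  have -> : l ^+ 2 + 2 * l * cos (pi / p) + 1 = (l + cos (pi / p)) ^+ 2 + sin (pi / p) ^+ 2 by rewrite sin2cos2; ring.
  by rewrite addr_ge0 ?sqr_ge0.
have := alt_monotonic_addV (ltW l0).
by apply: eq_alt_monotonic => y _; rewrite addrC.
Qed.

End alt_monotonic_examples.

(** Functions of the class are nonincreasing; [Num.max v 0] extends the shifted one monotonically to
    the whole line. *)
Lemma alt_monotonic_measurable (R : realType) (f : R -> R) (y : R) : 0 < y -> alt_monotonic f ->
  measurable_fun (`]0%R, +oo[%classic : set R) (fun v => f (y + v)).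
Proof.
move=> y0 cf.
refine (@eq_measurable_fun _ _ (measurableTypeR R) (measurableTypeR R) _ (fun v => f (y + Num.max v 0)) _ _ _).
  by move=> v; rewrite inE/= in_itv/= andbT => v0; rewrite max_l// ltW.
apply: nonincreasing_measurable; first exact: measurable_oy.
move=> v1 v2 v12; apply: alt_monotonic_le; first exact: cf.
  by rewrite ltr_wpDr// le_max lexx orbT.
by rewrite lerD2l ge_max le_max v12/= le_max lexx orbT.
Qed.

(** * Complete monotonicity of F *)

Section alt_monotonic_poisson_exp.
Variables (R : realType) (p : R).
Hypothesis p12 : 1 < p <= 2.
Local Notation mu := (@lebesgue_measure R).
Local Notation oy := (`]0%R, +oo[%classic : set R).
Local Notation moy := (@measurable_oy R).

Let p0 : 0 < p. Proof. by case/andP: p12 => h _; apply: lt_trans h. Qed.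
Let th : R := pi / p.
Let th0 : 0 < th < pi.
Proof.
by case/andP: p12 => p1 _; rewrite divr_gt0 ?pi_gt0//= ltr_pdivrMr// ltr_pMr// pi_gt0.
Qed.
Let P (u : R) := poisson 1 th u.
Let P0 u : 0 <= P u. Proof. exact: poisson_ge0. Qed.
Let mP : measurable_fun [set: R] P. Proof. exact: measurable_poisson. Qed.
(** With u^p in place of 1 + u^p, the scaling in [S_kappa] would produce the numerator 1 instead of
    y^p + 1, and the poles e^(i pi / p) and e^(- i pi / p) would remain. *)
Let w (s u : R) := P u * ((1 + u `^ p) * expR (- (s `^ p * u `^ p))).
Let S (s : R) := p * s `^ (p - 1) * \int[mu]_(u in oy) w s u.

Let w0 s u : 0 <= w s u.
Proof.
by apply: mulr_ge0; [exact: P0|rewrite mulr_ge0 ?addr_ge0 ?powR_ge0 ?expR_ge0].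
Qed.

Let mw s : measurable_fun oy (w s).
Proof. by apply: measurable_funM; [exact: measurable_funTS mP|mfun]. Qed.

Let iw s : 0 < s -> mu.-integrable oy (EFin \o w s).
Proof.
move=> s0; have sp0 : 0 < s `^ p by rewrite powR_gt0.
(* The inequality x e^(- x) <= 1 at x = s^p u^p bounds the part with u^p by s^(- p) times the
   kernel. *)
apply: (integrable_dom (m := mu) moy (g := fun u => (1 + (s `^ p)^-1) * P u)); first exact: mw.
  move=> u _; rewrite ger0_norm// /w mulrC; apply: ler_wpM2r; first exact: P0.
  rewrite mulrDl mul1r; apply: lerD.
    by rewrite -expR0 ler_expR oppr_le0 mulr_ge0 ?powR_ge0.
  rewrite expRN ler_pdivrMr ?expR_gt0// ler_pdivlMl//.
  by apply: le_trans (expR_ge1Dx _); rewrite lerDr.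
by apply: integrableZ; [exact: moy|exact: integrable_poisson ltr01 th0].
Qed.

Let kappa (y : R) := (y `^ p + 1) / (y ^+ 2 - 2 * y * cos th + 1).

Let k0 y : 0 <= kappa y.
Proof.
apply: divr_ge0; first by rewrite addr_ge0 ?powR_ge0.
have -> : y ^+ 2 - 2 * y * cos th + 1 = (y - cos th) ^+ 2 + sin th ^+ 2 by rewrite sin2cos2; ring.
by rewrite addr_ge0 ?sqr_ge0.
Qed.

(** The scaling u = x / s frees the exponential of [s], which is left only inside kappa (s / x): a
    mixture of rescaled copies of [kappa]. *)
Let S_kappa s : 0 < s ->
  mu.-integrable oy (EFin \o (fun x => sin th * x `^ (p - 2) * expR (- x `^ p) * kappa (x^-1 * s))) /\
  p * \int[mu]_(x in oy) (sin th * x `^ (p - 2) * expR (- x `^ p) * kappa (x^-1 * s)) = S s.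
Proof.
move=> s0; have si0 : 0 < s^-1 by rewrite invr_gt0.
have st : 0 < sin th by exact: sin_gt0_pi.
have sp0 : 0 < s `^ (p - 1) by rewrite powR_gt0.
set f : R -> R := fun x => sin th * x `^ (p - 2) * expR (- x `^ p) * kappa (x^-1 * s).
have f0 x : oy x -> 0 <= f x.
  move=> _; apply: mulr_ge0; last exact: k0.
  by rewrite !mulr_ge0 ?powR_ge0 ?expR_ge0 ?(ltW st).
have mf : measurable_fun oy f by rewrite /f /kappa; mfun.
have E : (\int[mu]_(x in oy) (f x)%:E)%E = (s `^ (p - 1) * \int[mu]_(u in oy) w s u)%:E.
  rewrite EFinM -(EFin_Rintegral moy (iw s0)) (ge0_subst_scale (G := w s) si0); first last.
  - by move=> u _; exact: w0.
  - move=> u; rewrite inE/= in_itv/= andbT => u0.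
    have cp : {for u, continuous (fun u : R => u `^ p)} by exact: continuous_powR.
    apply: cvgM.
      apply: cvgM; first exact: cvg_cst.
      apply: cvgV; first by rewrite gt_eqF// poisson_den_gt0.
      apply: cvgD; last exact: cvg_cst.
      apply: cvgB; first by apply: cvgM; exact: cvg_id.
      by apply: cvgM; [apply: cvgM; [apply: cvgM; [exact: cvg_cst|exact: cvg_id]|exact: cvg_cst]|exact: cvg_cst].
    apply: cvgM; first by apply: cvgD => //; exact: cvg_cst.
    apply: (cvg_comp _ expR); last exact: continuous_expR.
    by apply: cvgN; apply: cvgM => //; exact: cvg_cst.
  rewrite -ge0_integralZl_fin//; first last.
  - exact: ltW.
  - by move=> x _; rewrite mulr_ge0// ltW.
  - by rewrite /w /P /poisson; mfun.
  apply: eq_integral => x; rewrite inE/= in_itv/= andbT => x0; congr EFin.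
  rewrite /f /kappa /w /P /poisson.
  have xp : 0 < x `^ p by rewrite powR_gt0.
  have tp : 0 < s `^ p by rewrite powR_gt0.
  have -> : (s^-1 * x) `^ p = x `^ p / s `^ p.
    by rewrite powRM ?(ltW si0) ?(ltW x0)// -(powR_inv1 (ltW s0)) powRAC powR_inv1 ?powR_ge0// mulrC.
  have -> : (x^-1 * s) `^ p = s `^ p / x `^ p.
    by rewrite powRM ?invr_ge0 ?(ltW s0) ?(ltW x0)// -(powR_inv1 (ltW x0)) powRAC powR_inv1 ?powR_ge0// mulrC.
  have -> : s `^ p * (x `^ p / s `^ p) = x `^ p by rewrite mulrC divfK// gt_eqF.
  have -> : x `^ (p - 2) = x `^ p / x ^+ 2.
    by rewrite -powR_mulrn ?(ltW x0)// -powRB// (gt_eqF x0) implybT.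
  have -> : s `^ (p - 1) = s `^ p / s.
    by rewrite powRB ?(gt_eqF s0) ?implybT// powRr1// ltW.
  have d1 : 0 < (s^-1 * x) ^+ 2 - 2 * (s^-1 * x) * 1 * cos th + 1 ^+ 2.
    by apply: poisson_den_gt0.
  have d2 : (x^-1 * s) ^+ 2 - 2 * (x^-1 * s) * cos th + 1 = ((s^-1 * x) ^+ 2 - 2 * (s^-1 * x) * 1 * cos th + 1 ^+ 2) * (s / x) ^+ 2.
    by field; rewrite !gt_eqF.
  rewrite d2; move: d1; set d := _ + _ ^+ 2 => d1.
  by field; rewrite !gt_eqF.
have i : mu.-integrable oy (EFin \o f) by apply: (ge0_integral_eq_integrable (m := mu) mf f0 E).
split => //; rewrite /S -mulrA; congr (_ * _).
by apply: EFin_inj; rewrite -(EFin_Rintegral moy i).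
Qed.

Let cS : alt_monotonic S.
Proof.
apply: (eq_alt_monotonic (f := fun s => p * \int[mu]_(x in oy) (sin th * x `^ (p - 2) * expR (- x `^ p) * kappa (x^-1 * s)))).
  by move=> s s0; have [] := S_kappa s0.
apply: alt_monotonicZ; first exact: ltW.
apply: (@alt_monotonic_integral _ _ _ mu oy (fun s x => sin th * x `^ (p - 2) * expR (- x `^ p) * kappa (x^-1 * s))).
- exact: moy.
- by move=> s s0; have [] := S_kappa s0.
move=> x; rewrite /= in_itv/= andbT => x0.
apply: (alt_monotonicZ (f := fun s => kappa (x^-1 * s))).
  by rewrite !mulr_ge0 ?powR_ge0 ?expR_ge0// ltW// sin_gt0_pi.
by apply: alt_monotonic_scale; [rewrite invr_gt0|exact: alt_monotonic_quotient].
Qed.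

(** The integrand is the derivative in [v] of - e^(- k (y + v)^p); it is used with k = 1 + u^p. *)
Let integral_tail_exp (y k : R) : 0 < y -> 0 < k ->
  (\int[mu]_(v in oy) (p * (y + v) `^ (p - 1) * (k * expR (- (k * (y + v) `^ p))))%:E)%E = (expR (- (k * y `^ p)))%:E.
Proof.
move=> y0 kk0.
rewrite integral_itv_obnd_cbnd; last by apply/measurable_EFinP; mfun.
pose F (v : R) := - expR (- (k * (y + v) `^ p)).
have dF (v : R) : 0 <= v -> is_derive v 1 F (p * (y + v) `^ (p - 1) * (k * expR (- (k * (y + v) `^ p)))).
  move=> v0; have yv : 0 < y + v by rewrite ltr_wpDr.
  have d1 := is_derive_fD (is_derive_fC y v) (is_derive_fid v).
  have d2 := is_derive_fcomp (f := fun z => z `^ p) (g := fun v => y + v) (is_derive_fpowR p yv) d1.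
  have d3 := is_derive_fN (is_derive_fZ k d2).
  have d4 := is_derive_fcomp (f := expR) (g := fun v => - (k * (y + v) `^ p)) (is_derive_expR _) d3.
  by apply: (is_derive_eq (is_derive_fN d4)); ring.
have cp (q v : R) : 0 <= v -> {for v, continuous (fun v : R => (y + v) `^ q)}.
  move=> v0; have yv : 0 < y + v by rewrite ltr_wpDr.
  have d1 := is_derive_fD (is_derive_fC y v) (is_derive_fid v).
  exact: is_derive_continuous (is_derive_fcomp (f := fun z => z `^ q) (g := fun v => y + v) (is_derive_fpowR q yv) d1).
rewrite (@ge0_continuous_FTC2y _ _ F 0 0).
- by rewrite /F addr0 -EFinB sub0r opprK.
- by move=> v _; rewrite !mulr_ge0 ?powR_ge0 ?expR_ge0// ltW.
- apply: continuous_in_subspaceT => v; rewrite inE/= in_itv/= andbT => v0.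
  apply: cvgM; first by apply: cvgM; [exact: cvg_cst|exact: cp].
  apply: cvgM; first exact: cvg_cst.
  apply: (cvg_comp (fun v => - (k * (y + v) `^ p)) expR); last exact: continuous_expR.
  by apply: cvgN; apply: cvgM; [exact: cvg_cst|exact: cp].
- rewrite -[X in _ --> X]oppr0; apply: cvgN.
  apply: (cvg_comp (fun v => k * (y + v) `^ p) (fun x => expR (- x))); last exact: cvgr_expR.
  apply/cvgryPge => A; near=> v.
  have v1 : 1 <= y + v.
    by rewrite ler_wpDl ?(ltW y0)//; near: v; exact: nbhs_pinfty_ge.
  have : A <= k * v.
    by rewrite mulrC -ler_pdivrMr//; near: v; apply: nbhs_pinfty_ge; rewrite num_real.
  move=> /le_trans; apply; rewrite ler_pM2l//.
  apply: (@le_trans _ _ (y + v)); first by rewrite lerDr ltW.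
  by apply: le1r_powR => //; case/andP: p12 => /ltW.
- by move=> v /ltW/dF[].
- by apply: cvg_at_right_filter; apply: (is_derive_continuous (dF 0 _)).
- by move=> v; rewrite in_itv/= andbT => /ltW v0; rewrite derive1E; have [_ ->] := dF v v0.
Unshelve. all: by end_near. Qed.

(** Tonelli in [v] and [u], then [integral_tail_exp]: the product of e^(y^p) and e^(- (1 + u^p) y^p)
    is e^(- u^p y^p). *)
Let poisson_exp_tail y : 0 < y ->
  mu.-integrable oy (EFin \o (fun v => expR (- ((y + v) `^ p - y `^ p)) * S (y + v))) /\
  \int[mu]_(v in oy) (expR (- ((y + v) `^ p - y `^ p)) * S (y + v)) = poisson_exp th p (y `^ p).
Proof.
move=> y0.
have mS : measurable_fun oy (fun v => S (y + v)) by exact: alt_monotonic_measurable cS.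
have S0 v : 0 < v -> 0 <= S v by move=> v0; exact: (cS (hs := [::])).
have mE : measurable_fun oy (fun v => expR (- ((y + v) `^ p - y `^ p))) by mfun.
have m := measurable_funM mE mS.
have ge v : oy v -> 0 <= expR (- ((y + v) `^ p - y `^ p)) * S (y + v).
  by rewrite /= in_itv/= andbT => v0; rewrite mulr_ge0 ?expR_ge0 ?S0// addr_gt0.
have E : (\int[mu]_(v in oy) (expR (- ((y + v) `^ p - y `^ p)) * S (y + v))%:E)%E = (poisson_exp th p (y `^ p))%:E.
  pose f (v u : R) := expR (- ((y + v) `^ p - y `^ p)) * (p * (y + v) `^ (p - 1) * w (y + v) u).
  transitivity (\int[mu]_(v in oy) \int[mu]_(u in oy) (f v u)%:E)%E.
    apply: eq_integral => v; rewrite inE/= in_itv/= andbT => v0.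
    have yv : 0 < y + v by rewrite addr_gt0.
    rewrite /f /S EFinM (EFinM (p * _)) -(EFin_Rintegral moy (iw yv)).
    rewrite -ge0_integralZl_fin//; first last.
    - by rewrite mulr_ge0 ?powR_ge0// ltW.
    - exact: mw.
    rewrite -ge0_integralZl_fin//; first last.
    - by move=> u _; rewrite mulr_ge0 ?w0// mulr_ge0 ?powR_ge0// ltW.
    - by apply: measurable_funM => //; exact: mw.
  rewrite (@tonelli_on _ _ _ _ R mu mu oy oy _ moy moy); first last.
  - by move=> v u _ _; rewrite /f mulr_ge0 ?expR_ge0// mulr_ge0 ?w0// mulr_ge0 ?powR_ge0// ltW.
  - rewrite /f /w; apply: measurable_funM; first by mfun.
    apply: measurable_funM; first by mfun.
    apply: measurable_funM; last by mfun.
    exact: measurableT_comp mP measurable_snd.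
  rewrite -(EFin_Rintegral moy (integrable_poisson_exp p th0 (powR_ge0 y p))).
  apply: eq_integral => u; rewrite inE/= in_itv/= andbT => u0.
  have ku : 0 < 1 + u `^ p by rewrite ltr_wpDr ?powR_ge0.
  transitivity (\int[mu]_(v in oy) ((P u * expR (y `^ p)) * (p * (y + v) `^ (p - 1) * ((1 + u `^ p) * expR (- ((1 + u `^ p) * (y + v) `^ p)))))%:E)%E.
    apply: eq_integral => v _; congr EFin; rewrite /f /w.
    rewrite (_ : - ((y + v) `^ p - y `^ p) = y `^ p + - (y + v) `^ p); last by ring.
    rewrite (_ : - ((1 + u `^ p) * (y + v) `^ p) = - (y + v) `^ p + - ((y + v) `^ p * u `^ p)); last by ring.
    by rewrite !expRD; ring.
  rewrite ge0_integralZl_fin//; first last.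
  - by apply: mulr_ge0; [exact: P0|exact: expR_ge0].
  - by move=> v _; rewrite mulr_ge0 ?mulr_ge0 ?powR_ge0 ?expR_ge0 ?(ltW ku) ?(ltW p0).
  - by mfun.
  rewrite (integral_tail_exp y0 ku) -EFinM -mulrA -expRD; congr ((_ * expR _)%:E); ring.
have i := ge0_integral_eq_integrable (m := mu) m ge E.
split => //; by apply: EFin_inj; rewrite -(EFin_Rintegral moy i).
Qed.

(* Integrating [- d/dv (e^(-(y+v)^p (1+u^p)))] over [v > 0] writes [e^(-y^p) * poisson_exp] as an integral of [e^(-(y+v)^p) S (y+v)], and [S] is a mixture of rescaled copies of the Stieltjes function of [stieltjes_quotient]. *)
Lemma alt_monotonic_poisson_exp : alt_monotonic (fun y => poisson_exp (pi / p) p (y `^ p)).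
Proof.
apply: (eq_alt_monotonic (f := fun y => \int[mu]_(v in oy) (expR (- ((y + v) `^ p - y `^ p)) * S (y + v)))).
  by move=> y y0; have [] := poisson_exp_tail y0.
apply: (@alt_monotonic_integral _ _ _ mu oy (fun y v => expR (- ((y + v) `^ p - y `^ p)) * S (y + v))).
- exact: moy.
- by move=> y y0; have [] := poisson_exp_tail y0.
move=> v; rewrite /= in_itv/= andbT => v0.
apply: (alt_monotonicM (alt_monotonic_exp_gap p12 v0)).
exact: alt_monotonic_shift (ltW v0) cS.
Qed.

End alt_monotonic_poisson_exp.

(** * Averages against the Beta law and smoothness *)

Section beta_average.
Variable R : realType.
Local Notation mu := (@lebesgue_measure R).
Local Notation oy := (`]0%R, +oo[%classic : set R).
Local Notation moy := (@measurable_oy R).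
Local Notation uu := (`]0%R, 1%R[%classic : set R).

Let muu : measurable (uu : set (measurableTypeR R)). Proof. exact: measurable_itv. Qed.

(** Through t = x / (1 + x) the decreasing map t -> 1 - t becomes x -> 1 / x on the half-line, where
    [ge0_subst_inv] applies. *)
Lemma ge0_subst_onem (G : R -> R) :
  {in uu, continuous G} -> (forall t, 0 < t < 1 -> 0 <= G t) ->
  (\int[mu]_(t in uu) (G t)%:E = \int[mu]_(t in uu) (G (1 - t))%:E)%E.
Proof.
move=> cG G0; rewrite (ge0_subst_frac ltr01 cG G0).
have uf (x : R) : 0 < x -> 0 < 1 * (x / (1 + x)) < 1.
  move=> x0; have x1 : 0 < 1 + x by rewrite addr_gt0.
  by rewrite mul1r divr_gt0//= ltr_pdivrMr// mul1r ltrDr.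
rewrite [RHS](@ge0_subst_frac _ 1 (fun t => G (1 - t)) ltr01); first last.
- by move=> t /andP[t0 t1]; apply: G0; apply/andP; split; lra.
- move=> t; rewrite inE/= in_itv/= => /andP[t0 t1].
  apply: (cvg_comp (fun t : R => 1 - t) G); first by apply: cvgB; [exact: cvg_cst|exact: cvg_id].
  by apply: cG; rewrite inE/= in_itv/=; apply/andP; split; lra.
rewrite ge0_subst_inv; first last.
- by move=> x x0; apply: mulr_ge0; [apply: G0; exact: uf|rewrite mul1r invr_ge0 sqr_ge0].
- move=> x; rewrite inE/= in_itv/= andbT => x0.
  have x1 : 1 + x != 0 by rewrite gt_eqF// addr_gt0.
  have c1 : {for x, continuous (fun x : R => 1 + x)}.
    by apply: cvgD; [exact: cvg_cst|exact: cvg_id].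
  apply: cvgM.
    apply: (cvg_comp (fun x : R => 1 * (x / (1 + x))) G); last by apply: cG; rewrite inE/= in_itv/= uf.
    apply: cvgM; first exact: cvg_cst.
    by apply: cvgM; [exact: cvg_id|exact: cvgV].
  apply: cvgM; first exact: cvg_cst.
  by apply: cvgV; [exact: expf_neq0|exact: cvgM].
apply: eq_integral => x; rewrite inE/= in_itv/= andbT => x0; congr EFin.
have E1 : 1 * (x^-1 / (1 + x^-1)) = 1 - 1 * (x / (1 + x)).
  by field; rewrite !gt_eqF// ?addr_gt0.
by rewrite E1 -mulrA; congr (_ * _); field; rewrite !gt_eqF// ?addr_gt0.
Qed.

Lemma incomplete_gammaE (u x : R) : 0 < u -> 0 < x ->
  (\int[mu]_(t in `]0%R, x[) (t `^ (u - 1) * expR (- t))%:E)%E = (incomplete_gamma u x)%:E.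
Proof.
move=> u0 x0; rewrite integral_itv_bndo_bndc; last by apply/measurable_EFinP; mfun.
rewrite EFin_Rintegral//; last first.
  apply: (integrableS moy) (integrable_gamma u0) => //.
  by move=> t; rewrite /= !in_itv/= andbT => /andP[].
Qed.

(** Reflecting t to 1 - t and scaling by [x] leaves e^x times an incomplete Gamma integral: the
    source of the explicit term of [ML_remainder]. *)
Lemma integral_beta_expR (u x : R) : 0 < u -> 0 < x ->
  (\int[mu]_(t in uu) (u * (1 - t) `^ (u - 1) * expR (x * t))%:E)%E =
  (u * expR x * x `^ (- u) * incomplete_gamma u x)%:E.
Proof.
move=> u0 x0.
rewrite (ge0_subst_onem (G := fun t => u * (1 - t) `^ (u - 1) * expR (x * t))); first last.
- by move=> t _; rewrite !mulr_ge0 ?powR_ge0 ?expR_ge0// ltW.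
- move=> t; rewrite inE/= in_itv/= => /andP[t0 t1]; apply: cvgM.
    apply: cvgM; first exact: cvg_cst.
    apply: (cvg_comp (fun t : R => 1 - t) (fun z => z `^ (u - 1))).
      by apply: cvgB; [exact: cvg_cst|exact: cvg_id].
    by apply: continuous_powR; rewrite subr_gt0.
  apply: (cvg_comp (fun t : R => x * t) expR); last exact: continuous_expR.
  by apply: cvgM; [exact: cvg_cst|exact: cvg_id].
have cg (c : R) : 0 < c -> {for c, continuous (fun t : R => t `^ (u - 1))} by move=> c0; exact: continuous_powR.
rewrite EFinM -incomplete_gammaE// (ge0_subst_frac x0); first last.
- by move=> t _; rewrite mulr_ge0 ?powR_ge0 ?expR_ge0.
- move=> t; rewrite inE/= in_itv/= => /andP[t0 _]; apply: cvgM; first exact: cg.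
  apply: (cvg_comp (fun t : R => - t) expR); last exact: continuous_expR.
  by apply: cvgN; exact: cvg_id.
rewrite (@ge0_subst_frac _ 1 (fun t => u * (1 - (1 - t)) `^ (u - 1) * expR (x * (1 - t))) ltr01); first last.
- by move=> t _; rewrite !mulr_ge0 ?powR_ge0 ?expR_ge0// ltW.
- move=> t; rewrite inE/= in_itv/= => /andP[t0 t1].
  rewrite (_ : (fun t => _) = (fun t => u * t `^ (u - 1) * (expR x * expR (- (x * t))))); last first.
    apply/funext => y; rewrite -expRD; congr (_ * _ `^ _ * expR _); ring.
  apply: cvgM; first by apply: cvgM; [exact: cvg_cst|exact: cg].
  by apply: cvgM; [exact: cvg_cst|exact: continuous_expRN].
rewrite -ge0_integralZl_fin//; first last.
- by rewrite !mulr_ge0 ?powR_ge0 ?expR_ge0// ltW.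
- move=> t; rewrite /= in_itv/= andbT => t0.
  apply: mulr_ge0; first by rewrite mulr_ge0 ?powR_ge0 ?expR_ge0.
  by rewrite mulr_ge0 ?(ltW x0)// invr_ge0 sqr_ge0.
- by mfun.
apply: eq_integral => y; rewrite inE/= in_itv/= andbT => y0; congr EFin.
have y1 : 0 < 1 + y by rewrite addr_gt0.
have z0 : 0 < y / (1 + y) by rewrite divr_gt0.
have -> : 1 - (1 - 1 * (y / (1 + y))) = y / (1 + y) by ring.
have -> : x * (1 - 1 * (y / (1 + y))) = x - x * (y / (1 + y)) by ring.
rewrite expRD mul1r (powRM _ (ltW x0) (ltW z0)) powRN.
have xE : x `^ u = x * x `^ (u - 1) by rewrite mulr_powRB1// ltW.
have x10 : 0 < x `^ (u - 1) by rewrite powR_gt0.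
by rewrite xE; field; rewrite !gt_eqF.
Qed.

(** In each coefficient the Beta integral of t^(a n) trades Gamma (1 + a n) for Gamma (1 + u + a n),
    up to the common factor u Gamma u = Gamma (1 + u). *)
Lemma beta_average_mittag_leffler (a u x : R) : 0 < a -> 0 < u ->
  mu.-integrable uu (EFin \o (fun t => u * (1 - t) `^ (u - 1) * mittag_leffler a 1 (x * t `^ a))) /\
  \int[mu]_(t in uu) (u * (1 - t) `^ (u - 1) * mittag_leffler a 1 (x * t `^ a)) =
  Gamma (1 + u) * mittag_leffler a (1 + u) x.
Proof.
move=> a0 u0.
have u1 : 0 < 1 + u by rewrite addr_gt0.
pose g n (t : R) := (1 - t) `^ (u - 1) * t `^ (1 + a * n%:R - 1).
pose f n (t : R) := u * (1 - t) `^ (u - 1) * ((x * t `^ a) ^+ n / Gamma (1 + a * n%:R)).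
have v0 n : 0 < 1 + a * n%:R by rewrite ltr_wpDr ?mulr_ge0// ltW.
have w0 n : 0 < 1 + u + a * n%:R by rewrite ltr_wpDr ?mulr_ge0// ltW.
have fE n t : 0 < t -> f n t = u * x ^+ n / Gamma (1 + a * n%:R) * g n t.
  move=> t0; rewrite /f /g addrAC subrr add0r exprMn powRrM powR_mulrn ?powR_ge0//; ring.
have mf n : measurable_fun uu (f n) by rewrite /f; mfun.
have mg n : measurable_fun uu (g n) by rewrite /g; mfun.
have g0 n t : 0 <= g n t by rewrite mulr_ge0 ?powR_ge0.
have ig n : (\int[mu]_(t in uu) (g n t)%:E)%E = (Gamma (1 + a * n%:R) * Gamma u / Gamma (1 + u + a * n%:R))%:E.
  by rewrite (integral_beta (v0 n) u0) (addrAC 1 u).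
have iG n : mu.-integrable uu (EFin \o g n).
  by apply: (ge0_integral_eq_integrable (m := mu) (mg n) _ (ig n)) => t _; exact: g0.
have eG n (k : R) : k / Gamma (1 + a * n%:R) * (Gamma (1 + a * n%:R) * Gamma u / Gamma (1 + u + a * n%:R)) = Gamma u * (k / Gamma (1 + u + a * n%:R)).
  by have := Gamma_gt0 (v0 n); have := Gamma_gt0 (w0 n); set G1 := Gamma _ => ?; set G2 := Gamma _ => ?; field; rewrite !gt_eqF.
have c z := @cvg_mittag_leffler _ a (1 + u) z a0 (ltW (ltr_pwDr u0 (lexx 1))).
have [||i1 i2] := @cvg_Rintegral_series _ _ R mu uu muu f
  (fun t => u * (1 - t) `^ (u - 1) * mittag_leffler a 1 (x * t `^ a)) mf.
- move=> t _; have := @cvg_mittag_leffler _ a 1 (x * t `^ a) a0 (lexx 1).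
  rewrite /f => h; rewrite (_ : series _ = fun n => u * (1 - t) `^ (u - 1) * series (fun n => (x * t `^ a) ^+ n / Gamma (1 + a * n%:R)) n).
    by apply: cvgM => //; exact: cvg_cst.
  by apply/funext => n; rewrite /series/= mulr_sumr.
- pose v n := u * Gamma u * (`|x| ^+ n / Gamma (1 + u + a * n%:R)).
  have vE n : (v n)%:E = (\int[mu]_(t in uu) (u * `|x| ^+ n / Gamma (1 + a * n%:R) * g n t)%:E)%E.
    rewrite ge0_integralZl_fin//; last 1 first.
    + by rewrite divr_ge0 ?mulr_ge0 ?exprn_ge0 ?(ltW u0)// ltW// Gamma_gt0.
    + by rewrite ig -EFinM eG /v; congr EFin; ring.
    exact: mg.
  apply: (@le_lt_trans _ _ (\sum_(0 <= n <oo) (v n)%:E)%E).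
    apply: lee_nneseries => [n *|n *]; first by apply: integral_ge0 => t _; rewrite lee_fin.
    rewrite vE; apply: ge0_le_integral => //.
    + by apply/measurable_EFinP; apply: measurableT_comp => //; exact: mf.
    + by apply/measurable_EFinP; apply: measurable_funM; [exact: measurable_cst|exact: mg].
    + move=> t; rewrite /= in_itv/= => /andP[t0 _]; rewrite lee_fin fE// normrM (ger0_norm (g0 n t)).
      apply: ler_wpM2r => //; rewrite !normrM normfV (gtr0_norm (Gamma_gt0 (v0 n))) (gtr0_norm u0).
      by rewrite normrX.
  apply: (@nneseries_lty _ _ v) => //.
    by move=> n; rewrite /v !mulr_ge0 ?exprn_ge0 ?invr_ge0 ?(ltW u0)// ltW// Gamma_gt0.
  rewrite (_ : series v = fun n => u * Gamma u * series (fun n => `|x| ^+ n / Gamma (1 + u + a * n%:R)) n).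
    apply/cvg_ex; exists (u * Gamma u * mittag_leffler a (1 + u) `|x|).
    by apply: cvgM; [exact: cvg_cst|exact: c].
  by apply/funext => n; rewrite /series/= mulr_sumr.
split => //; apply: (cvg_unique (@Rhausdorff R) i2).
rewrite (_ : series _ = fun n => Gamma (1 + u) * series (fun n => x ^+ n / Gamma (1 + u + a * n%:R)) n).
  by apply: cvgM; [exact: cvg_cst|exact: c].
apply/funext => n; rewrite /series/= mulr_sumr; apply: eq_bigr => k _.
transitivity (\int[mu]_(t in uu) (u * x ^+ k / Gamma (1 + a * k%:R) * g k t)).
  by apply: eq_Rintegral => t; rewrite inE/= in_itv/= => /andP[t0 _]; rewrite fE.
rewrite (RintegralZl _ muu (iG k)).
have -> : \int[mu]_(t in uu) g k t = Gamma (1 + a * k%:R) * Gamma u / Gamma (1 + u + a * k%:R).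
  by apply: EFin_inj; rewrite -(EFin_Rintegral muu (iG k)).
by rewrite eG (addrC 1 u) GammaD1//; ring.
Qed.

(** With T = x^(1 / a) one has (x t^a)^(1 / a) = T t, so the exponential part of F (x t^a) is e^(T
    t) / a and the two averages above apply. *)
Lemma ML_remainderE (a b x : R) : 2^-1 <= a < 1 -> 1 < b -> 0 < x ->
  mu.-integrable uu (EFin \o (fun t => (b - 1) * (1 - t) `^ (b - 1 - 1) *
    ((a * pi)^-1 * poisson_exp (a * pi) a^-1 ((x * t `^ a) `^ a^-1)))) /\
  ML_remainder a b x = (Gamma b)^-1 * \int[mu]_(t in uu) ((b - 1) * (1 - t) `^ (b - 1 - 1) *
    ((a * pi)^-1 * poisson_exp (a * pi) a^-1 ((x * t `^ a) `^ a^-1))).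
Proof.
move=> a01 b1 x0; case/andP: (a01) => ah a1.
have a0 : 0 < a by apply: lt_le_trans ah.
pose u := b - 1; have u0 : 0 < u by rewrite subr_gt0.
have bE : b = 1 + u by rewrite /u; ring.
have gb : 0 < Gamma b by rewrite Gamma_gt0// (lt_trans _ b1).
have gu : 0 < Gamma u by rewrite Gamma_gt0.
pose T := x `^ a^-1; have T0 : 0 < T by rewrite powR_gt0.
have TE t : 0 < t -> (x * t `^ a) `^ a^-1 = T * t.
  by move=> t0; rewrite powRM ?powR_ge0 ?(ltW x0)// -powRrM divff ?gt_eqF// powRr1// ltW.
pose E1 t := u * (1 - t) `^ (u - 1) * expR (T * t).
have mE : measurable_fun uu E1 by rewrite /E1; mfun.
have hE := integral_beta_expR u0 T0.
have iE : mu.-integrable uu (EFin \o E1).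
  apply: (ge0_integral_eq_integrable (m := mu) mE _ hE) => t _.
  by rewrite !mulr_ge0 ?powR_ge0 ?expR_ge0// ltW.
have eE : \int[mu]_(t in uu) E1 t = u * expR T * T `^ (- u) * incomplete_gamma u T.
  by apply: EFin_inj; rewrite -(EFin_Rintegral muu iE).
have [iM eM] := beta_average_mittag_leffler x a0 u0.
have iEa := integrableZ muu a^-1 iE.
have e t : uu t -> (b - 1) * (1 - t) `^ (b - 1 - 1) * ((a * pi)^-1 * poisson_exp (a * pi) a^-1 ((x * t `^ a) `^ a^-1)) =
    a^-1 * E1 t - u * (1 - t) `^ (u - 1) * mittag_leffler a 1 (x * t `^ a).
  rewrite /= in_itv/= => /andP[t0 _]; rewrite -/u TE// -mittag_leffler_posE ?mulr_gt0//.
  have -> : (T * t) `^ a = x * t `^ a.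
    by rewrite -TE// -powRrM mulVf ?gt_eqF// powRr1// mulr_ge0 ?powR_ge0// ltW.
  by rewrite /E1; ring.
split.
  have := integrableBr muu iEa iM.
  by apply: eq_integrable; [exact: muu|move=> t; rewrite inE => ut /=; rewrite e].
rewrite (_ : \int[mu]_(t in uu) _ = \int[mu]_(t in uu) (a^-1 * E1 t - u * (1 - t) `^ (u - 1) * mittag_leffler a 1 (x * t `^ a))); last first.
  by apply: eq_Rintegral => t; rewrite inE => ut; rewrite e.
rewrite (RintegralB muu iEa iM) (RintegralZl _ muu iE) eE eM -bE.
have gE : Gamma b = u * Gamma u by rewrite bE addrC GammaD1.
rewrite /ML_remainder -/u -/T.
have -> : x `^ ((1 - b) / a) = T `^ (- u) by rewrite -powRrM; congr (_ `^ _); rewrite /u; field; rewrite gt_eqF.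
rewrite gE in gb *; field.
by rewrite !gt_eqF.
Qed.

End beta_average.

(** * From alternating differences to derivatives *)

Section smooth_functions.
Variable R : realType.
Local Notation mu := (@lebesgue_measure R).
Local Notation oy := (`]0%R, +oo[%classic : set R).
Local Notation uu := (`]0%R, 1%R[%classic : set R).
Local Notation moy := (@measurable_oy R).
Implicit Types (f g : R -> R) (n : nat).

(** Derivatives are existential witnesses, prescribed on the half-line only: closure under sums and
    products becomes a plain induction, and values at x <= 0 do not interfere. *)
Fixpoint smooth n f : Prop :=
  if n is n'.+1 then exists g, (forall x : R, 0 < x -> is_derive x 1 f (g x)) /\ smooth n' g else True.

Lemma near_eq_is_derive f g (x d : R) : (\forall y \near x, f y = g y) -> is_derive x 1 f d -> is_derive x 1 g d.
Proof.
move=> fg [df <-]; apply: DeriveDef; first exact: near_eq_derivable df.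
by apply/esym; apply: near_eq_derive => //; exact: oner_neq0.
Qed.

Lemma eq_smooth n f g : (forall x : R, 0 < x -> f x = g x) -> smooth n f -> smooth n g.
Proof.
case: n => [//|n] fg [d [hd sd]]; exists d; split => // x x0.
apply: near_eq_is_derive (hd x x0); near=> y; apply: fg; near: y; exact: lt_nbhsr.
Unshelve. all: by end_near. Qed.

Lemma smoothS n f : smooth n.+1 f -> smooth n f.
Proof.
by elim: n f => [//|n IH] f [g [fg sg]]; exists g; split => //; exact: IH.
Qed.

Lemma smoothC n (c : R) : smooth n (fun=> c).
Proof.
by elim: n c => [//|n IH] c; exists (fun=> 0); split => // x _; exact: is_derive_fC.
Qed.

Lemma smoothD n f g : smooth n f -> smooth n g -> smooth n (fun x => f x + g x).
Proof.
elim: n f g => [//|n IH] f g [f' [hf sf]] [g' [hg sg]]; exists (fun x => f' x + g' x).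
by split; [move=> x x0; exact: is_derive_fD (hf x x0) (hg x x0)|exact: IH].
Qed.

Lemma smoothM n f g : smooth n f -> smooth n g -> smooth n (fun x => f x * g x).
Proof.
elim: n f g => [//|n IH] f g sf sg; have sf1 := smoothS sf; have sg1 := smoothS sg.
move: sf sg => [f' [hf sf]] [g' [hg sg]]; exists (fun x => f' x * g x + f x * g' x).
by split; [move=> x x0; exact: is_derive_fM (hf x x0) (hg x x0)|apply: smoothD; exact: IH].
Qed.

Lemma smooth_powR n (p : R) : smooth n (fun x => x `^ p).
Proof.
elim: n p => [//|n IH] p; exists (fun x => p * x `^ (p - 1)).
split; first by move=> x x0; exact: is_derive_fpowR.
by apply: smoothM; [exact: smoothC|exact: IH].
Qed.

Lemma smooth_expR_powR n (k p : R) : smooth n (fun x => expR (k * x `^ p)).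
Proof.
elim: n => [//|n IH]; exists (fun x => expR (k * x `^ p) * (k * (p * x `^ (p - 1)))); split.
  move=> x x0; exact: (is_derive_fcomp (f := expR) (g := fun x => k * x `^ p) (is_derive_expR _) (is_derive_fZ k (is_derive_fpowR p x0))).
apply: smoothM => //; apply: smoothM; first exact: smoothC.
by apply: smoothM; [exact: smoothC|exact: smooth_powR].
Qed.

Lemma smooth_entire n (c : R ^nat) : entire_coef c -> smooth n (fun x => limn (pseries c x)).
Proof.
elim: n c => [//|n IH] c ec; exists (fun x => limn (pseries (pseries_diffs c) x)).
by split; [move=> x _; exact: is_derive_entire|apply: IH; exact: entire_coef_diffs].
Qed.

Lemma is_derive_incomplete_gamma (u x : R) : 0 < u -> 0 < x ->
  is_derive x 1 (incomplete_gamma u) (x `^ (u - 1) * expR (- x)).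
Proof.
move=> u0 x0; have xx : x < x + 1 by rewrite ltrDl.
have h := @continuous_FTC1 R (fun t => t `^ (u - 1) * expR (- t)) (BRight 0) x (x + 1) xx.
have [|||d e] := h.
- apply: (integrableS moy) (integrable_gamma u0) => //.
  by move=> t; rewrite /= !in_itv/= andbT => /andP[].
- by first [exact: x0|rewrite lte_fin|rewrite bnd_simp lte_fin].
- apply: cvgM; first exact: continuous_powR.
  apply: (cvg_comp (fun t : R => - t) expR); last exact: continuous_expR.
  by apply: cvgN; exact: cvg_id.
apply: DeriveDef; first exact: d.
by rewrite -derive1E; exact: e.
Qed.

(** Derivability of all orders is read off the closed form instead of being drawn from Bernstein's
    theorem. The incomplete Gamma factor is differentiated once, after which only powers and
    exponentials occur in it. *)
Lemma smooth_ML_remainder n (a b : R) : 0 < a -> 1 < b -> smooth n (ML_remainder a b).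
Proof.
move=> a0 b1; have u0 : 0 < b - 1 by rewrite subr_gt0.
apply: (eq_smooth (f := fun x => x `^ ((1 - b) / a) * (expR (1 * x `^ a^-1) *
   (incomplete_gamma (b - 1) (x `^ a^-1) * (a * Gamma (b - 1))^-1)) +
   -1 * limn (pseries (fun n => (Gamma (b + a * n%:R))^-1) x))).
  by move=> x x0; rewrite /ML_remainder mittag_lefflerE mul1r mulN1r !mulrA.
apply: smoothD; last first.
  apply: smoothM; first exact: smoothC.
  by apply: smooth_entire; apply: entire_coef_mittag_leffler => //; exact: ltW.
apply: smoothM; first exact: smooth_powR.
apply: smoothM; first exact: smooth_expR_powR.
apply: smoothM; last exact: smoothC.
case: n => [//|n]; exists (fun x => ((x `^ a^-1) `^ (b - 1 - 1) * expR (-1 * x `^ a^-1)) * (a^-1 * x `^ (a^-1 - 1))); split.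
  move=> x x0; rewrite mulN1r.
  apply: (is_derive_fcomp (f := incomplete_gamma (b - 1)) (g := fun x => x `^ a^-1)); last exact: is_derive_fpowR.
  by apply: is_derive_incomplete_gamma => //; rewrite powR_gt0.
apply: smoothM.
  apply: smoothM; last exact: smooth_expR_powR.
  by apply: (eq_smooth (f := fun x => x `^ (a^-1 * (b - 1 - 1)))); [move=> x _; rewrite powRrM|exact: smooth_powR].
by apply: smoothM; [exact: smoothC|exact: smooth_powR].
Qed.

(** - s g is the limit of k (s f(x) - s f(x + 1 / k)), and these quotients belong to the class. *)
Lemma alt_monotonic_derive f g (s : R) : (forall x : R, 0 < x -> is_derive x 1 f (g x)) ->
  alt_monotonic (fun x => s * f x) -> alt_monotonic (fun x => - s * g x).
Proof.
move=> fg cf.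
apply: (@alt_monotonic_lim _ (fun k x => k.+1%:R * (s * f x - s * f (x + k.+1%:R^-1)))).
  by move=> k; apply: alt_monotonicZ => //; apply: alt_monotonic_diff => //; rewrite invr_gt0.
move=> x x0.
rewrite (_ : (fun k => _) = (fun k => - s * ((k.+1%:R^-1)^-1 *: (f (k.+1%:R^-1 *: 1 + x) - f x)))); last first.
  apply/funext => k; rewrite invrK /GRing.scale/= mulr1 addrC [_ + x]addrC; ring.
apply: cvgM; first exact: cvg_cst.
have [df dE] := fg x x0; rewrite -dE.
have dc : h^-1 *: (f (h *: 1 + x) - f x) @[h --> 0^'] --> 'D_1 f x by exact: df.
move/cvgr_dnbhsP : dc; apply; split => [k|]; first by rewrite gt_eqF// invr_gt0.
exact: cvg_angle.
Qed.

Lemma alt_monotonic_completely_monotonic f : (forall n, smooth n f) -> alt_monotonic f -> completely_monotonic f.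
Proof.
move=> sf cf n x x0.
(* The sign [s] collects the factors -1, so that the induction can replace [f] by its derivative. *)
suff H : forall (s : R), alt_monotonic (fun x => s * f x) ->
    derivable (derive1n n f) x 1 /\ 0 <= s * (-1) ^+ n * derive1n n f x.
  have [//|d] := H 1; last by rewrite mul1r.
  by apply: eq_alt_monotonic cf => y _; rewrite mul1r.
elim: n f sf {cf} => [|n IH] f sf s cf.
  have [g [fg _]] := sf 1%N; split; first by have [] := fg x x0.
  by rewrite expr0 mulr1; exact: (cf [::]).
have dE g : (forall y : R, 0 < y -> is_derive y 1 f (g y)) -> forall y, 0 < y -> g y = derive1 f y.
  by move=> fg y y0; rewrite derive1E; have [_ ->] := fg y y0.
have [g [fg _]] := sf 1%N.
rewrite /derive1n iterSr -/(derive1n n (derive1 f)) exprS mulrA mulrN1.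
apply: (IH (derive1 f)).
  move=> m; have [g' [fg' sg']] := sf m.+1.
  exact: eq_smooth (dE _ fg') sg'.
apply: eq_alt_monotonic (alt_monotonic_derive fg cf) => y y0.
by rewrite (dE _ fg).
Qed.

(** [ML_remainderE] writes it as a mixture over t of copies of F rescaled by t^a, each of the class
    because p = 1 / a lies in ]1, 2]. *)
Lemma completely_monotonic_ML_remainder (a b : R) : 2^-1 <= a < 1 -> 1 < b ->
  completely_monotonic (ML_remainder a b).
Proof.
move=> a01 b1; case/andP: (a01) => ah a1.
have a0 : 0 < a by apply: lt_le_trans ah.
have p12 : 1 < a^-1 <= 2.
  by rewrite invf_gt1// a1 -[leRHS]invrK lef_pV2 ?posrE ?invr_gt0.
apply: alt_monotonic_completely_monotonic.
  by move=> n; apply: smooth_ML_remainder.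
have gb : 0 < Gamma b by rewrite Gamma_gt0// (lt_trans _ b1).
apply: (eq_alt_monotonic (f := fun x => (Gamma b)^-1 * \int[mu]_(t in uu) ((b - 1) * (1 - t) `^ (b - 1 - 1) *
    ((a * pi)^-1 * poisson_exp (a * pi) a^-1 ((x * t `^ a) `^ a^-1))))).
  by move=> x x0; have [_ ->] := ML_remainderE a01 b1 x0.
apply: alt_monotonicZ; first by rewrite invr_ge0 ltW.
apply: (@alt_monotonic_integral _ _ _ mu uu (fun x t => (b - 1) * (1 - t) `^ (b - 1 - 1) *
    ((a * pi)^-1 * poisson_exp (a * pi) a^-1 ((x * t `^ a) `^ a^-1)))).
- exact: measurable_itv.
- by move=> x x0; have [] := ML_remainderE a01 b1 x0.
move=> t; rewrite /= in_itv/= => /andP[t0 _].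
apply: (alt_monotonicZ (f := fun x => (a * pi)^-1 * poisson_exp (a * pi) a^-1 ((x * t `^ a) `^ a^-1))).
  by rewrite mulr_ge0 ?powR_ge0// subr_ge0 ltW.
apply: alt_monotonicZ; first by rewrite invr_ge0 mulr_ge0 ?pi_ge0// ltW.
have ta : 0 < t `^ a by rewrite powR_gt0.
have := alt_monotonic_scale ta (alt_monotonic_poisson_exp p12).
by rewrite invrK [pi * a]mulrC; apply: eq_alt_monotonic => x _; rewrite [_ * x]mulrC.
Qed.

End smooth_functions.

(** * Stable and Beta laws *)

Section laws.
Context d (T : measurableType d) (R : realType) (P : probability T R).
Local Notation mu := (@lebesgue_measure R).
Local Notation oy := (`]0%R, +oo[%classic : set R).
Local Notation uu := (`]0%R, 1%R[%classic : set R).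
Local Notation moy := (@measurable_oy R).

(** Independence identifies the joint law with the product law on rectangles, hence everywhere, and
    Tonelli applies to the product law. *)
Lemma ge0_integral_independent (X Y : {RV P >-> R}) (f : R -> R -> R) :
  independent_rv P X Y ->
  measurable_fun [set: R * R] (fun z => f z.1 z.2) -> (forall x y, 0 <= f x y) ->
  (\int[P]_w (f (X w) (Y w))%:E = \int[P]_w \int[P]_v (f (X w) (Y v))%:E)%E.
Proof.
move=> XY mf f0.
pose g (z : R * R) := (f z.1 z.2)%:E.
have mg : measurable_fun [set: R * R] g by apply/measurable_EFinP.
have g0 z : (0 <= g z)%E by rewrite lee_fin.
have mZ : measurable_fun [set: T] (fun w => (X w, Y w)) by exact/measurable_fun_pair.
pose Z : {mfun T >-> (R * R)%type} := HB.pack (fun w => (X w, Y w)) (isMeasurableFun.Build _ _ _ _ _ mZ).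
rewrite -[LHS]/(\int[P]_w (g \o Z) w)%E -ge0_integral_distribution//.
rewrite (eq_measure_integral (distribution P X \x distribution P Y)%E); last first.
  move=> A mA _; apply/esym; apply: product_measure_unique mA => A1 A2 mA1 mA2.
  rewrite -[RHS]/(P (X @^-1` A1) * P (Y @^-1` A2))%E -XY//.
rewrite fubini_tonelli1// ge0_integral_distribution//; first last.
- by move=> x; exact: integral_ge0.
- exact: measurable_fun_fubini_tonelli_F.
apply: eq_integral => w _; rewrite /= /fubini_F.
rewrite (ge0_integral_distribution Y (f := fun y => g (X w, y)))//.
exact: measurableT_comp.
Qed.

(** The law is given by probabilities of sets, so [g] is cut into layers: it is the integral over s
    > 0 of the indicators of s < g, and both sides are compared level by level. *)
Lemma ge0_integral_beta1_law (c : R) (B : {RV P >-> R}) (g : R -> R) :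
  0 < c -> beta1_law P c B -> measurable_fun [set: R] g -> (forall t, 0 <= g t) ->
  (\int[P]_w (g (B w))%:E = \int[mu]_(t in uu) (c * (1 - t) `^ (c - 1) * g t)%:E)%E.
Proof.
move=> c0 hB mg g0.
have layer (k : R) : 0 <= k -> (\int[mu]_(s in oy) ((s < k)%R%:R : R)%:E = k%:E)%E.
  move=> k0; transitivity (\int[mu]_(s in oy) ((\1_`]0%R, k[%classic s : R))%:E)%E.
    apply: eq_integral => s; rewrite inE/= in_itv/= andbT => s0.
    rewrite indicE (_ : (s \in _) = (s < k))//.
    by apply/idP/idP; rewrite inE/= in_itv/= s0.
  rewrite integral_indic//.
  rewrite setIidl; last by move=> s; rewrite /= !in_itv/= andbT => /andP[].
  rewrite -[LHS]/(lebesgue_measure (`]0%R, k[%classic : set R)) lebesgue_measure_itv/= lte_fin; case: ltP => [_|k1]; first by rewrite sube0.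
  by have -> : k = 0 by apply/eqP; rewrite eq_le k0 k1.
have mlt (dS : measure_display) (S : measurableType dS) (h : S -> R) : measurable_fun setT h -> measurable_fun [set: S * R] (fun z => ((z.2 < h z.1)%R%:R : R)).
  move=> mh; apply: (measurableT_comp (f := fun b : bool => b%:R : R)) => //.
  apply: measurable_fun_ltr => //; exact: measurableT_comp.
transitivity (\int[P]_w \int[mu]_(s in oy) ((s < g (B w))%R%:R : R)%:E)%E.
  by apply: eq_integral => w _; rewrite layer.
rewrite (@tonelli_on _ _ _ _ R P mu setT oy (fun w s => (s < g (B w))%R%:R) measurableT moy); first last.
- by [].
- exact: (mlt _ _ (fun w => g (B w)) (measurableT_comp mg _)).
transitivity (\int[mu]_(s in oy) \int[mu]_(t in uu) (c * (1 - t) `^ (c - 1) * (s < g t)%R%:R)%:E)%E; last first.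
  rewrite (@tonelli_on _ _ _ _ R mu mu oy uu (fun s t => c * (1 - t) `^ (c - 1) * (s < g t)%R%:R) moy); first last.
  - by move=> s t _ _; rewrite !mulr_ge0 ?powR_ge0// ltW.
  - apply: measurable_funM; first by mfun.
    apply: (measurableT_comp (f := fun b : bool => b%:R : R)) => //.
    by apply: measurable_fun_ltr => //; exact: measurableT_comp.
  - exact: measurable_itv.
  apply: eq_integral => t _.
  rewrite ge0_integralZl_fin//; first last.
  - by rewrite mulr_ge0 ?powR_ge0// ltW.
  - apply: (measurableT_comp (f := fun b : bool => b%:R : R)) => //.
    by apply: measurable_fun_ltr => //; exact: measurable_cst.
  by rewrite layer// -EFinM.
apply: eq_integral => s _.
have mA : measurable [set t | s < g t].
  rewrite -[X in measurable X]setTI; exact: (measurable_fun_ltr (measurable_cst s) mg measurableT (Y := [set true])).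
transitivity (\int[P]_w ((\1_(B @^-1` [set t | s < g t]) w : R)%:E))%E.
  apply: eq_integral => w _; rewrite indicE (_ : (w \in _) = (s < g (B w)))//.
  by apply/idP/idP; rewrite inE.
have mBA : measurable (B @^-1` [set t | s < g t]).
  by rewrite -[X in measurable X]setTI; exact: measurable_funP.
transitivity (P (B @^-1` [set t | s < g t])); first by rewrite integral_indic// setIT.
rewrite hB// setIC integral_mkcondr/=; apply: eq_integral => t _.
rewrite patchE; case: ifPn => [|]; first by rewrite inE/= => ->; rewrite mulr1.
by rewrite notin_setE/= => /negP/negbTE ->; rewrite mulr0.
Qed.

End laws.

(** * Stable variables: negative moments and Laplace transforms *)

Section stable_laws.
Context d (T : measurableType d) (R : realType) (P : probability T R).
Local Notation mu := (@lebesgue_measure R).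
Local Notation oy := (`]0%R, +oo[%classic : set R).
Local Notation uu := (`]0%R, 1%R[%classic : set R).
Local Notation moy := (@measurable_oy R).

Lemma integral_probability_cst (r : R) : (\int[P]_w r%:E)%E = r%:E.
Proof. by have := expectation_cst P r; rewrite unlock. Qed.

(* A positive modification of almost surely positive variables: it makes the identities below hold everywhere. *)
Definition positive_version (x : R) : R := if 0 < x then x else 1.

Lemma positive_version_gt0 x : 0 < positive_version x.
Proof. by rewrite /positive_version; case: ifP. Qed.

Lemma measurable_positive_version : measurable_fun [set: R] positive_version.
Proof.
apply: measurable_fun_ifT => //; first by apply: measurable_fun_ltr => //; exact: measurable_cst.
Qed.

Lemma measurable_positive_RV (Z : {RV P >-> R}) : measurable_fun [set: T] (fun w => positive_version (Z w)).
Proof. exact: measurableT_comp measurable_positive_version _. Qed.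

Lemma std_positive_stable_ae (a : R) (Z : T -> R) : std_positive_stable P a Z ->
  {ae P, forall w, positive_version (Z w) = Z w}.
Proof.
rewrite /std_positive_stable /positive_version; case: ifP => _ => [|[+ _]].
  by apply: filterS => w ->; rewrite ltr01.
by apply: filterS => w ->.
Qed.

Lemma laplace_positive_version (a l : R) (Z : {RV P >-> R}) : std_positive_stable P a Z -> 0 <= l ->
  (\int[P]_w (expR (- (l * positive_version (Z w))))%:E = (expR (- (l `^ a)))%:E)%E.
Proof.
move=> hZ l0; have ae := std_positive_stable_ae hZ.
(* Index 1 is the degenerate case Z = 1; it arises for [Z1] when alpha = 1/2. *)
move: hZ; rewrite /std_positive_stable; case: ifP => [/eqP ->|_] hZ.
  transitivity (\int[P]_w (expR (- (l `^ 1)))%:E)%E; last first.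
    exact: integral_probability_cst.
  apply: ae_eq_integral => //.
  - by apply/measurable_EFinP; have := measurable_positive_RV Z => mZ; mfun.
  - apply: filterS hZ => w -> _; rewrite /positive_version ltr01 mulr1 powRr1//.
have [_ <-//] := hZ; rewrite unlock; apply: ae_eq_integral => //.
- by apply/measurable_EFinP; have := measurable_positive_RV Z => mZ; mfun.
- have mZ : measurable_fun [set: T] Z by [].
  by apply/measurable_EFinP; mfun.
- by apply: filterS ae => w ->.
Qed.

(** Gamma s times Z^(- s) is the integral of t^(s - 1) e^(- Z t); exchanged with the expectation, it
    becomes the integral of t^(s - 1) e^(- t^a), a Gamma integral at s / a. *)
Lemma stable_negative_moment (a s : R) (Z : {RV P >-> R}) : 0 < a -> 0 < s -> std_positive_stable P a Z ->
  (\int[P]_w (positive_version (Z w) `^ (- s))%:E = (Gamma (s / a) / (a * Gamma s))%:E)%E.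
Proof.
move=> a0 s0 hZ; have gs := Gamma_gt0 s0.
have mZ := measurable_positive_RV Z.
have mp (q : R) : measurable_fun [set: T] (fun w => positive_version (Z w) `^ q).
  by mfun.
have gE : (\int[P]_w (Gamma s * positive_version (Z w) `^ (- s))%:E = (Gamma (s / a) / a)%:E)%E.
  transitivity (\int[P]_w \int[mu]_(t in oy) (t `^ (s - 1) * expR (- (positive_version (Z w) * t)))%:E)%E.
    by apply: eq_integral => w _; rewrite integral_gamma_scale// positive_version_gt0.
  rewrite (@tonelli_on _ _ _ _ R P mu setT oy (fun w t => t `^ (s - 1) * expR (- (positive_version (Z w) * t))) measurableT moy); first last.
  - by move=> w t _ _; rewrite mulr_ge0 ?powR_ge0 ?expR_ge0.
  - apply: measurable_funM; first by mfun.
    have mZ1 := measurableT_comp mZ (@measurable_fst _ _ T R).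
    by mfun.
  rewrite -integral_gamma_powR//; apply: eq_integral => t; rewrite inE/= in_itv/= andbT => t0.
  rewrite ge0_integralZl_fin//; first last.
  - exact: powR_ge0.
  - by mfun.
  under eq_integral do rewrite mulrC.
  by rewrite (laplace_positive_version hZ (ltW t0)) -EFinM.
rewrite ge0_integralZl_fin// in gE; [|by move=> w _; exact: powR_ge0|exact: ltW].
have -> : (Gamma (s / a) / (a * Gamma s))%:E = ((Gamma s)^-1%:E * (Gamma (s / a) / a)%:E)%E.
  by rewrite -EFinM; congr EFin; field; rewrite !gt_eqF.
by rewrite -gE muleA -EFinM mulVf ?gt_eqF// mul1e.
Qed.

(** The moments of Z^(- a) are n! / Gamma (1 + a n), so the exponential series averages to E_(a,1)
    (- l), which [mittag_leffler_negE] rewrites as a Poisson integral. *)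
Lemma laplace_stable_powRN (a l : R) (Z : {RV P >-> R}) : 0 < a < 1 -> 0 < l -> std_positive_stable P a Z ->
  (\int[P]_w (expR (- (l * positive_version (Z w) `^ (- a))))%:E =
   ((a * pi)^-1 * poisson_exp (pi - a * pi) a^-1 (l `^ a^-1))%:E)%E.
Proof.
move=> a01 l0 hZ; case/andP: (a01) => a0 a1.
have mZ := measurable_positive_RV Z.
have mp (q : R) : measurable_fun [set: T] (fun w => positive_version (Z w) `^ q).
  by mfun.
pose g n w := positive_version (Z w) `^ (- (a * n%:R)).
have g0 n w : 0 <= g n w by exact: powR_ge0.
have v0 n : 0 < 1 + a * n%:R by rewrite ltr_wpDr ?mulr_ge0// ltW.
have ig n : (\int[P]_w (g n w)%:E)%E = (n`!%:R / Gamma (1 + a * n%:R))%:E.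
  (* The formula for negative moments asks for a positive exponent, which n = 0 does not give. *)
  case: n => [|n].
    rewrite mulr0 addr0 Gamma1 divr1 /g; under eq_integral do rewrite mulr0 oppr0 powRr0.
    exact: integral_probability_cst.
  have s0 : 0 < a * n.+1%:R by rewrite mulr_gt0.
  rewrite (stable_negative_moment a0 s0 hZ) (mulrC a) mulfK ?gt_eqF// Gamma_natS addrC GammaD1; last by rewrite mulrC.
  have gs := Gamma_gt0 s0; rewrite (mulrC a) in gs *.
  rewrite factS natrM; congr EFin; move: (n.+1%:R : R) gs (ltr0Sn R n) => k gs k0.
  by field; rewrite !gt_eqF.
have mg n : measurable_fun [set: T] (g n) by exact: mp.
have iG n : P.-integrable [set: T] (EFin \o g n).
  by apply: (ge0_integral_eq_integrable (m := P) (mg n) _ (ig n)) => w _; exact: g0.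
pose f n w := (- l) ^+ n / n`!%:R * g n w.
have mf n : measurable_fun [set: T] (f n) by apply: measurable_funM => //; exact: measurable_cst.
have eG n (k : R) : k / n`!%:R * (n`!%:R / Gamma (1 + a * n%:R)) = k / Gamma (1 + a * n%:R).
  by rewrite mulrA divfK// gt_eqF// ltr0n fact_gt0.
have Efn n : \int[P]_(w in [set: T]) g n w = n`!%:R / Gamma (1 + a * n%:R).
  by apply: EFin_inj; rewrite -(EFin_Rintegral measurableT (iG n)).
have cml z := @cvg_mittag_leffler _ a 1 z a0 (lexx 1).
have [||i1 i2] := @cvg_Rintegral_series _ _ R P setT measurableT f
  (fun w => expR (- (l * positive_version (Z w) `^ (- a)))) mf.
- move=> w _; set m := - (l * _).
  rewrite (_ : f ^~ w = exp_coeff m); first exact: is_cvg_series_exp_coeff.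
  apply/funext => n; rewrite /f /g /exp_coeff/= (_ : m = - l * positive_version (Z w) `^ (- a)); last by rewrite /m mulNr.
  have -> : positive_version (Z w) `^ (- (a * n%:R)) = (positive_version (Z w) `^ (- a)) ^+ n.
    by rewrite -mulNr powRrM powR_mulrn ?powR_ge0.
  by rewrite exprMn mulrAC.
- pose v n := l ^+ n / Gamma (1 + a * n%:R).
  have vE n : (v n)%:E = (\int[P]_w (l ^+ n / n`!%:R * g n w)%:E)%E.
    rewrite ge0_integralZl_fin//; last 1 first.
    + by rewrite divr_ge0 ?exprn_ge0// ltW.
    by rewrite ig -EFinM eG.
  apply: (@le_lt_trans _ _ (\sum_(0 <= n <oo) (v n)%:E)%E).
    apply: lee_nneseries => [n *|n *]; first by apply: integral_ge0 => t _; rewrite lee_fin.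
    rewrite vE; apply: ge0_le_integral => //.
    + by apply/measurable_EFinP; apply: measurableT_comp => //; exact: mf.
    + by apply/measurable_EFinP; apply: measurable_funM => //; exact: measurable_cst.
    + move=> w _; rewrite lee_fin /f normrM (ger0_norm (g0 n w)); apply: ler_wpM2r => //.
      by rewrite normrM normfV normrX normrN gtr0_norm// ger0_norm.
  apply: (@nneseries_lty _ v v) => //.
    by move=> n; rewrite /v divr_ge0 ?exprn_ge0 ?(ltW l0)// ltW// Gamma_gt0.
  by apply/cvg_ex; exists (mittag_leffler a 1 l); exact: cml.
rewrite (EFin_Rintegral measurableT i1); congr EFin.
have t0 : 0 < l `^ a^-1 by rewrite powR_gt0.
have lE : l = (l `^ a^-1) `^ a by rewrite -powRrM mulVf ?gt_eqF// powRr1// ltW.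
rewrite -mittag_leffler_negE// -lE; apply: (cvg_unique (@Rhausdorff R) i2).
rewrite (_ : series _ = series (fun n => (- l) ^+ n / Gamma (1 + a * n%:R))); first exact: cml.
congr series; apply/funext => n.
by rewrite /f (RintegralZl _ measurableT (iG n)) Efn eG.
Qed.

(** [Z2] is averaged first, for fixed [Z1]. Since pi - (1 - a) pi = a pi, the Poisson kernel already
    has the right angle, and the exponent is linear in [Z1]. The Laplace transform of [Z1], of index
    (1 - a) / a, then turns u^(1 / (1 - a)) into u^(1 / a). *)
Lemma laplace_W_var (a y : R) (Z1 Z2 : {RV P >-> R}) : 2^-1 <= a < 1 -> 0 < y ->
  std_positive_stable P ((1 - a) / a) Z1 -> std_positive_stable P (1 - a) Z2 -> independent_rv P Z1 Z2 ->
  (\int[P]_w (expR (- (y * W_var a Z1 Z2 w)))%:E =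
   (((1 - a) * pi)^-1 * poisson_exp (a * pi) a^-1 (y `^ a^-1))%:E)%E.
Proof.
move=> a01 y0 h1 h2 ind; case/andP: (a01) => ah a1.
have a0 : 0 < a by apply: lt_le_trans ah.
have r01 : 0 < 1 - a < 1 by apply/andP; split; lra.
case/andP: (r01) => r0 r1.
have d0 : 0 < a * pi < pi by rewrite mulr_gt0 ?pi_gt0//= -[ltRHS]mul1r ltr_pM2r// pi_gt0.
have mZ1 := measurable_positive_RV Z1; have mZ2 := measurable_positive_RV Z2.
have mp := measurable_positive_version.
pose f (x z : R) := expR (- (y * (positive_version x / positive_version z) `^ (1 - a))).
have f0 x z : 0 <= f x z by exact: expR_ge0.
have mf : measurable_fun [set: R * R] (fun z => f z.1 z.2).
  have m1 := measurableT_comp mp (@measurable_fst _ _ R R).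
  have m2 := measurableT_comp mp (@measurable_snd _ _ R R).
  by rewrite /f; mfun.
transitivity (\int[P]_w (f (Z1 w) (Z2 w))%:E)%E.
  apply: ae_eq_integral => //.
  - have m1 : measurable_fun [set: T] Z1 by []. have m2 : measurable_fun [set: T] Z2 by [].
    by apply/measurable_EFinP; rewrite /W_var; mfun.
  - by apply/measurable_EFinP; rewrite /f; mfun.
  - apply: filterS2 (std_positive_stable_ae h1) (std_positive_stable_ae h2) => w e1 e2 _.
    by rewrite /f e1 e2.
rewrite (ge0_integral_independent ind mf f0).
pose k := ((1 - a) * pi)^-1 : R; have k0 : 0 <= k by rewrite invr_ge0 mulr_ge0 ?pi_ge0 ?ltW.
pose c := y `^ (1 - a)^-1; have c0 : 0 < c by rewrite powR_gt0.
pose F w u := poisson 1 (a * pi) u * expR (- (c * u `^ (1 - a)^-1 * positive_version (Z1 w))).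
have F0 w u : 0 <= F w u by apply: mulr_ge0; [exact: poisson_ge0|exact: expR_ge0].
have mF w : measurable_fun oy (F w) by apply: measurable_funM; [exact: measurable_funTS (measurable_poisson _ _)|mfun].
transitivity (\int[P]_w (k%:E * \int[mu]_(u in oy) (F w u)%:E))%E.
  apply: eq_integral => w _; set x := positive_version (Z1 w).
  have x0 : 0 < x by exact: positive_version_gt0.
  have l0 : 0 < y * x `^ (1 - a) by rewrite mulr_gt0// powR_gt0.
  transitivity (\int[P]_v (expR (- (y * x `^ (1 - a) * positive_version (Z2 v) `^ (- (1 - a)))))%:E)%E.
    apply: eq_integral => v _; rewrite /f -/x -mulrA; congr ((expR (- (_ * _)))%:E).
    have z0 := positive_version_gt0 (Z2 v).
    rewrite powRM ?invr_ge0 ?(ltW x0) ?(ltW z0)//; congr (_ * _).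
    by rewrite -(powR_inv1 (ltW z0)) -powRrM mulN1r.
  rewrite (laplace_stable_powRN r01 l0 h2) EFinM; congr (_ * _)%E.
  have lE : (y * x `^ (1 - a)) `^ (1 - a)^-1 = c * x.
    by rewrite powRM ?powR_ge0 ?(ltW y0)// -powRrM mulfV ?gt_eqF// powRr1// ltW.
  have dE : pi - (1 - a) * pi = a * pi by ring.
  rewrite lE dE -(EFin_Rintegral moy (integrable_poisson_exp _ d0 _)); last by rewrite mulr_ge0 ?ltW.
  by apply: eq_integral => u _; rewrite /F -/x; congr ((_ * expR _)%:E); ring.
transitivity (\int[P]_w \int[mu]_(u in oy) (k * F w u)%:E)%E.
  by apply: eq_integral => w _; rewrite ge0_integralZl_fin//; exact: mF.
rewrite (@tonelli_on _ _ _ _ R P mu setT oy (fun w u => k * F w u) measurableT moy); first last.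
- by move=> w u _ _; rewrite mulr_ge0.
- rewrite /F; apply: measurable_funM; first exact: measurable_cst.
  apply: measurable_funM; first exact: measurableT_comp (measurable_poisson 1 (a * pi)) measurable_snd.
  by have mZ := measurableT_comp mZ1 (@measurable_fst _ _ T R); mfun.
rewrite EFinM -(EFin_Rintegral moy (integrable_poisson_exp _ d0 _)); last exact: powR_ge0.
rewrite -ge0_integralZl_fin//; first last.
- by move=> u _; apply: mulr_ge0; [exact: poisson_ge0|exact: expR_ge0].
- by apply: measurable_funM; [exact: measurable_funTS (measurable_poisson _ _)|mfun].
apply: eq_integral => u; rewrite inE/= in_itv/= andbT => u0.
transitivity (\int[P]_w ((k * poisson 1 (a * pi) u) * expR (- (c * u `^ (1 - a)^-1 * positive_version (Z1 w))))%:E)%E.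
  by apply: eq_integral => w _; rewrite /F mulrA.
rewrite ge0_integralZl_fin//; first last.
- by apply: mulr_ge0 => //; exact: poisson_ge0.
- by mfun.
rewrite (laplace_positive_version h1) ?mulr_ge0 ?powR_ge0 ?(ltW c0)// -EFinM -mulrA.
congr ((_ * (_ * expR (- _)))%:E).
rewrite powRM ?powR_ge0 ?(ltW c0)// /c -!powRrM.
by congr (_ `^ _ * _ `^ _); rewrite mulrA mulVf ?mul1r// gt_eqF.
Qed.

Lemma ML_remainder_expectation (a b : R) (Z1 Z2 B : {RV P >-> R}) : 2^-1 <= a < 1 -> 1 < b ->
  std_positive_stable P ((1 - a) / a) Z1 -> std_positive_stable P (1 - a) Z2 -> independent_rv P Z1 Z2 ->
  beta1_law P (b - 1) B -> independent_rv P (W_var a Z1 Z2) B ->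
  forall x : R, 0 < x ->
  ((ML_remainder a b x)%:E = ((Gamma b)^-1 * (a^-1 - 1))%:E *
     'E_P[(fun w => expR (- (x * (W_var a Z1 Z2 w * B w `^ a))))])%E.
Proof.
move=> a01 b1 h1 h2 ind hB indB x x0; case/andP: (a01) => ah a1.
have a0 : 0 < a by apply: lt_le_trans ah.
have a10 : 0 < 1 - a by rewrite subr_gt0.
have u0 : 0 < b - 1 by rewrite subr_gt0.
have gb : 0 < Gamma b by rewrite Gamma_gt0// (lt_trans _ b1).
have m1 : measurable_fun [set: T] Z1 by [].
have m2 : measurable_fun [set: T] Z2 by [].
have mW : measurable_fun [set: T] (W_var a Z1 Z2) by rewrite /W_var; mfun.
pose W : {RV P >-> R} := HB.pack (W_var a Z1 Z2) (isMeasurableFun.Build _ _ _ _ _ mW).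
pose f (w t : R) := expR (- (x * (w * t `^ a))).
have f0 w t : 0 <= f w t by exact: expR_ge0.
have mf : measurable_fun [set: R * R] (fun z => f z.1 z.2) by rewrite /f; mfun.
have muu : measurable (uu : set (measurableTypeR R)) by exact: measurable_itv.
have [ipe ->] := ML_remainderE a01 b1 x0.
pose D t := (b - 1) * (1 - t) `^ (b - 1 - 1).
have D0 t : 0 <= D t by rewrite mulr_ge0 ?powR_ge0 ?ltW.
set I := \int[mu]_(t in uu) _ in ipe *.
(* The ratio a / (1 - a) compares the normalization 1 / ((1 - a) pi) of [laplace_W_var] with 1 / (a
   pi) in [ML_remainderE]; it is the inverse of the factor 1 / a - 1 of the claim. *)
suff -> : 'E_P[(fun w => expR (- (x * (W_var a Z1 Z2 w * B w `^ a))))]%E = (a / (1 - a) * I)%:E.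
  rewrite -EFinM; congr EFin; move: (I) gb => J; move: (Gamma b) => G G0.
  by field; rewrite !gt_eqF.
rewrite unlock -[LHS]/(\int[P]_w (f (W w) (B w))%:E)%E (@ge0_integral_independent _ _ _ P W B f indB mf f0).
transitivity (\int[P]_w \int[mu]_(t in uu) (D t * f (W w) t)%:E)%E.
  apply: eq_integral => w _; rewrite (ge0_integral_beta1_law (g := f (W w)) u0 hB)//.
  by rewrite /f; mfun.
rewrite (@tonelli_on _ _ _ _ R P mu setT uu (fun w t => D t * f (W w) t) measurableT muu); first last.
- by move=> w t _ _; rewrite mulr_ge0.
- by rewrite /D /f; have mWW := measurableT_comp mW (@measurable_fst _ _ T R); mfun.
rewrite EFinM -(EFin_Rintegral muu ipe).
have pe0 t : 0 <= poisson_exp (a * pi) a^-1 t.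
  apply: poisson_exp_ge0.
  by rewrite mulr_gt0 ?pi_gt0//= -[ltRHS]mul1r ltr_pM2r// pi_gt0.
rewrite -ge0_integralZl_fin//; first last.
- by rewrite divr_ge0 ?ltW.
- by move=> t _; rewrite mulr_ge0 ?D0// mulr_ge0 ?pe0// invr_ge0 mulr_ge0 ?pi_ge0 ?ltW.
- exact: (integrable_mfun ipe).
apply: eq_integral => t; rewrite inE/= in_itv/= => /andP[t0 t1].
have ta : 0 < x * t `^ a by rewrite mulr_gt0// powR_gt0.
rewrite ge0_integralZl_fin//; last by rewrite /f; mfun.
transitivity ((D t)%:E * \int[P]_w (expR (- (x * t `^ a * W_var a Z1 Z2 w)))%:E)%E.
  by congr (_ * _)%E; apply: eq_integral => w _; rewrite /f; congr ((expR _)%:E); rewrite [W w * _]mulrC mulrA.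
rewrite (laplace_W_var a01 ta h1 h2 ind) -EFinM /D; congr EFin.
have p0 := pi_gt0 R; move: (pi : R) p0 => p p0.
by field; rewrite !gt_eqF.
Qed.

End stable_laws.

Theorem mainTheorem5 (R : realType) (alpha beta : R)
    (halpha : 2^-1 <= alpha < 1) (hbeta : 1 < beta) :
  completely_monotonic (ML_remainder alpha beta) /\
  (forall (d : measure_display) (T : measurableType d) (P : probability T R)
          (Z1 Z2 B : {RV P >-> R}),
     std_positive_stable P ((1 - alpha) / alpha) Z1 ->
     std_positive_stable P (1 - alpha) Z2 ->
     independent_rv P Z1 Z2 ->
     beta1_law P (beta - 1) B ->
     independent_rv P (W_var alpha Z1 Z2) B ->
     forall x : R, 0 < x ->
       (ML_remainder alpha beta x)%:E =
       (((Gamma beta)^-1 * (alpha^-1 - 1))%:E *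
        'E_P[(fun w => expR (- (x * (W_var alpha Z1 Z2 w * B w `^ alpha))))])%E).
Proof.
split; first exact: completely_monotonic_ML_remainder.
by move=> d T P Z1 Z2 B h1 h2 h12 hB hWB; exact: ML_remainder_expectation.
Qed.
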